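(* Let $d\ge 2$ be a fixed integer. There exist constants $c_1,c_2,K,K'>0$ depending only on $d$ such that, for every function $p=p(q)\in[0,1]$ defined on prime powers $q$, the following hold, where each probability tends to $1$ as $q\to\infty$ along any infinite set of prime powers on which $p(q)$ satisfies the indicated range condition: (a) if $q^{-d}(\log q)^{K}\le p\le q^{-d+1/d}(\log q)^{-K}$, then with probability tending to $1$, $c_1\,pq^d\le \alpha(\mathbb{F}_q^d,p)\le c_2\,pq^d$; (b) if $q^{-d+1/d}(\log q)^{-K}\le p\le q^{-1+1/d}(\log q)^{K}$, then with probability tending to $1$, $q^{1/d}(\log q)^{-K'}\le \alpha(\mathbb{F}_q^d,p)\le q^{1/d}(\log q)^{K'}$; (c) if $q^{-1+1/d}(\log q)^{K}\le p\le 1$, then with probability tending to $1$, $c_1\,pq\le \alpha(\mathbb{F}_q^d,p)\le c_2\,pq$.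
   Context: $\mathbb{F}_q$ is the finite field with $q$ elements. A $k$-flat of $\mathbb{F}_q^d$ is a $k$-dimensional affine subspace. A point set $P\subseteq\mathbb{F}_q^d$ is in general position if no $k+2$ points of $P$ lie in a $k$-flat, for any $1\le k\le d-1$. For $p\in[0,1]$, let $\mathbf{S}_p\subseteq\mathbb{F}_q^d$ be the random subset obtained by including each point of $\mathbb{F}_q^d$ independently with probability $p$; $\alpha(\mathbb{F}_q^d,p)$ is the (random) maximum size of a subset of $\mathbf{S}_p$ in general position. *)

(* Defs.v *)
From mathcomp Require Import all_boot all_order all_algebra.
From mathcomp Require Import all_classical all_reals all_analysis.
Set Implicit Arguments.
Unset Strict Implicit.
Unset Printing Implicit Defensive.
Import Order.TTheory GRing.Theory Num.Theory.
Import numFieldNormedType.Exports.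
Local Open Scope classical_set_scope.
Local Open Scope ring_scope.

Definition prime_powers : set nat :=
  [set q | exists l n : nat, [/\ prime l, (0 < n)%N & q = (l ^ n)%N]].

(* The direction of a flat is the row space of a square matrix U, so its
   dimension is the rank of U. *)
Definition is_flat (F : finFieldType) (d k : nat) (A : {set 'rV[F]_d}) : bool :=
  [exists a : 'rV[F]_d, exists U : 'M[F]_d,
    (\rank U == k) && (A == [set x | (x - a <= U)%MS]%SET)].

(* The quantification over k : 'I_d with 0 < k is the range 1 <= k <= d - 1. *)
Definition general_position (F : finFieldType) (d : nat)
    (P : {set 'rV[F]_d}) : bool :=
  [forall k : 'I_d, (0 < k)%N ==>
    [forall A : {set 'rV[F]_d}, is_flat k A ==>
      ~~ [exists T : {set 'rV[F]_d},
            [&& T \subset P, T \subset A & #|T| == k.+2]]]].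

Definition alpha (F : finFieldType) (d : nat) (S : {set 'rV[F]_d}) : nat :=
  \max_(P : {set 'rV[F]_d} | (P \subset S) && general_position P) #|P|.

(* The law of the random subset of T containing each point independently with
   probability p. *)
Definition random_subset_prob (R : realType) (T : finType) (p : R)
    (E : pred {set T}) : R :=
  \sum_(S : {set T} | E S) \prod_(x : T) (if x \in S then p else 1 - p).

(* u tends to 1 along every infinite set of prime powers satisfying D. *)
Definition tends_to_1_along (R : realType) (D : nat -> Prop) (u : nat -> R) :
    Prop :=
  forall Q : set nat, infinite_set Q ->
    (forall q, Q q -> prime_powers q /\ D q) ->
    u q @[q --> within Q \oo] --> (1 : R).

(* Main.v *)
(** Under x |-> (1, x), flats become subspaces, and a set of more than d points
    is in general position iff the images of any d + 1 of its points are
    independent.  The lower bounds come from deleting a point of each dependent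
    (d+1)-tuple of the random set (range (a)), from the moment curve (range (c)),
    and, since P(alpha >= x) increases with p, from the endpoint of (a) in the
    range (b); the upper bound in (b) is likewise the one at the endpoint of (c).

    The upper bound in (c) is a union bound over containers: exp(O(q^(1/d) ln^2 q))
    sets of size O(q) such that each set in general position lies in one of them.
    They are obtained by shrinking the whole space O(ln q) times by a constant
    factor.  Let A have n >= C q points.  If a hyperplane holds a positive
    proportion of A, a set in general position keeps at most d of its points.
    Otherwise, typical d-tuples of A span hyperplanes with about n/q points of A,
    and we need a measure on the (d+1)-tuples of A carrying a minimal linear
    relation, of total mass about n^d, whose marginal along each coordinate is at
    most 1 and whose values are O(q/n).  Inside a typical hyperplane take the
    subspace that is extremal for the number of points against the dimension: no
    proper subspace captures much of it, so its generic points are full-support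
    combinations of a generic basis.  For some g, this gives a positive proportion
    of all g-tuples, the windows, from which relations are built: two overlapping
    windows yield a relation on g + 1 up to 2 g - 1 points, and replacing one of
    its points by a combination of another window through it adds g - 1 points, so
    that exactly d + 1 points can be reached. *)
Require Import Defs.
From mathcomp Require Import all_boot all_order all_algebra perm.
From mathcomp Require Import ring lra zify.
Set Implicit Arguments.
Unset Strict Implicit.
Unset Printing Implicit Defensive.
Import Order.TTheory GRing.Theory Num.Theory.
Local Open Scope ring_scope.

(** * The container lemma *)

Section Tuples.
Variables (R : realFieldType) (T : finType).

(** Counting dependent tuples would not suffice for the containers: if a relation misses a
    coordinate, that coordinate is free, and the marginal along it can be as large as the number of
    points. So only relations with all coefficients nonzero are used, each weighted by the inverse
    of the number of points of A in its span. Once all coordinates but one are fixed, the last one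
    lies in the span of the others, which is the whole span; every marginal is then at most 1,
    however A is distributed on flats. Attaching a window convolves two such measures and keeps this
    bound, and the values are O(q/n) because the spans hold at least a constant times n/q points.
    Marginals at most 1 control the degrees of all proper sub-tuples at once; only full tuples need
    the bound O(q/n). With fingerprints of size O(t) both conditions fit as soon as q <= t^d, whence
    t = q^(1/d). The two logarithms in the number of containers come from the number of rounds and
    from choosing each fingerprint point among q^d points. The constant kappa = 1/(2d) recurs: a
    genericity step excludes at most d proper subspaces, and half of the points must survive. *)

Definition fcons s (v : T) (f : {ffun 'I_s -> T}) : {ffun 'I_s.+1 -> T} :=
  [ffun i => oapp f v (unlift ord0 i)].

Lemma fcons0 s v (f : {ffun 'I_s -> T}) : fcons v f ord0 = v.
Proof. by rewrite ffunE unlift_none. Qed.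

Lemma fconsS s v (f : {ffun 'I_s -> T}) j : fcons v f (lift ord0 j) = f j.
Proof. by rewrite ffunE liftK. Qed.

Lemma sum_fcons s (G : {ffun 'I_s.+1 -> T} -> R) :
  \sum_h G h = \sum_v \sum_f G (fcons v f).
Proof.
rewrite pair_big /= (reindex (fun p : T * {ffun 'I_s -> T} => fcons p.1 p.2)) //=.
exists (fun h => (h ord0, [ffun j => h (lift ord0 j)])).
  move=> [v f] _ /=; rewrite fcons0; congr pair.
  by apply/ffunP=> j; rewrite ffunE fconsS.
move=> h _ /=; apply/ffunP=> i; rewrite ffunE.
by case: unliftP => [j|] -> //=; rewrite ffunE.
Qed.

Definition agree s (P : {set 'I_s}) (f g : {ffun 'I_s -> T}) : bool :=
  [forall i in P, f i == g i].

Lemma agree_sym s (P : {set 'I_s}) f g : agree P f g = agree P g f.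
Proof. by apply/eq_forallb_in => i _; rewrite eq_sym. Qed.

Definition degree s (W : {ffun 'I_s -> T} -> R) P g := \sum_(f | agree P f g) W f.

(** The codegree condition of hypergraph containers at scale [x]: each free coordinate accounts for
    a factor [x]. For [P = setT] it bounds the values of [W] by [C]. *)
Definition degree_bounded s (W : {ffun 'I_s -> T} -> R) (C x : R) :=
  forall P g, P != set0 -> degree W P g <= C * x ^+ (s - #|P|).

Definition lift_set s (P : {set 'I_s}) : {set 'I_s.+1} := [set lift ord0 i | i in P].

Lemma card_lift_set s (P : {set 'I_s}) : #|lift_set P| = #|P|.
Proof. by rewrite card_imset //; exact: lift_inj. Qed.

Lemma agree_lift s (P : {set 'I_s}) v f w g :
  agree (lift_set P) (fcons v f) (fcons w g) = agree P f g.
Proof.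
apply/forall_inP/forall_inP => H i iP.
  by have := H (lift ord0 i); rewrite !fconsS; apply; apply: imset_f.
by case/imsetP: iP => j jP ->; rewrite !fconsS; apply: H.
Qed.

Lemma agree_lift0 s (P : {set 'I_s}) v f w g :
  agree (ord0 |: lift_set P) (fcons v f) (fcons w g) = (v == w) && agree P f g.
Proof.
rewrite -(agree_lift P v f w g); apply/forall_inP/andP => [H|[/eqP -> /forall_inP H] i].
  split; first by have := H ord0; rewrite !fcons0 setU11; apply.
  by apply/forall_inP=> i iP; apply: H; rewrite inE iP orbT.
by rewrite !inE => /orP[/eqP->|]; [rewrite !fcons0|apply: H].
Qed.

Lemma degree_lift s (W : {ffun 'I_s.+1 -> T} -> R) P w g :
  degree W (lift_set P) (fcons w g) = \sum_v \sum_(f | agree P f g) W (fcons v f).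
Proof.
rewrite /degree big_mkcond sum_fcons; apply: eq_bigr => v _.
by rewrite [RHS]big_mkcond; apply: eq_bigr => f _; rewrite agree_lift.
Qed.

Lemma degree_lift0 s (W : {ffun 'I_s.+1 -> T} -> R) P w g :
  degree W (ord0 |: lift_set P) (fcons w g) = \sum_(f | agree P f g) W (fcons w f).
Proof.
rewrite /degree big_mkcond sum_fcons (bigD1 w) //= [X in _ + X]big1 ?addr0.
  by rewrite [RHS]big_mkcond; apply: eq_bigr => f _; rewrite agree_lift0 eqxx.
by move=> v /negPf vw; rewrite big1 // => f _; rewrite agree_lift0 vw.
Qed.

End Tuples.

Section Level.
Variables (R : realFieldType) (T : finType) (A : {set T}) (s : nat).
Variables (W : {ffun 'I_s.+2 -> T} -> R) (C x : R).
Hypothesis W0 : forall h, 0 <= W h.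
Hypothesis C0 : 0 < C.
Hypothesis x0 : 0 < x.
Hypothesis Wdeg : degree_bounded W C x.

(* Tuples that contain a saturated sub-tuple are skipped when links are added, which
   caps the degrees of the accumulated hypergraph. *)
Definition saturated (W' : {ffun 'I_s.+1 -> T} -> R) f :=
  [exists P : {set 'I_s.+1}, (P != set0) && (C * x ^+ (s.+1 - #|P|) <= degree W' P f)].

Definition add_link v (W' : {ffun 'I_s.+1 -> T} -> R) f :=
  W' f + (if saturated W' f then 0 else W (fcons v f)).

Definition links (sigma : seq T) := foldr add_link (fun=> 0) sigma.

Definition unsaturated_mass W' v := \sum_(f | ~~ saturated W' f) W (fcons v f).

Lemma links_ge0 sigma f : 0 <= links sigma f.
Proof. by elim: sigma f => //= v sg IH f; rewrite /add_link addr_ge0 //; case: ifP. Qed.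

(** A sub-tuple that has reached the threshold is frozen, since every tuple through it is saturated.
    One below the threshold gains at most [C * x ^+ (s.+1 - #|P|)] from the link of [v], by the
    bound on [W] at the sub-tuple enlarged by [v]. So twice the threshold is never exceeded. *)
Lemma links_degree sigma : degree_bounded (links sigma) (2 * C) x.
Proof.
move=> P g P0; have cx k : 0 <= C * x ^+ k by rewrite mulr_ge0 ?exprn_ge0 // ltW.
elim: sigma => [|v sg IH] /=.
  by rewrite /degree big1 // -mulrA mulr_ge0.
have [sat|] := leP (C * x ^+ (s.+1 - #|P|)) (degree (links sg) P g).
  suff -> : degree (add_link v (links sg)) P g = degree (links sg) P g by [].
  apply: eq_bigr => f Pfg; rewrite /add_link ifT ?addr0 //.
  apply/existsP; exists P; rewrite P0 /=; suff -> : degree (links sg) P f = degree (links sg) P g by [].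
  apply: eq_bigl => h; apply/forall_inP/forall_inP => H i iP; rewrite (eqP (H i iP)).
    exact: (forall_inP Pfg).
  by rewrite eq_sym (forall_inP Pfg).
move=> /ltW unsat; rewrite -mulrA mulr_natl mulr2n /degree big_split lerD //.
have P'0 : ord0 |: lift_set P != set0 by apply/set0Pn; exists ord0; rewrite setU11.
have := Wdeg (fcons v g) P'0.
rewrite cardsU1 card_lift_set; have -> : ord0 \in lift_set P = false.
  by apply/imsetP => -[j _ /eqP]; rewrite (negPf (neq_lift _ _)).
rewrite degree_lift0 subSS; apply: le_trans.
by apply: ler_sum => f _; case: ifP.
Qed.

Lemma links_supp sigma f : links sigma f != 0 -> exists2 v, v \in sigma & W (fcons v f) != 0.
Proof.
elim: sigma => [|v sg IH] /=; first by rewrite eqxx.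
rewrite /add_link; have [->|/IH[w ws Wf] _] := eqVneq (links sg f) 0.
  rewrite add0r; case: ifP => [_|_ Wf]; first by rewrite eqxx.
  by exists v; rewrite ?mem_head.
by exists w; rewrite // inE ws orbT.
Qed.

Variable z : R.

Fixpoint valid (I : {set T}) (sigma : seq T) :=
  if sigma is v :: sg then
    [&& v \in I, z * x ^+ s.+1 <= unsaturated_mass (links sg) v & valid I sg] else true.

Lemma valid_mem I sigma : valid I sigma -> {subset sigma <= I}.
Proof.
elim: sigma => //= v sg IH /and3P[vI _ /IH H] w; rewrite inE => /orP[/eqP->//|].
exact: H.
Qed.

Lemma valid_mass I sigma : valid I sigma ->
  (size sigma)%:R * (z * x ^+ s.+1) <= \sum_f links sigma f.
Proof.
elim: sigma => [|v sg IH] /=; first by rewrite mul0r big1.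
move=> /and3P[vI Hm /IH H]; rewrite -add1n natrD mulrDl mul1r addrC.
rewrite big_split lerD //; apply: le_trans Hm _; rewrite /unsaturated_mass big_mkcond /=.
by apply: ler_sum => f _; case: saturated.
Qed.

(** Sum over the point at coordinate 0. Against [valid_mass], this bounds the length of a valid
    sequence. *)
Lemma mass_degree (W' : {ffun 'I_s.+1 -> T} -> R) D :
  (forall f, 0 <= W' f) -> (forall f, W' f != 0 -> f ord0 \in A) ->
  degree_bounded W' D x -> \sum_f W' f <= #|A|%:R * (D * x ^+ s).
Proof.
move=> W'0 W'A W'D; have [g _|no] := pickP (@predT {ffun 'I_s.+1 -> T}); last first.
  rewrite big_pred0 //; have [->|[a aA]] := set_0Vmem A; first by rewrite cards0 mul0r.
  by have := no [ffun=> a].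
rewrite (bigID (fun f : {ffun _ -> T} => f ord0 \in A)) /= [X in _ + X]big1 ?addr0; last first.
  by move=> f; apply: contraNeq => /W'A.
rewrite (partition_big (fun f : {ffun 'I_s.+1 -> T} => f ord0) (mem A)) //= -sum1_card natr_sum mulr_suml.
apply: ler_sum => a aA; rewrite mul1r.
have P0 : [set ord0] != set0 :> {set 'I_s.+1} by apply/set0Pn; exists ord0; rewrite inE.
have := W'D _ [ffun=> a] P0; rewrite cards1 subn1 /=; apply: le_trans.
rewrite /degree big_mkcond [leRHS]big_mkcond; apply: ler_sum => f _.
case: ifP => [/andP[_ /eqP fa]|_]; last by case: ifP.
by rewrite ifT //; apply/forall_inP => i; rewrite inE => /eqP ->; rewrite fa ffunE.
Qed.

(** There are at most 2^(s+1) sets [P] that can witness saturation; each is treated by Markov's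
    inequality and double counting. *)
Lemma saturated_mass (W' : {ffun 'I_s.+1 -> T} -> R) : (forall f, 0 <= W' f) ->
  \sum_v \sum_(f | saturated W' f) W (fcons v f) <= 2 ^+ s.+1 * (x * \sum_f W' f).
Proof.
move=> W'0.
have step P : P != set0 ->
    \sum_v \sum_(f | C * x ^+ (s.+1 - #|P|) <= degree W' P f) W (fcons v f) <= x * \sum_f W' f.
  move=> P0; set b := C * _; have b0 : 0 < b by rewrite mulr_gt0 ?exprn_gt0.
  have -> : x * \sum_f W' f = \sum_f W' f * (C * x ^+ (s.+2 - #|P|) / b).
    rewrite -mulr_suml mulrC; congr (_ * _); rewrite /b subSn ?exprS; last first.
      by rewrite (leq_trans (max_card _)) ?card_ord.
    by field; rewrite !gt_eqF ?exprn_gt0.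
  (* Markov: on the tuples saturated at [P], the factor [degree W' P f / b] is at least 1. *)
  have le1 : \sum_v \sum_(f | b <= degree W' P f) W (fcons v f) <=
             \sum_v \sum_f W (fcons v f) * (degree W' P f / b).
    apply: ler_sum => v _; rewrite big_mkcond; apply: ler_sum => f _; case: ifP => [le|_].
      by rewrite ler_peMr // ler_pdivlMr ?mul1r.
    by rewrite mulr_ge0 // divr_ge0 ?(ltW b0) // sumr_ge0.
  apply: le_trans le1 _.
  (* Expand the degree and exchange sums: for fixed [f'] there remains a degree of [W] at the lift
     of [P], which the hypothesis on [W] bounds. *)
  have -> : \sum_v \sum_f W (fcons v f) * (degree W' P f / b) =
            \sum_f' W' f' * (\sum_v (\sum_(f | agree P f f') W (fcons v f)) / b).
    rewrite (eq_bigr (fun v => \sum_f' \sum_(f | agree P f f') W (fcons v f) * (W' f' / b))); last first.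
      move=> v _; under eq_bigr do rewrite /degree mulr_suml mulr_sumr big_mkcond /=.
      rewrite exchange_big /=; apply: eq_bigr => f' _.
      by rewrite [RHS]big_mkcond; apply: eq_bigr => f _; rewrite agree_sym.
    rewrite exchange_big /=; apply: eq_bigr => f' _; rewrite mulr_sumr; apply: eq_bigr => v _.
    by rewrite -mulr_suml; ring.
  apply: ler_sum => f _; rewrite ler_wpM2l // -mulr_suml ler_pM2r ?invr_gt0 //.
  have [v _|no] := pickP (@predT T); last first.
    by rewrite big_pred0 // mulr_ge0 ?exprn_ge0 // ltW.
  rewrite -(degree_lift W P v f) -(card_lift_set P); apply: Wdeg.
  by rewrite -card_gt0 card_lift_set card_gt0.
have -> : 2 ^+ s.+1 * (x * \sum_f W' f) = \sum_(P : {set 'I_s.+1}) x * \sum_f W' f.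
  by rewrite sumr_const -cardsT -powersetT card_powerset cardsT card_ord -[RHS]mulr_natl natrX.
have xW : 0 <= x * \sum_f W' f by rewrite mulr_ge0 ?sumr_ge0 // ltW.
apply: (@le_trans _ _ (\sum_(P : {set 'I_s.+1} | P != set0)
    \sum_v \sum_(f | C * x ^+ (s.+1 - #|P|) <= degree W' P f) W (fcons v f))).
  rewrite [leRHS]exchange_big /=; apply: ler_sum => v _.
  rewrite (exchange_big_dep xpredT) //= [leLHS]big_mkcond; apply: ler_sum => f _.
  case: ifP => [/existsP[P PP]|_]; last exact: sumr_ge0.
  by rewrite (bigD1 P) //= lerDl sumr_ge0.
by rewrite big_mkcond; apply: ler_sum => P _; case: ifP => // /step.
Qed.

End Level.

Definition free_of (R : realFieldType) (T : finType) s (W : {ffun 'I_s -> T} -> R) (I : {set T}) :=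
  forall h, W h != 0 -> exists i, h i \notin I.

Section Greedy.
Variables (R : realFieldType) (T : finType) (A : {set T}) (s : nat).
Variables (W : {ffun 'I_s.+2 -> T} -> R) (C x z : R) (L : nat).
Hypothesis W0 : forall h, 0 <= W h.
Hypothesis WA : forall h, W h != 0 -> forall i, h i \in A.
Hypothesis C0 : 0 < C.
Hypothesis x0 : 0 < x.
Hypothesis z0 : 0 < z.
Hypothesis Wdeg : degree_bounded W C x.
Hypothesis HL : 2 * C / z * (#|A|%:R / x) <= L%:R.

Lemma links_memA sigma f : links W C x sigma f != 0 -> forall i, f i \in A.
Proof. by case/links_supp => v _ /WA H i; have := H (lift ord0 i); rewrite fconsS. Qed.

Lemma valid_size I sigma : valid W C x z I sigma -> (size sigma <= L)%N.
Proof.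
move=> /valid_mass; rewrite -(@ler_nat R) => H; apply: le_trans HL.
have := mass_degree (links_ge0 _ _ W0 _) (fun f H => links_memA H ord0) (links_degree W0 C0 x0 Wdeg sigma).
move=> /(le_trans H) le1.
have zx : 0 < z * x ^+ s.+1 by rewrite mulr_gt0 ?exprn_gt0.
rewrite -(ler_pM2r zx) (le_trans le1) // le_eqVlt; apply/orP; left; apply/eqP.
by rewrite exprS; field; rewrite !gt_eqF.
Qed.

Lemma greedy (I : {set T}) : exists2 sigma, valid W C x z I sigma &
  forall v, v \in I -> unsaturated_mass W C x (links W C x sigma) v < z * x ^+ s.+1.
Proof.
(* Either a valid sequence exists in every length [k], or one gets stuck; [valid_size] excludes
   length [L.+1]. *)
have step k : (exists2 sigma, valid W C x z I sigma & size sigma = k) \/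
    exists2 sigma, valid W C x z I sigma &
      forall v, v \in I -> unsaturated_mass W C x (links W C x sigma) v < z * x ^+ s.+1.
  elim: k => [|k [[sg sgv szsg]|?]]; [by left; exists [::]| |by right].
  have [v /andP[vI vm]|none] :=
      pickP (fun v => (v \in I) && (z * x ^+ s.+1 <= unsaturated_mass W C x (links W C x sg) v)).
    by left; exists (v :: sg); rewrite /= ?vI ?vm ?szsg.
  right; exists sg => // v vI; rewrite ltNge; apply/negP => le.
  by have := none v; rewrite vI le.
have [[sg /valid_size le szsg]|//] := step L.+1.
by rewrite szsg ltnn in le.
Qed.

End Greedy.

Lemma sum_indicator (R : realFieldType) (T : finType) (X : {set T}) (k : R) :
  \sum_v (if v \in X then k else 0) = #|X|%:R * k.
Proof. by rewrite -big_mkcond /= sumr_const mulr_natl. Qed.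

(** Split the mass of [W] by its first vertex: vertices outside [X] carry at most [C * x ^+ s.+1]
    each, the unsaturated part at a vertex of [X] is below [z * x ^+ s.+1], and the remaining,
    saturated part is at most 2^(s+1) x times the mass of the links. Hence the links are heavy. *)
Lemma links_mass (R : realFieldType) (T : finType) (A X : {set T}) s
    (W : {ffun 'I_s.+2 -> T} -> R) (C x z c e : R) sigma :
  (forall h, 0 <= W h) -> (forall h, W h != 0 -> forall i, h i \in A) ->
  0 < C -> 0 < x -> degree_bounded W C x ->
  (forall v, v \in X -> unsaturated_mass W C x (links W C x sigma) v < z * x ^+ s.+1) ->
  #|A :\: X|%:R <= c * #|A|%:R -> 0 <= c -> 0 <= z -> e * (#|A|%:R * x ^+ s.+1) <= \sum_h W h ->
  (e - c * C - z) / 2 ^+ s.+1 * (#|A|%:R * x ^+ s) <= \sum_f links W C x sigma f.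
Proof.
move=> W0 WA C0 x0 Wdeg HX AX c0 z0 We.
set W' := links W C x sigma.
have W'0 f : 0 <= W' f by apply: links_ge0.
have sat := @saturated_mass R T s W C x W0 C0 x0 Wdeg W' W'0.
have xs : 0 <= x ^+ s.+1 by rewrite exprn_ge0 // ltW.
have mass_v v : \sum_f W (fcons v f) <= C * x ^+ s.+1.
  have [f _|no] := pickP (@predT {ffun 'I_s.+1 -> T}); last first.
    by rewrite big_pred0 // mulr_ge0 // ltW.
  have P0 : ord0 |: lift_set (set0 : {set 'I_s.+1}) != set0.
    by apply/set0Pn; exists ord0; rewrite setU11.
  have := Wdeg _ (fcons v f) P0; rewrite degree_lift0 /lift_set imset0 setU0 cards1 subn1 /=.
  apply: le_trans; rewrite [leRHS]big_mkcond; apply: ler_sum => g _; rewrite ifT //.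
  by apply/forall_inP=> i; rewrite inE.
have split_v v : \sum_f W (fcons v f) =
    \sum_(f | saturated C x W' f) W (fcons v f) + unsaturated_mass W C x W' v.
  by rewrite (bigID (saturated C x W')).
have bound v : \sum_f W (fcons v f) <= \sum_(f | saturated C x W' f) W (fcons v f) +
    ((if v \in A :\: X then C * x ^+ s.+1 else 0) + (if v \in A then z * x ^+ s.+1 else 0)).
  have sat0 : 0 <= \sum_(f | saturated C x W' f) W (fcons v f) by apply: sumr_ge0.
  rewrite inE; have [vA|vA] := boolP (v \in A); last first.
    rewrite andbF !addr0 big1 // => f _; apply/eqP; apply: contraNT vA => /WA /(_ ord0).
    by rewrite fcons0.
  have zx : 0 <= z * x ^+ s.+1 by rewrite mulr_ge0.
  have [vX|vX] /= := boolP (v \in X); last first.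
    by have := mass_v v; lra.
  by rewrite split_v add0r lerD2l ltW // HX.
move: We; rewrite sum_fcons => We; have {}We := le_trans We (ler_sum _ (fun v _ => bound v)).
rewrite big_split /= big_split /= !sum_indicator in We.
have {sat} := le_trans We (lerD sat (lexx _)).
have cC : #|A :\: X|%:R * (C * x ^+ s.+1) <= c * #|A|%:R * (C * x ^+ s.+1).
  by rewrite ler_wpM2r // mulr_ge0 // ltW.
move=> H; rewrite mulrAC ler_pdivrMr ?exprn_gt0 // -(ler_pM2r x0).
move: H cC; rewrite [x ^+ s.+1]exprSr.
set a := #|A|%:R; set b := #|_|%:R; set m := \sum_i _; set y := x ^+ s; set t := 2 ^+ s.+1.
by move=> H1 H2; nra.
Qed.

Lemma card_bigcup_leq (I T : finType) (F : I -> {set T}) :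
  (#|\bigcup_i F i| <= \sum_i #|F i|)%N.
Proof.
elim/big_ind2: _ => [|X m Y n XM YN|//]; first by rewrite cards0.
by rewrite (leq_trans (leq_card_setU _ _)) // leq_add.
Qed.

(* Induction on the uniformity.  Grow greedily inside I a sequence of vertices whose
   unsaturated links are heavy.  The vertices with light links form a set containing
   I; if it is almost all of A, then the accumulated links are heavy, and I is free
   of them as well. *)
Theorem container (R : realFieldType) s (C e : R) : 0 < C -> 0 < e ->
  exists c B : R, [/\ 0 < c, 0 < B &
  forall (T : finType) (A : {set T}) (x : R) (W : {ffun 'I_s.+1 -> T} -> R) (L : nat),
    0 < x -> (forall h, 0 <= W h) -> (forall h, W h != 0 -> forall i, h i \in A) ->
    degree_bounded W C x -> e * (#|A|%:R * x ^+ s) <= \sum_h W h ->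
    B * (#|A|%:R / x) <= L%:R ->
    exists CC : {set {set T}}, [/\ (#|CC| <= (#|T|.+1 ^ L) ^ s)%N,
      forall X, X \in CC -> #|X|%:R <= (1 - c) * #|A|%:R &
      forall I : {set T}, I \subset A -> free_of W I -> exists2 X, X \in CC & I \subset X]].
Proof.
elim: s C e => [|s IH] C e C0 e0.
  (* For 1-tuples, a free set avoids the support of [W]; as the weights are at most [C], this
     support has at least e #|A| / C points. *)
  exists (e / C), 1; split; rewrite ?divr_gt0 // => T A x W L x0 W0 WA Wdeg We _.
  pose X := [set v in A | W [ffun=> v] == 0].
  exists [set X]; split; first by rewrite cards1 expn0.
    move=> _ /set1P ->; have : e * #|A|%:R <= C * #|A :\: X|%:R.
      move: We; rewrite expr0 mulr1 => /le_trans; apply.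
      rewrite (reindex_onto (fun v : T => [ffun=> v] : {ffun 'I_1 -> T}) (fun h => h ord0)) /=; last first.
        by move=> h _; apply/ffunP=> i; rewrite ffunE (ord1 i).
      rewrite [leRHS]mulrC -sum1_card natr_sum mulr_suml (bigID (mem (A :\: X))) /= addrC big1 ?add0r; last first.
        move=> v /andP[_]; rewrite !inE; have [vA|vA] := boolP (v \in A).
          by rewrite andbT negbK => /eqP.
        by move=> _; apply/eqP; apply: contraNT vA => /WA /(_ ord0); rewrite ffunE.
      under eq_bigl do rewrite ffunE eqxx /=.
      apply: ler_sum => v _; rewrite mul1r.
      have P0 : setT != set0 :> {set 'I_1} by apply/set0Pn; exists ord0.
      have := Wdeg _ [ffun=> v] P0; rewrite cardsT card_ord subnn mulr1; apply: le_trans.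
      by rewrite /degree (bigD1 [ffun=> v]) ?lerDl ?sumr_ge0 //=; apply/forall_inP => i _.
    rewrite cardsD (setIidPr _); last by apply/subsetP => v; rewrite inE => /andP[].
    rewrite natrB; last by apply: subset_leq_card; apply/subsetP => v; rewrite inE => /andP[].
    move=> H; rewrite -(ler_pM2l C0).
    have -> : C * ((1 - e / C) * #|A|%:R) = C * #|A|%:R - e * #|A|%:R by field; rewrite gt_eqF.
    by lra.
  move=> I IA If; exists X; first exact: set11.
  apply/subsetP => v vI; rewrite inE (subsetP IA) //=; apply/eqP/eqP; apply: contraT => /If[i].
  by rewrite ffunE vI.
have [c [B [c0 B0 {}IH]]] := IH (2 * C) (e / 2 / 2 ^+ s.+1) (mulr_gt0 (ltr0Sn _ _) C0)
   (divr_gt0 (divr_gt0 e0 (ltr0Sn _ _)) (exprn_gt0 _ (ltr0Sn _ _))).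
(* Chosen so that [e - c1 * C - z] equals [e / 2] in [links_mass]. *)
pose z := e / 4; pose c1 := e / (4 * C).
have z0 : 0 < z by rewrite divr_gt0.
have c10 : 0 < c1 by rewrite divr_gt0 // mulr_gt0.
exists (Num.min c c1), (Num.max B (2 * C / z)); split.
- by rewrite lt_min c0.
- by rewrite lt_max B0.
move=> T A x W L x0 W0 WA Wdeg We HL.
have nx : 0 <= #|A|%:R / x by rewrite divr_ge0 // ltW.
have HL1 : B * (#|A|%:R / x) <= L%:R.
  by apply: le_trans HL; rewrite ler_wpM2r // le_max lexx.
have HL2 : 2 * C / z * (#|A|%:R / x) <= L%:R.
  by apply: le_trans HL; rewrite ler_wpM2r // le_max lexx orbT.
pose W' sg := links W C x sg.
pose X sg := [set v in A | unsaturated_mass W C x (W' sg) v < z * x ^+ s.+1].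
have XA sg : X sg \subset A by apply/subsetP => v; rewrite inE => /andP[].
(* The family depends on the fingerprint [tau] alone, not on [I], so each level multiplies the count
   by at most (#|T| + 1)^L. If [X] already misses a proportion [c1] of [A], it is a container
   itself; otherwise the links are heavy and the induction applies to them. *)
have fam (tau : L.-tuple (option T)) : exists CC : {set {set T}},
    [/\ (#|CC| <= (#|T|.+1 ^ L) ^ s)%N,
      forall Y, Y \in CC -> #|Y|%:R <= (1 - Num.min c c1) * #|A|%:R &
      forall I : {set T}, I \subset X (pmap id tau) -> free_of (W' (pmap id tau)) I ->
        exists2 Y, Y \in CC & I \subset Y].
  set sg := pmap id tau.
  have [small|big] := leP #|X sg|%:R ((1 - c1) * #|A|%:R).
    exists [set X sg]; split; first by rewrite cards1 expn_gt0 expn_gt0.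
      move=> _ /set1P ->; apply: le_trans small _; rewrite ler_wpM2r // lerD2l lerN2.
      by rewrite ge_min lexx orbT.
    by move=> I IX _; exists (X sg); rewrite ?set11.
  have AX : #|A :\: X sg|%:R <= c1 * #|A|%:R.
    by rewrite cardsD (setIidPr (XA _)) natrB ?subset_leq_card //; lra.
  have := links_mass W0 WA C0 x0 Wdeg (fun v => _) AX (ltW c10) (ltW z0) We.
  move=> /(_ sg) H; have {}H : e / 2 / 2 ^+ s.+1 * (#|A|%:R * x ^+ s) <= \sum_f W' sg f.
    have : (e - c1 * C - z) / 2 ^+ s.+1 * (#|A|%:R * x ^+ s) <= \sum_f W' sg f.
      by apply: H => v; rewrite inE => /andP[].
    by have -> : e - c1 * C - z = e / 2 by rewrite /c1 /z; field; rewrite gt_eqF.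
  have [CC [cCC sCC HCC]] := IH T A x (W' sg) L x0 (links_ge0 _ _ W0 _)
      (fun h Hh => links_memA WA Hh) (links_degree W0 C0 x0 Wdeg sg) H HL1.
  exists CC; split => //.
    move=> Y /sCC /le_trans; apply; rewrite ler_wpM2r // lerD2l lerN2.
    by rewrite ge_min lexx.
  by move=> I IX If; apply: HCC => //; apply: subset_trans IX (XA _).
have [F HF] := fin_all_exists fam.
exists (\bigcup_tau F tau); split.
- have cF tau : (#|F tau| <= (#|T|.+1 ^ L) ^ s)%N by case: (HF tau).
  apply: (leq_trans (card_bigcup_leq _)); apply: (leq_trans (leq_sum _ (fun tau _ => cF tau))).
  by rewrite sum_nat_const card_tuple card_option expnS.
- by move=> Y /bigcupP[tau _ YF]; have [_ + _] := HF tau; apply.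
move=> I IA If.
have [sg sgv sgI] := greedy W0 WA C0 x0 z0 Wdeg HL2 I.
have szsg := valid_size W0 WA C0 x0 z0 Wdeg HL2 sgv.
(* Shorter fingerprints are padded with [None]. *)
have sz : size (map some sg ++ nseq (L - size sg) None) == L.
  by rewrite size_cat size_map size_nseq subnKC.
have tauE : pmap id (Tuple sz) = sg.
  rewrite /=; elim: (sg) (L - _)%N => [|a l IHl] k /=; first by elim: k.
  by rewrite IHl.
have [_ _ H] := HF (Tuple sz); rewrite tauE in H.
have [||Y YF IY] := H I.
- by apply/subsetP=> v vI; rewrite inE (subsetP IA) // sgI.
(* A linked tuple extends to a tuple of [W] by a vertex of [sg]. That vertex lies in [I], so the
   coordinate outside [I] is one of the linked tuple. *)
- move=> h /links_supp[v vs /If[i]].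
  case: (unliftP ord0 i) => [j ->|->]; rewrite ?fconsS ?fcons0; first by exists j.
  by rewrite (valid_mem sgv).
by exists Y => //; apply/bigcupP; exists (Tuple sz).
Qed.

(** * Measures on tuples with bounded marginals *)

Section Update.
Variables (R : realFieldType) (T I : finType).
Implicit Type z : {ffun I -> T}.

Definition upd z i t : {ffun I -> T} := [ffun k => if k == i then t else z k].

Lemma upd_same z i t : upd z i t i = t. Proof. by rewrite ffunE eqxx. Qed.

Lemma upd_other z i t k : k != i -> upd z i t k = z k.
Proof. by rewrite ffunE => /negPf ->. Qed.

Lemma updK z i t : upd (upd z i t) i (z i) = z.
Proof. by apply/ffunP => k; rewrite !ffunE; case: eqP => [->|]. Qed.

Lemma upd_id z i : upd z i (z i) = z.
Proof. by apply/ffunP => k; rewrite !ffunE; case: eqP => [->|]. Qed.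

Lemma upd_upd z i t t' : upd (upd z i t) i t' = upd z i t'.
Proof. by apply/ffunP => k; rewrite !ffunE; case: eqP. Qed.

(** Exchanging [z i] with [t] is an involution on the pairs (z, t). This is the double counting
    behind every resampling argument below. *)
Lemma sum_exchange i (G : {ffun I -> T} -> T -> R) :
  \sum_z \sum_t G z t = \sum_z \sum_t G (upd z i t) (z i).
Proof.
rewrite !pair_big /= (reindex (fun p => (upd p.1 i p.2, p.1 i))) //.
exists (fun p : {ffun I -> T} * T => (upd p.1 i p.2, p.1 i)) => -[z t] _ /=; by rewrite updK upd_same.
Qed.

(** The value [t0] only singles out one representative of each class of tuples that differ at
    [i]. *)
Lemma sum_upd i t0 (G : {ffun I -> T} -> R) :
  \sum_z G z = \sum_(z : {ffun I -> T} | z i == t0) \sum_t G (upd z i t).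
Proof.
rewrite pair_big_dep /= (reindex_onto (fun p : {ffun I -> T} * T => upd p.1 i p.2) (fun z : {ffun I -> T} => (upd z i t0, z i))) /=; last first.
  by move=> z _; rewrite upd_upd upd_id.
apply: eq_bigl => -[z t] /=; rewrite upd_same upd_upd andbT.
apply/eqP/eqP => [[zE]|<-]; first by rewrite -zE upd_same.
by rewrite upd_id.
Qed.

Lemma card_box (F : I -> {set T}) :
  #|[set z : {ffun I -> T} | [forall k, z k \in F k]]| = (\prod_k #|F k|)%N.
Proof.
rewrite cardsE (eq_card (B := family F)); last by move=> z; rewrite inE; apply/eq_forallb.
by rewrite card_family foldrE big_map big_enum.
Qed.

End Update.

Definition marginal_le1 (R : realFieldType) (T I : finType) (mu : {ffun I -> T} -> R) :=
  forall i z, \sum_t mu (upd z i t) <= 1.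

Definition supported (R : realFieldType) (T I : finType) (A : {set T}) (mu : {ffun I -> T} -> R) :=
  forall z, mu z != 0 -> forall i, z i \in A.

(** Summing over one coordinate outside [P] costs a factor at most 1; the other [s - #|P| - 1] free
    coordinates range over [A]. *)
Lemma marginal_degree (R : realFieldType) (T : finType) (A : {set T}) s (mu : {ffun 'I_s -> T} -> R) P g :
  supported A mu -> (forall z, 0 <= mu z) -> marginal_le1 mu -> P != setT ->
  degree mu P g <= #|A|%:R ^+ (s - #|P|).-1.
Proof.
move=> muA mu0 mu1 PT.
have [i iP] : exists i, i \notin P.
  by apply/existsP; rewrite -negb_forall; apply: contra PT => /forallP H; apply/eqP/setP => j; rewrite inE H.
rewrite /degree big_mkcond (sum_upd i (g i)) /=.
pose F k : {set T} := if (k == i) || (k \in P) then [set g k] else A.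
apply: (@le_trans _ _ (\sum_(z in [set z : {ffun 'I_s -> T} | [forall k, z k \in F k]]) 1)).
  rewrite big_mkcond [leRHS]big_mkcond; apply: ler_sum => z _; case: ifP => [/eqP zi|_]; last by case: ifP.
  have agE t : agree P (upd z i t) g = agree P z g.
    apply: eq_forallb_in => k kP; rewrite upd_other //; apply: contraNneq iP => <-; exact: kP.
  under eq_bigr do rewrite agE.
  have [ag|_] := boolP (agree P z g); last by rewrite big1 //; case: ifP.
  case: ifP => [_|]; first exact: mu1.
  rewrite inE => /negbT; rewrite negb_forall => /existsP[k]; rewrite /F; case: ifPn => [/orP[/eqP ->|kP]|].
  - by rewrite inE zi eqxx.
  - by rewrite inE (forall_inP ag).
  rewrite negb_or => /andP[ki _] zk; rewrite big1 // => t _; apply/eqP; apply: contraNT zk => /muA /(_ k).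
  by rewrite upd_other.
rewrite sumr_const card_box /= -[leLHS]mulr_natl mulr1 -natrX ler_nat.
rewrite (bigID (mem (i |: P))) /= big1 ?mul1n; last first.
  by move=> k; rewrite /F !inE => ->; rewrite cards1.
rewrite (eq_bigr (fun=> #|A|)); last by move=> k; rewrite /F !inE => /negPf ->.
rewrite prod_nat_const; have -> : #|[predC i |: P]| = (s - #|P|).-1.
  have <- : #|~: (i |: P)| = (s - #|P|).-1 by rewrite cardsCs setCK card_ord cardsU1 iP; lia.
  by apply: eq_card => k; rewrite !inE.
by [].
Qed.

(** This is [container] at scale x = n / t for the weight mu / b with b = t^d / n: the mass n^d
    becomes n x^d, and values at most [beta] become values at most 1. Proper sub-tuples then have a
    factor t^(#|P| - 1) to spare. *)
Lemma measure_container (R : realFieldType) d (de : R) : 0 < de ->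
  exists c B : R, [/\ 0 < c, 0 < B &
  forall (T : finType) (A : {set T}) (t beta : R) (mu : {ffun 'I_d.+1 -> T} -> R) (L : nat),
    1 <= t -> (forall h, 0 <= mu h) -> supported A mu -> marginal_le1 mu ->
    (forall h, mu h <= beta) -> beta * #|A|%:R <= t ^+ d ->
    de * #|A|%:R ^+ d <= \sum_h mu h -> B * t <= L%:R ->
    exists CC : {set {set T}}, [/\ (#|CC| <= (#|T|.+1 ^ L) ^ d)%N,
      forall X, X \in CC -> #|X|%:R <= (1 - c) * #|A|%:R &
      forall I : {set T}, I \subset A -> free_of mu I -> exists2 X, X \in CC & I \subset X]].
Proof.
move=> de0; have [c [B [c0 B0 H]]] := container d (@ltr01 R) de0.
exists c, B; split => // T A t beta mu L t1 mu0 muA mu1 mub bt mass BL.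
have t0 : 0 < t by apply: lt_le_trans t1.
have [A0|] := posnP #|A|.
  exists [set set0]; split; first by rewrite cards1 expn_gt0 expn_gt0.
    by move=> X /set1P ->; rewrite cards0 A0 mulr0.
  by move=> I; rewrite (cards0_eq A0) subset0 => /eqP -> _; exists set0; rewrite ?set11.
rewrite -(ltr0n R); set n := #|A|%:R => n0.
pose b := t ^+ d / n; have b0 : 0 < b by rewrite divr_gt0 ?exprn_gt0.
have := H T A (n / t) (fun h => mu h / b) L (divr_gt0 n0 t0).
case=> [|||||CC [H1 H2 H3]].
- by move=> h; rewrite divr_ge0 // ltW.
- by move=> h; rewrite mulf_eq0 negb_or => /andP[/muA].
- move=> P g P0; rewrite mul1r /degree -mulr_suml ler_pdivrMr //.
  have [->|PT] := eqVneq P setT.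
    rewrite cardsT card_ord subnn mul1r (big_pred1 g); last first.
      move=> f /=; apply/forall_inP/eqP => [ag|-> //]; by apply/ffunP => k; apply/eqP/ag.
    by rewrite /b ler_pdivlMr // (le_trans _ bt) // ler_wpM2r // ltW.
  apply: le_trans (marginal_degree g muA mu0 mu1 PT) _.
  have [j Pj] : exists j, #|P| = j.+1 by exists #|P|.-1; rewrite prednK // card_gt0.
  have jd : (j < d)%N.
    have : (#|P| < #|[set: 'I_d.+1]|)%N by apply: proper_card; rewrite properT.
    by rewrite cardsT card_ord Pj.
  rewrite Pj subSS -/n.
  have -> : (n / t) ^+ (d - j) * b = n ^+ (d - j).-1 * t ^+ j.
    have E1 : (d - j)%N = (d - j.+1).+1 by rewrite -subSn // subSS.
    have E2 : t ^+ d = t ^+ (d - j.+1).+1 * t ^+ j by rewrite -exprD addSn -addnS subnK.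
    rewrite /b E1 E2 succnK expr_div_n [n ^+ _.+1]exprS.
    by field; rewrite !expf_neq0 ?gt_eqF.
  by rewrite ler_peMr ?exprn_ge0 ?exprn_ege1 // ltW.
- rewrite -mulr_suml ler_pdivlMr //; apply: le_trans mass.
  rewrite le_eqVlt; apply/orP; left; apply/eqP; rewrite /b -/n expr_div_n.
  by field; rewrite !expf_neq0 ?gt_eqF.
- by rewrite -/n; suff -> : n / (n / t) = t by []; field; rewrite !gt_eqF.
exists CC; split => // I IA If; apply: H3 => // h; rewrite mulf_eq0 negb_or => /andP[mh _].
exact: If.
Qed.

(** * Spans of tuples of points *)

Section Spans.
Variables (F : finFieldType) (V : vectType F) (T : finType) (phi : T -> V).

Definition sp (I : finType) (W : {set I}) (z : {ffun I -> T}) : {vspace V} :=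
  (\sum_(i in W) <[phi (z i)]>)%VS.

Section OneIndex.
Variable I : finType.
Implicit Types (W S : {set I}) (z : {ffun I -> T}).

Lemma mem_sp W z i : i \in W -> phi (z i) \in sp W z.
Proof. by move=> iW; rewrite memvE (sumv_sup i). Qed.

Lemma sp_sub W z (G : {vspace V}) : (forall i, i \in W -> phi (z i) \in G) -> (sp W z <= G)%VS.
Proof. by move=> H; apply/subv_sumP => i /H; rewrite memvE. Qed.

Lemma dim_sp W z : (\dim (sp W z) <= #|W|)%N.
Proof.
apply: leq_trans (dimv_leq_sum _ _ _) _; rewrite -sum1_card; apply: leq_sum => i _.
by rewrite dim_vline; case: eqP.
Qed.

Lemma sp_subset W W' z : W \subset W' -> (sp W z <= sp W' z)%VS.
Proof. by move=> s; apply: sp_sub => i /(subsetP s); apply: mem_sp. Qed.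

Lemma sp_upd_notin W z i t : i \notin W -> sp W (upd z i t) = sp W z.
Proof.
move=> iW; apply: eq_bigr => k kW; rewrite upd_other //.
by apply: contraNneq iW => <-.
Qed.

Lemma memv_spP W z v :
  reflect (exists c : {ffun I -> F}, v = \sum_(i in W) c i *: phi (z i)) (v \in sp W z).
Proof.
apply: (iffP memv_sumP) => [[vs vsP ->]|[c ->]]; last first.
  by exists (fun i => c i *: phi (z i)) => // i _; rewrite memvZ ?memv_line.
have H i : exists k, i \in W -> vs i = k *: phi (z i).
  have [/vsP/vlineP[k ->]|_] := boolP (i \in W); first by exists k.
  by exists 0.
have [c cP] := fin_all_exists H.
by exists [ffun i => c i]; apply: eq_bigr => i iW; rewrite ffunE cP.
Qed.

Definition fullrel z :=
  [exists c : {ffun I -> F}, [forall i, c i != 0] && (\sum_i c i *: phi (z i) == 0)].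

(** The coefficients are not unique when [z] is dependent, so one [u] may have several supports. *)
Definition rep S z u :=
  [exists c : {ffun I -> F}, [forall i, (c i != 0) == (i \in S)] &&
                             (phi u == \sum_i c i *: phi (z i))].

Lemma repP S z u : reflect (exists c : {ffun I -> F}, (forall i, (c i != 0) = (i \in S)) /\
    phi u = \sum_i c i *: phi (z i)) (rep S z u).
Proof.
apply: (iffP existsP) => -[c] => [/andP[/forallP H /eqP E]|[H E]]; exists c.
  by split=> // i; exact: (eqP (H i)).
by rewrite E eqxx andbT; apply/forallP => i; rewrite H.
Qed.

Lemma rep_sp S z u : rep S z u -> phi u \in sp S z.
Proof.
case/repP => c [H ->]; apply/memv_spP; exists c; rewrite [LHS](bigID (mem S)) /= [X in _ + X]big1 ?addr0 //.
by move=> i; rewrite -H negbK => /eqP ->; rewrite scale0r.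
Qed.

Lemma sp_rep_ex z u : phi u \in sp setT z -> exists S, rep S z u.
Proof.
case/memv_spP => c E; exists [set i | c i != 0]; apply/repP; exists c; split.
  by move=> i; rewrite inE.
by rewrite E; apply: eq_bigl => i; rewrite inE.
Qed.

Lemma fullrel_sub z i : fullrel z -> phi (z i) \in sp [set~ i] z.
Proof.
case/existsP => c /andP[/forallP c0 /eqP E]; apply/memv_spP.
exists [ffun k => - (c i)^-1 * c k].
move: E; rewrite (bigD1 i) //= => /eqP; rewrite addr_eq0 => /eqP E.
have -> : phi (z i) = (c i)^-1 *: (c i *: phi (z i)) by rewrite scalerA mulVf // scale1r.
rewrite E scalerN -scaleNr scaler_sumr; apply: eq_big => [k|k _]; first by rewrite !inE.
by rewrite scalerA ffunE.
Qed.

(** This lets one weight, the inverse number of points in the whole span, normalize all coordinates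
    at once; see [relation_measure]. *)
Lemma fullrel_span z i : fullrel z -> sp setT z = sp [set~ i] z.
Proof.
move=> zf; apply: subv_anti; apply/andP; split; last by apply: sp_subset; apply: subsetT.
apply: sp_sub => k _.
have [->|ki] := eqVneq k i; first exact: fullrel_sub.
by apply: mem_sp; rewrite !inE.
Qed.

End OneIndex.

Variables (R : realFieldType) (A : {set T}).

Definition pts (G : {vspace V}) : {set T} := [set t in A | phi t \in G].
Definition npts (G : {vspace V}) : R := #|pts G|%:R.

Lemma npts_ge0 G : 0 <= npts G. Proof. exact: ler0n. Qed.

Lemma ptsS G G' : (G <= G')%VS -> pts G \subset pts G'.
Proof. by move=> s; apply/subsetP => t; rewrite !inE => /andP[-> /(subvP s) ->]. Qed.

Lemma nptsS G G' : (G <= G')%VS -> npts G <= npts G'.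
Proof. by move=> /ptsS/subset_leq_card; rewrite ler_nat. Qed.

Definition spT (B : {set T}) : {vspace V} := sp B [ffun t => t].

(* Only spans of sets of points are tested, to keep [good] boolean; see [goodP]. *)
Definition good (kappa : R) (G : {vspace V}) :=
  [forall B : {set T}, (B \subset pts G) ==> (\dim (spT B) < \dim G)%N ==>
    (npts (spT B) <= kappa * npts G)].

Lemma pts_spT G : pts (spT (pts G)) = pts G /\ (spT (pts G) <= G)%VS.
Proof.
have le : (spT (pts G) <= G)%VS.
  by apply: sp_sub => t; rewrite ffunE inE => /andP[].
split=> //; apply/eqP; rewrite eqEsubset ptsS //; apply/subsetP => t tG.
have := mem_sp [ffun t => t] tG; rewrite ffunE.
by move: (tG); rewrite !inE => /andP[-> _].
Qed.

Lemma goodP kappa G : reflect (forall G' : {vspace V}, (G' <= G)%VS -> (\dim G' < \dim G)%N ->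
    npts G' <= kappa * npts G) (good kappa G).
Proof.
apply: (iffP forallP) => [H G' s d|H B]; last first.
  apply/implyP => s; apply/implyP => d; apply: H => //.
  by apply: sp_sub => t tB; rewrite ffunE; have := subsetP s t tB; rewrite inE => /andP[].
have [E le] := pts_spT G'.
rewrite /npts -E; have := H (pts G'); rewrite ptsS //=.
by rewrite (leq_ltn_trans (dimvS le) d).
Qed.

(* Over the tuples D, the proportion of the points in the span of D which are
   combinations of D with support exactly S. *)
Definition Phi (I : finType) (Q : pred {ffun I -> T}) (S : {set I}) : R :=
  \sum_(D | Q D) \sum_(u in A | rep S D u) (npts (sp setT D))^-1.

Lemma cover_count (J : finType) (P : {set J}) (X : {set T}) (K : J -> {vspace V}) (b : R) :
  X \subset \bigcup_(i in P) pts (K i) -> (forall i, i \in P -> npts (K i) <= b) ->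
  #|X|%:R <= #|P|%:R * b.
Proof.
move=> /subset_leq_card le Hb.
have le2 : (#|\bigcup_(i in P) pts (K i)| <= \sum_(i in P) #|pts (K i)|)%N.
  elim/big_ind2: _ => [|Y m Z n YM ZN|//]; first by rewrite cards0.
  by rewrite (leq_trans (leq_card_setU _ _)) // leq_add.
have : #|X|%:R <= (\sum_(i in P) #|pts (K i)|)%:R :> R by rewrite ler_nat (leq_trans le).
move=> /le_trans; apply; rewrite natr_sum -sum1_card natr_sum mulr_suml.
by apply: ler_sum => i iP; rewrite mul1r Hb.
Qed.

(** Write [y] in the basis [W] and eliminate [D x]. The coefficients on [W] all become nonzero
    unless [y] lies in one of #|W| proper subspaces, each holding at most a proportion [kappa] of
    the points. *)
Lemma absorb_generic (I : finType) (S W : {set I}) x (kappa : R) (D : {ffun I -> T}) u :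
  x \in S -> x \in W -> \dim (sp W D) = #|W| -> good kappa (sp W D) -> #|W|%:R * kappa <= 2^-1 ->
  rep S D u ->
  npts (sp W D) <= 2 * #|[set y in A | [&& phi y \in sp W D, sp W (upd D x y) == sp W D,
     sp setT (upd D x y) == sp setT D & rep (S :|: W) (upd D x y) u]]|%:R.
Proof.
move=> xS xW dimW /goodP Hgood kW /repP[c [cS uE]].
set Y := [set y in A | _].
(* With b the coefficients of [y] and c those of [u]: [K x] contains the [y] with b x = 0, and [K i]
   those with c i * b x = c x * b i, for which the new coefficient of [D i] vanishes. *)
pose K i := if i == x then sp (W :\ x) D
            else (sp (W :\ x :\ i) D + <[c x *: phi (D x) + c i *: phi (D i)]>)%VS.
have KW i : i \in W -> (K i <= sp W D)%VS.
  move=> iW; rewrite /K; case: eqP => _; first by rewrite sp_subset // subsetDl.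
  rewrite subv_add sp_subset /=; last by rewrite (subset_trans (subsetDl _ _)) ?subsetDl.
  by rewrite -memvE memvD // memvZ // mem_sp.
have W0 : (0 < #|W|)%N by apply/card_gt0P; exists x.
have Kdim i : i \in W -> (\dim (K i) < \dim (sp W D))%N.
  move=> iW; rewrite dimW /K; case: eqP => [_|/eqP ix].
    by apply: (leq_ltn_trans (dim_sp _ _)); rewrite [X in (_ < X)%N](cardsD1 x) xW.
  have -> : #|W| = #|W :\ x :\ i|.+2 by rewrite (cardsD1 x) xW (cardsD1 i (W :\ x)) !inE ix iW.
  apply: (leq_ltn_trans (dimv_add_leqif _ _)); rewrite ltnS -addn1 leq_add ?dim_sp //.
  by rewrite dim_vline; case: eqP.
have cx : c x != 0 by rewrite cS.
have cover : pts (sp W D) :\: Y \subset \bigcup_(i in W) pts (K i).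
  apply/subsetP => y; rewrite inE => /andP[yY]; rewrite inE => /andP[yA yW].
  apply/bigcupP; case/memv_spP: (yW) => b yE.
  have [bx|bx] := eqVneq (b x) 0.
    exists x => //; rewrite inE yA /K eqxx; apply/memv_spP; exists b.
    rewrite yE (bigD1 x) //= bx scale0r add0r; apply: eq_bigl => k.
    by rewrite !inE andbC.
  have [i /andP[iW /eqP ci]|none] := pickP (fun i => (i \in W :\ x) && (c i * b x == c x * b i)).
    move: iW; rewrite !inE => /andP[ix iW]; exists i => //.
    rewrite inE yA /K (negPf ix) yE (bigD1 x) //= (bigD1 i) /=; last by rewrite iW ix.
    rewrite addrA addrC memv_add //.
      apply/memv_spP; exists b; apply: eq_bigl => k.
      by rewrite !inE; case: (k == i); case: (k == x); case: (k \in W).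
    apply/vlineP; exists (b x / c x); rewrite scalerDr !scalerA mulfVK //.
    by congr (_ + _ *: _); rewrite mulrAC (mulrC (b x)) ci mulrAC mulfV // mul1r.
  have ciE i : i \in W -> i != x -> c i * b x != c x * b i.
    by move=> iW ix; have := none i; rewrite !inE iW ix /= => ->.
  case/negP: yY; rewrite inE yA /= yW /=.
  have yE' : phi y = b x *: phi (D x) + \sum_(i in W | i != x) b i *: phi (D i).
    by rewrite yE (bigD1 x).
  have DxE : phi (D x) = (b x)^-1 *: phi y - \sum_(i in W | i != x) ((b x)^-1 * b i) *: phi (D i).
    rewrite yE' scalerDr scalerA mulVf // scale1r scaler_sumr.
    under [X in _ - X]eq_bigr do rewrite -scalerA.
    by rewrite addrK.
  have Dx_mem (U : {set I}) : W \subset U -> phi (D x) \in sp U (upd D x y).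
    move=> WU; rewrite DxE memvB //.
      by rewrite memvZ //; have := mem_sp (upd D x y) (subsetP WU x xW); rewrite upd_same.
    apply: memv_suml => i /andP[iW ix]; rewrite memvZ //.
    by have := mem_sp (upd D x y) (subsetP WU i iW); rewrite upd_other.
  have spE (U : {set I}) : W \subset U -> sp U (upd D x y) = sp U D.
    move=> WU; apply: subv_anti; apply/andP; split; apply: sp_sub => k kU.
      have [->|kx] := eqVneq k x; last by rewrite upd_other // mem_sp.
      by rewrite upd_same (subvP (sp_subset _ WU)).
    have [->|kx] := eqVneq k x; first exact: Dx_mem.
    by rewrite -(upd_other D y kx) mem_sp.
  rewrite !spE ?subsetT // !eqxx /=.
  (* Coefficients of [u] after substituting for [D x] its expression in [y] and the other points of
     [W]. *)
  pose c' := [ffun i => if i == x then c x / b x else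
      if i \in W then c i - c x / b x * b i else c i].
  have c'x : c' x = c x / b x by rewrite ffunE eqxx.
  have c'E i : i != x -> c' i = if i \in W then c i - c x / b x * b i else c i.
    by move=> /negPf ix; rewrite ffunE ix.
  apply/repP; exists c'; split.
    move=> i; rewrite inE; have [->|ix] := eqVneq i x.
      by rewrite xS c'x mulf_neq0 ?invr_eq0.
    rewrite c'E //; have [iW|iW] := boolP (i \in W); last by rewrite orbF cS.
    rewrite orbT; apply: contra (ciE i iW ix) => /eqP H; apply/eqP.
    have -> : c i = c x / b x * b i by apply/eqP; rewrite -subr_eq0 H.
    by field.
  rewrite uE (bigD1 x) //= [RHS](bigD1 x) //= upd_same c'x.
  rewrite {1}DxE scalerBr scalerA scaler_sumr -addrA; congr (_ + _).
  rewrite [RHS](eq_bigr (fun i => c i *: phi (D i) - (if i \in W then (c x / b x * b i) *: phi (D i) else 0))); last first.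
    move=> i ix; rewrite c'E // upd_other //; case: ifP => _; last by rewrite subr0.
    by rewrite scalerBl.
  rewrite sumrB addrC; congr (_ - _); rewrite -big_mkcondr /=.
  apply: eq_big => [i|i _]; first by rewrite andbC.
  by rewrite scalerA mulrA.
have le1 := cover_count cover (fun i iW => Hgood _ (KW i iW) (Kdim i iW)).
have Ysub : Y \subset pts (sp W D).
  by apply/subsetP => y; rewrite !inE => /andP[-> /and4P[-> _ _ _]].
have : npts (sp W D) = #|Y|%:R + #|pts (sp W D) :\: Y|%:R.
  by rewrite -natrD cardsD (setIidPr Ysub) subnKC // subset_leq_card.
have := ler_wpM2r (npts_ge0 (sp W D)) kW.
by rewrite mulrA in le1; move=> H1 H2; lra.
Qed.

(* In a combination of D with support S, replace D x by a generic point of the span of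
   the window W, where x lies in S and W: the support becomes the union of S and W. *)
Lemma absorb (I : finType) (Q Q' : pred {ffun I -> T}) (S W : {set I}) x (kappa : R) :
  x \in S -> x \in W -> #|W|%:R * kappa <= 2^-1 ->
  (forall D, Q D -> [/\ forall i, D i \in A, \dim (sp W D) = #|W|, good kappa (sp W D) &
     0 < npts (sp W D)]) ->
  (forall D y, Q D -> y \in A -> phi y \in sp W D -> sp W (upd D x y) = sp W D ->
     sp setT (upd D x y) = sp setT D -> Q' (upd D x y)) ->
  Phi Q S <= 2 * Phi Q' (S :|: W).
Proof.
move=> xS xW kW HQ HQ'.
pose gen D u y := [&& phi y \in sp W D, sp W (upd D x y) == sp W D,
     sp setT (upd D x y) == sp setT D & rep (S :|: W) (upd D x y) u].
pose G D y := \sum_(u in A | rep S D u) if [&& Q D, y \in A & gen D u y]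
   then (npts (sp setT D))^-1 * (npts (sp W D))^-1 else 0.
have inv0 (H : {vspace V}) : 0 <= (npts H)^-1 by rewrite invr_ge0 npts_ge0.
have le1 : Phi Q S <= \sum_D \sum_y 2 * G D y.
  rewrite /Phi big_mkcond; apply: ler_sum => D _; case: ifP => [QD|_]; last first.
    by rewrite sumr_ge0 // => y _; rewrite mulr_ge0 // sumr_ge0 // => u _; case: ifP => // _; rewrite mulr_ge0.
  have [DA dW gW aW] := HQ D QD.
  rewrite -mulr_sumr /G exchange_big /= mulr_sumr; apply: ler_sum => u /andP[uA repu].
  have := absorb_generic xS xW dW gW kW repu.
  rewrite -big_mkcond /= sumr_const => le.
  have -> : #|[pred y | [&& Q D, y \in A & gen D u y]]| = #|[set y in A | gen D u y]|.
    by apply: eq_card => y; rewrite !inE QD.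
  have {}le : 1 <= 2 * ((npts (sp W D))^-1 * #|[set y in A | gen D u y]|%:R).
    by rewrite mulrCA mulrC ler_pdivlMr // mul1r.
  have := ler_wpM2l (inv0 (sp setT D)) le; rewrite mulr1 => /le_trans; apply.
  by rewrite -[X in _ <= _ * X]mulr_natr mulrCA !mulrA.
(* After the exchange, [D] is the modified tuple and [v] its former point at [x]. The span of [W]
   has not changed and contains [v], so at most [npts (sp W D)] values of [v] occur, each with the
   inverse of this number as weight. *)
apply: le_trans le1 _; rewrite (sum_exchange x) /= /Phi mulr_sumr [leRHS]big_mkcond.
apply: ler_sum => D _; rewrite -mulr_sumr.
pose m := \sum_(u in A | rep (S :|: W) D u) (npts (sp setT D))^-1.
have m0 : 0 <= m by apply: sumr_ge0.
suff : \sum_v G (upd D x v) (D x) <= if Q' D then m else 0.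
  by case: ifP => // _ H; [rewrite ler_wpM2l|rewrite pmulr_rle0].
apply: (@le_trans _ _ (\sum_v if v \in pts (sp W D) then
    (if Q' D then m else 0) * (npts (sp W D))^-1 else 0)); last first.
  rewrite -big_mkcond /= sumr_const -[X in X <= _]mulr_natr -mulrA.
  case: ifP => _; last by rewrite mul0r.
  have [->|n0] := eqVneq (npts (sp W D)) 0; first by rewrite invr0 mul0r mulr0.
  by rewrite mulVf // mulr1.
apply: ler_sum => v _; rewrite /G.
case: ifPn => [vW|vW]; last first.
  rewrite big1 // => u _; rewrite ifF //; apply/negbTE; apply: contra vW => /and3P[QD _ /and4P[_ /eqP E _ _]].
  have [/(_ x) xA _ _ _] := HQ _ QD; rewrite upd_same in xA.
  by rewrite inE xA -[D](updK D x v) E; have := mem_sp (upd D x v) xW; rewrite upd_same.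
apply: (@le_trans _ _ (\sum_(u in A | rep (S :|: W) D u) (if Q' D then (npts (sp setT D))^-1 * (npts (sp W D))^-1 else 0))).
  rewrite big_mkcond [leRHS]big_mkcond; apply: ler_sum => u _.
  have r0 : 0 <= (if (u \in A) && rep (S :|: W) D u then
       if Q' D then (npts (sp setT D))^-1 * (npts (sp W D))^-1 else 0 else 0).
    by case: ifP => // _; case: ifP => // _; rewrite mulr_ge0.
  case: ifP => // /andP[uA _]; case: ifP => // /and3P[QD xA /and4P[yW /eqP E1 /eqP E2 r]].
  rewrite updK in r E1 E2; rewrite uA r /=.
  have := HQ' (upd D x v) (D x) QD xA yW; rewrite updK => /(_ E1 E2) ->.
  by rewrite E1 E2.
by case: ifP => _; [rewrite /m mulr_suml|rewrite mul0r big1].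
Qed.

End Spans.

(** * Counting dependent tuples and completing bases *)

Section Counting.
Variables (R : realFieldType) (F : finFieldType) (V : vectType F) (T : finType) (phi : T -> V).

Definition tuples (I : finType) (B : {set T}) : {set {ffun I -> T}} :=
  [set D : {ffun I -> T} | [forall i, D i \in B]].

Lemma card_tuples (I : finType) (B : {set T}) : #|tuples I B| = (#|B| ^ #|I|)%N.
Proof. by rewrite (card_box (fun=> B)) prod_nat_const. Qed.

Lemma tuples_upd (I : finType) (B : {set T}) (D : {ffun I -> T}) i t :
  (upd D i t \in tuples I B) && (D i \in B) = (D \in tuples I B) && (t \in B).
Proof.
rewrite !inE; apply/andP/andP => -[/forallP H Hi]; split.
- by apply/forallP => k; have := H k; have [->|ki] := eqVneq k i; [|rewrite upd_other].
- by have := H i; rewrite upd_same.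
- by apply/forallP => k; have [->|ki] := eqVneq k i; [rewrite upd_same|rewrite upd_other].
- exact: H.
Qed.

(** The left side counts pairs of a tuple satisfying [P] and a point [t] of [B]. Exchanging [t] with
    coordinate [i] leaves, for each tuple over [B], the values at [i] that achieve [P]. *)
Lemma count_coord (I : finType) (B : {set T}) (i : I) (P : pred {ffun I -> T}) (M : R) :
  (forall D, D \in tuples I B -> #|[set t in B | P (upd D i t)]|%:R <= M) ->
  #|B|%:R * #|[set D in tuples I B | P D]|%:R <= #|B|%:R ^+ #|I| * M.
Proof.
move=> H.
have -> : #|B|%:R * #|[set D in tuples I B | P D]|%:R =
    \sum_(D : {ffun I -> T}) \sum_t (if [&& D \in tuples I B, P D & t \in B] then 1 else 0 : R).
  rewrite mulrC -sum1_card natr_sum mulr_suml big_mkcond; apply: eq_bigr => D _.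
  rewrite inE; have [DB|] := boolP (D \in tuples I B); last by rewrite big1.
  have [PD|] := boolP (P D); last by rewrite big1.
  by rewrite /= -big_mkcond /= sumr_const mul1r.
rewrite (sum_exchange i) -natrX -card_tuples -sum1_card natr_sum mulr_suml [leRHS]big_mkcond.
apply: ler_sum => D _; have [DB|DB] := boolP (D \in tuples I B); last first.
  by rewrite big1 // => t _; rewrite andbCA tuples_upd (negPf DB) andbF.
rewrite mul1r; apply: le_trans (H D DB); rewrite -sum1_card natr_sum [leRHS]big_mkcond.
apply: ler_sum => t _; rewrite inE andbCA tuples_upd DB /= andbC; exact: lexx.
Qed.

Lemma sp_setU1 (I : finType) (W : {set I}) (z : {ffun I -> T}) i : i \notin W ->
  sp phi (i |: W) z = (<[phi (z i)]> + sp phi W z)%VS.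
Proof. by move=> iW; rewrite /sp big_setU1. Qed.

Lemma dim_addv_line (G : {vspace V}) v : v \notin G -> \dim (<[v]> + G)%VS = (\dim G).+1.
Proof.
move=> vG; have v0 : v != 0 by apply: contraNneq vG => ->; rewrite mem0v.
rewrite dimv_disjoint_sum ?dim_vline ?v0 //; apply/eqP; rewrite -subv0; apply/subvP => w.
rewrite memv_cap => /andP[/vlineP[k ->] kG]; have [->|k0] := eqVneq k 0; first by rewrite scale0r mem0v.
by case/negP: vG; rewrite -[v]scale1r -(mulVf k0) -scalerA memvZ.
Qed.

Lemma dependent_coord (I : finType) (z : {ffun I -> T}) :
  (\dim (sp phi setT z) < #|I|)%N -> exists i, phi (z i) \in sp phi [set~ i] z.
Proof.
move=> lt; apply/existsP; apply: contraLR lt; rewrite negb_exists => /forallP H; rewrite -leqNgt.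
suff dimW k : forall W : {set I}, #|W| = k -> \dim (sp phi W z) = #|W|.
  by rewrite (dimW #|I|) cardsT.
elim: k => [|k IH] W Wk.
  by rewrite (cards0_eq Wk) /sp big_set0 dimv0 cards0.
have [i iW] : exists i, i \in W by apply/set0Pn; rewrite -card_gt0 Wk.
have Wi : #|W :\ i| = k by move: Wk; rewrite (cardsD1 i) iW => -[].
rewrite -(setD1K iW) sp_setU1 ?setD11 // dim_addv_line ?IH ?cardsU1 ?setD11 //.
apply: contra (H i); apply: subvP; apply: sp_subset; apply/subsetP => k'.
by rewrite !inE => /andP[].
Qed.

(** Some coordinate lies in the span of the others, which has dimension below #|I|; resample that
    coordinate. *)
Lemma dependent_count (I : finType) (B : {set T}) (M : R) : 0 <= M ->
  (forall G : {vspace V}, (\dim G < #|I|)%N -> #|pts phi B G|%:R <= M) ->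
  #|B|%:R * #|[set D in tuples I B | (\dim (sp phi setT D) < #|I|)%N]|%:R <=
    #|I|%:R * (#|B|%:R ^+ #|I| * M).
Proof.
move=> M0 HM; pose P i (D : {ffun I -> T}) := phi (D i) \in sp phi [set~ i] D.
apply: (@le_trans _ _ (\sum_i #|B|%:R * #|[set D in tuples I B | P i D]|%:R)).
  rewrite -mulr_sumr ler_wpM2l // -natr_sum ler_nat.
  apply: (@leq_trans #|\bigcup_i [set D in tuples I B | P i D]|); last exact: card_bigcup_leq.
  apply: subset_leq_card; apply/subsetP => D; rewrite inE => /andP[DB /dependent_coord[i Hi]].
  by apply/bigcupP; exists i => //; rewrite inE DB.
have -> : #|I|%:R * (#|B|%:R ^+ #|I| * M) = \sum_(i : I) #|B|%:R ^+ #|I| * M.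
  by rewrite sumr_const mulr_natl.
apply: ler_sum => i _; apply: (count_coord (i := i)) => D DB.
apply: le_trans (HM (sp phi [set~ i] D) _).
  rewrite ler_nat; apply: subset_leq_card; apply/subsetP => t; rewrite !inE /P upd_same.
  by rewrite sp_upd_notin // !inE eqxx.
apply: (leq_ltn_trans (dim_sp _ _ _)).
by rewrite cardsCs setCK cards1 -ltnS -[X in (_ < X.+1)%N]prednK ?subn1 ?ltnS //; apply/card_gt0P; exists i.
Qed.

(** Take [P] maximal among the sets whose points each raise the dimension by one. *)
Lemma complete_basis (I : finType) (D : {ffun I -> T}) (G : {vspace V}) :
  (G <= sp phi setT D)%VS -> exists2 P : {set I}, (\dim G + #|P| = \dim (sp phi setT D))%N &
    (G + sp phi P D)%VS = sp phi setT D.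
Proof.
move=> GH; pose p (P : {set I}) := \dim (G + sp phi P D)%VS == (\dim G + #|P|)%N.
have p0 : p set0 by rewrite /p /sp big_set0 addv0 cards0 addn0.
have [P pP maxP] := @arg_maxnP _ set0 p (fun P => #|P|) p0.
have E : (G + sp phi P D)%VS = sp phi setT D.
  apply: subv_anti; rewrite subv_add GH sp_subset ?subsetT //=.
  apply: sp_sub => i _; have [//|iH] := boolP (phi (D i) \in (G + sp phi P D)%VS).
  have iP : i \notin P.
    by apply: contra iH => iP; rewrite (subvP (addvSr _ _)) // mem_sp.
  have := maxP (i |: P); rewrite /p sp_setU1 // addvA (addvC G) -addvA dim_addv_line // (eqP pP) cardsU1 iP add1n addnS.
  by rewrite eqxx /= => /(_ isT); rewrite ltnn.
by exists P => //; rewrite -E (eqP pP).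
Qed.

End Counting.

(** * Windows *)

Section RichFlats.
Variables (R : realFieldType) (F : finFieldType) (V : vectType F) (T : finType) (phi : T -> V).
Variables (A : {set T}) (kappa : R).
Hypothesis k0 : 0 < kappa.
Hypothesis k1 : kappa <= 1.
Local Notation a := (npts phi R A).
Local Notation sp := (sp phi).

(* Maximize a(G) kappa^(dim G) over the subspaces G of H. *)
Lemma extremal_flat (H : {vspace V}) : exists G : {vspace V},
  [/\ (G <= H)%VS, good phi A kappa G & kappa ^+ \dim H * a H <= a G].
Proof.
pose f (B : {set T}) : R := a (spT phi B) * kappa ^+ \dim (spT phi B).
have [B BH maxB] := @arg_maxP _ _ _ (pts phi A H) (fun B => B \subset pts phi A H) f (subxx _).
have GH : (spT phi B <= H)%VS.
  by apply: sp_sub => t tB; rewrite ffunE; have := subsetP BH t tB; rewrite inE => /andP[].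
exists (spT phi B); split => //.
  apply/forallP => B'; apply/implyP => B'G; apply/implyP => d.
  have : f B' <= f B := maxB B' (subset_trans B'G (ptsS _ _ GH)).
  rewrite /f.
  rewrite -(subnK (ltnW d)) exprD mulrA ler_pM2r ?exprn_gt0 // => /le_trans; apply.
  rewrite mulrC ler_wpM2r ?npts_ge0 // -[leRHS]expr1 ler_wiXn2l ?subn_gt0 // ltW //.
(* The competitor is the set of all points of [H]: its span still contains all of them. *)
have : f (pts phi A H) <= f B := maxB _ (subxx _).
rewrite /f /npts.
have [-> le] := pts_spT phi A H; rewrite -/(a H) -/(a _) => le2.
apply: (@le_trans _ _ (a H * kappa ^+ \dim (spT phi (pts phi A H)))).
  by rewrite mulrC ler_wpM2l ?npts_ge0 // ler_wiXn2l ?dimvS // ltW.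
by apply: le_trans le2 _; rewrite ler_piMr ?npts_ge0 // exprn_ile1 // ltW.
Qed.

Definition window (theta : R) (I : finType) (W : {set I}) (z : {ffun I -> T}) :=
  [&& \dim (sp W z) == #|W|, good phi A kappa (sp W z) & theta <= a (sp W z)].

(** Apply [dependent_count] to the points of [G]: since [G] is good, at most #|I| kappa <= 1/2 of
    its tuples are dependent. *)
Lemma card_bases (I : finType) (G : {vspace V}) : \dim G = #|I| -> good phi A kappa G ->
  #|I|%:R * kappa <= 2^-1 -> 0 < a G ->
  a G ^+ #|I| <= 2 * #|[set x in tuples I A | sp setT x == G]|%:R.
Proof.
move=> dG /goodP gG kI aG0; set B := pts phi A G.
have BE : #|B|%:R = a G by [].
have HB (G' : {vspace V}) : (\dim G' < #|I|)%N -> #|pts phi B G'|%:R <= kappa * a G.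
  move=> dG'; have -> : pts phi B G' = pts phi A (G :&: G')%VS.
    by apply/setP => t; rewrite !inE memv_cap andbA.
  apply: gG; first exact: capvSl.
  by rewrite dG; apply: leq_ltn_trans dG'; apply: dimvS; apply: capvSr.
have := dependent_count (mulr_ge0 (ltW k0) (ltW aG0)) HB.
rewrite BE; set X := [set D in _ | _] => le.
have XB : X \subset tuples I B by apply/subsetP => D; rewrite inE => /andP[].
have : tuples I B :\: X \subset [set x in tuples I A | sp setT x == G].
  apply/subsetP => D; rewrite !inE => /andP[nX DB]; rewrite DB /= -leqNgt in nX.
  have DG : (sp setT D <= G)%VS.
    by apply: sp_sub => i _; have := forallP DB i; rewrite inE => /andP[].
  apply/andP; split; first by apply/forallP => i; have := forallP DB i; rewrite inE => /andP[].
  by rewrite eqEdim DG dG.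
move=> /subset_leq_card; rewrite cardsD (setIidPr XB) card_tuples -(@ler_nat R) natrB; last first.
  by rewrite -(@card_tuples T) subset_leq_card.
rewrite natrX BE => le2.
have {}le : #|X|%:R <= a G ^+ #|I| / 2.
  rewrite -(ler_pM2l aG0) (le_trans le) //.
  have := ler_wpM2l (mulr_ge0 (ltW aG0) (exprn_ge0 #|I| (ltW aG0))) kI; lra.
lra.
Qed.

(** The coordinates in [P] are free in [A]; they determine the span, in which each remaining
    coordinate has at most [M] choices. *)
Lemma count_extension (I : finType) (G : {vspace V}) (P : {set I}) (M : R) : 0 <= M ->
  #|[set D in tuples I A | ((G + sp P D)%VS == sp setT D) && (a (sp setT D) <= M)]|%:R <=
    #|A|%:R ^+ #|P| * M ^+ (#|I| - #|P|).
Proof.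
move=> M0; set X := [set D in _ | _].
have rhs0 : 0 <= #|A|%:R ^+ #|P| * M ^+ (#|I| - #|P|) by rewrite mulr_ge0 ?exprn_ge0.
have [->|[E0 _]] := set_0Vmem X; first by rewrite cards0.
pose r (D : {ffun I -> T}) : {ffun I -> T} := [ffun i => if i \in P then D i else E0 i].
pose B k : {set T} := if k \in P then A else [set E0 k].
pose Y := [set E : {ffun I -> T} | [forall k, E k \in B k]].
have rY D : D \in X -> r D \in Y.
  rewrite inE => /andP[DA _]; rewrite inE; apply/forallP => k; rewrite ffunE /B.
  by case: ifP => _; [move: DA; rewrite inE => /forallP|rewrite inE].
have cY : #|Y| = (#|A| ^ #|P|)%N.
  rewrite (card_box B) (bigID (mem P)) /= [X in (_ * X)%N]big1 ?muln1; last first.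
    by move=> k; rewrite /B => /negPf ->; rewrite cards1.
  by rewrite (eq_bigr (fun=> #|A|)) ?prod_nat_const // => k kP; rewrite /B ifT.
rewrite -sum1_card natr_sum (partition_big r (mem Y)) //= -natrX -cY -sum1_card natr_sum mulr_suml.
apply: ler_sum => E _; rewrite mul1r.
have [D /andP[DX /eqP rD]|none] := pickP (fun D => (D \in X) && (r D == E)); last first.
  by rewrite big_pred0 // exprn_ge0.
have spE D' : r D' = E -> sp P D' = sp P E.
  by move=> <-; apply: eq_bigr => k kP; rewrite ffunE kP.
have GE : a (G + sp P E)%VS <= M.
  by move: DX; rewrite inE -(spE D rD) => /and3P[_ /eqP -> ].
pose BE k : {set T} := if k \in P then [set E k] else pts phi A (G + sp P E)%VS.
apply: (@le_trans _ _ #|[set D : {ffun I -> T} | [forall k, D k \in BE k]]|%:R).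
  rewrite sumr_const -mulr_natl mulr1 ler_nat; apply: subset_leq_card; apply/subsetP => D'.
  rewrite inE => /andP[D'X /eqP rD']; move: D'X; rewrite inE => /and3P[D'A /eqP GD' _].
  apply/forallP => k; rewrite /BE; rewrite inE in D'A.
  case: ifPn => [kP|_]; first by rewrite inE -rD' ffunE kP.
  by rewrite inE (forallP D'A) -(spE D' rD') GD' mem_sp ?inE.
rewrite (card_box BE) (bigID (mem P)) /= big1 ?mul1n; last first.
  by move=> k; rewrite /BE => ->; rewrite cards1.
rewrite (eq_bigr (fun=> #|pts phi A (G + sp P E)%VS|)); last by move=> k; rewrite /BE => /negPf ->.
rewrite prod_nat_const natrX; have -> : #|[predC P]| = (#|I| - #|P|)%N.
  by rewrite -(cardC (mem P)) addKn.
by rewrite lerXn2r // nnegrE ?ler0n.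
Qed.

(* A typical D is counted through the bases x of its extremal flat G, of which there
   are about a(G)^g: given x, choose the d - g coordinates of D that complete G to the
   span of D; each of the g others is one of the at most kappa^-d a(G) points there. *)
Theorem rich_flats d (theta : R) :
  (forall G : {vspace V}, (\dim G <= 1)%N -> a G <= 1) -> (0 < #|A|)%N ->
  #|A|%:R ^+ d / 2 <= #|[set D in tuples 'I_d A | (\dim (sp setT D) == d) && (theta <= a (sp setT D))]|%:R :> R ->
  1 < kappa ^+ d * theta -> d%:R * kappa <= 2^-1 ->
  exists2 g, (2 <= g <= d)%N &
    kappa ^+ (d * d) / (2 ^+ d.+3 * d.+1%:R) * #|A|%:R ^+ g <=
      #|[set x in tuples 'I_g A | window (kappa ^+ d * theta) setT x]|%:R.
Proof.
move=> H1 A0 HTy kth kd; set Ty := [set D in _ | _] in HTy.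
set de := _ / _; pose Xg g := [set x in tuples 'I_g A | window (kappa ^+ d * theta) setT x].
have n0 : 0 < #|A|%:R :> R by rewrite ltr0n.
have de0 : 0 <= de.
  by apply: divr_ge0; [apply: exprn_ge0; apply: ltW|apply: mulr_ge0; [apply: exprn_ge0|]; apply: ler0n].
have [G GP] := fin_all_exists (fun D : {ffun 'I_d -> T} => extremal_flat (sp setT D)).
have TyP D : D \in Ty -> [/\ D \in tuples 'I_d A, \dim (sp setT D) = d, (G D <= sp setT D)%VS,
    good phi A kappa (G D) & kappa ^+ d * a (sp setT D) <= a (G D) /\ kappa ^+ d * theta <= a (G D)].
  rewrite inE => /and3P[DA /eqP dD th]; have [G1 G2 G3] := GP D; rewrite dD in G3; split => //.
  by split => //; apply: le_trans G3; rewrite ler_pM2l ?exprn_gt0.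
(* A subspace of dimension at most 1 holds at most one point, while [G D] holds more than one. So g
   >= 2, which makes attaching a window of g points a real extension. *)
have TyG D : D \in Ty -> (2 <= \dim (G D) <= d)%N.
  case/TyP => _ dD GD _ [_ th]; have := dimvS GD; rewrite dD => ->; rewrite andbT ltnNge.
  apply/negP => /H1.
  by rewrite leNgt (lt_le_trans kth th).
have [/existsP[g /andP[g2 Hg]]|] := boolP [exists g : 'I_d.+1, (2 <= g)%N && (de * #|A|%:R ^+ g <= #|Xg g|%:R)].
  by exists g; rewrite // g2 -ltnS ltn_ord.
rewrite negb_exists => /forallP none; exfalso.
(* A factor 2^d for the choice of [P], a factor 2 from [card_bases], and kappa^(-d) for each of at
   most d coordinates. The constant [de] makes [d.+1%:R * (K * de)] equal to 1/4, less than the 1/2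
   assumed. *)
pose K : R := 2 ^+ d.+1 / kappa ^+ (d * d).
have K0 : 0 < K by rewrite divr_gt0 ?exprn_gt0.
have bound (g : 'I_d.+1) :
    #|[set D in Ty | \dim (G D) == g]|%:R <= K * de * #|A|%:R ^+ d.
  have [g2|g2] := ltnP g 2.
    suff -> : [set D in Ty | \dim (G D) == g] = set0.
      by rewrite cards0; apply: mulr_ge0; [apply: mulr_ge0 => //; apply: ltW|apply: exprn_ge0].
    apply/setP => D; rewrite [RHS]inE inE; apply/negbTE/negP => /andP[/TyG/andP[le _] /eqP E].
    by rewrite E leqNgt g2 in le.
  have gd : (g <= d)%N by rewrite -ltnS ltn_ord.
  have lt : #|Xg g|%:R <= de * #|A|%:R ^+ g.
    by have := none g; rewrite g2 /= -ltNge => /ltW.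
  have gk : #|'I_g|%:R * kappa <= 2^-1.
    rewrite card_ord; apply: le_trans kd; rewrite ler_wpM2r ?(ltW k0) // ler_nat //.
  (* By [card_bases], the bases of [G D] give each [D] total weight at least 1. Exchanging the sums
     leaves, for each [x], the number of [D] whose [G D] is spanned by [x]. *)
  apply: (@le_trans _ _ (\sum_(D in Ty | \dim (G D) == g)
      \sum_(x in Xg g | sp setT x == G D) 2 / a (sp setT x) ^+ g)).
    rewrite -sum1_card natr_sum; under eq_bigl do rewrite inE.
    apply: ler_sum => D /andP[DTy /eqP dG].
    have [DA dD GD gG [kG thG]] := TyP D DTy.
    have aG0 : 0 < a (G D) by apply: lt_le_trans thG; apply: lt_trans kth.
    have := @card_bases 'I_g (G D); rewrite card_ord in gk *; move=> /(_ dG gG gk aG0) le.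
    rewrite (eq_bigr (fun=> 2 / a (G D) ^+ g)); last by move=> x /andP[_ /eqP ->].
    have -> : \sum_(x in Xg g | sp setT x == G D) 2 / a (G D) ^+ g =
        #|[set x in tuples 'I_g A | sp setT x == G D]|%:R * (2 / a (G D) ^+ g).
      rewrite [RHS]mulr_natl -[RHS]sumr_const; apply: eq_bigl => x; rewrite !inE.
      apply/andP/andP => [[/andP[-> _] ->]|[xA /eqP E]] //; split; last by rewrite E.
      by rewrite xA /window E dG cardsT card_ord eqxx gG.
    by rewrite mulrA [X in _ <= X / _]mulrC ler_pdivlMr ?exprn_gt0 // mul1r.
  rewrite (exchange_big_dep (mem (Xg g))) /=; last by move=> D x _ /andP[].
  have inner x : x \in Xg g ->
      \sum_(D | (D \in Ty) && (\dim (G D) == g) && ((x \in Xg g) && (sp setT x == G D)))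
        2 / a (sp setT x) ^+ g <= K * #|A|%:R ^+ (d - g).
    move=> xX; have aG0 : 0 < a (sp setT x).
      move: xX; rewrite inE => /andP[_ /and3P[_ _ th]].
      by apply: lt_le_trans th; apply: lt_trans kth.
    have dx : \dim (sp setT x) = g.
      by move: xX; rewrite inE => /andP[_ /and3P[/eqP -> _ _]]; rewrite cardsT card_ord.
    set M := a (sp setT x) / kappa ^+ d.
    have M0 : 0 <= M by rewrite divr_ge0 ?npts_ge0 ?exprn_ge0 ?(ltW k0).
    pose Z P := [set D in tuples 'I_d A | ((sp setT x + sp P D)%VS == sp setT D) && (a (sp setT D) <= M)].
    rewrite sumr_const -[leLHS]mulr_natl.
    have le1 : #|[pred D | (D \in Ty) && (\dim (G D) == g) && ((x \in Xg g) && (sp setT x == G D))]|%:R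
       <= \sum_(P : {set 'I_d} | #|P| == (d - g)%N) #|Z P|%:R :> R.
      rewrite -natr_sum ler_nat.
      apply: (@leq_trans #|\bigcup_(P : {set 'I_d} | #|P| == (d - g)%N) Z P|); last first.
        rewrite big_mkcond [X in (_ <= X)%N]big_mkcond /=; apply: (leq_trans (card_bigcup_leq _)).
        by apply: leq_sum => P _; case: ifP; rewrite ?cards0.
      rewrite -(cardsE (fun D => _)); apply: subset_leq_card; apply/subsetP => D.
      rewrite inE => /andP[/andP[DTy /eqP dG] /andP[_ /eqP xG]].
      have [DA dD GD gG [kG thG]] := TyP D DTy.
      have [P PE GP'] := complete_basis GD.
      rewrite dG dD in PE; apply/bigcupP; exists P; first by rewrite -[X in (X - g)%N]PE addKn.
      by rewrite inE DA xG GP' eqxx /= /M xG ler_pdivlMr ?exprn_gt0 // mulrC.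
    have le2 : \sum_(P : {set 'I_d} | #|P| == (d - g)%N) #|Z P|%:R <= 2 ^+ d * (#|A|%:R ^+ (d - g) * M ^+ g).
      have nM : 0 <= #|A|%:R ^+ (d - g) * M ^+ g by rewrite mulr_ge0 ?exprn_ge0.
      apply: (@le_trans _ _ (\sum_(P : {set 'I_d}) #|A|%:R ^+ (d - g) * M ^+ g)).
        rewrite big_mkcond; apply: ler_sum => P _; case: eqP => // cP.
        by have := count_extension (sp setT x) P M0; rewrite cP card_ord subKn.
      by rewrite sumr_const -cardsT -powersetT card_powerset cardsT card_ord -[leLHS]mulr_natl natrX.
    have le3 : #|[pred D | (D \in Ty) && (\dim (G D) == g) && ((x \in Xg g) && (sp setT x == G D))]|%:R
       * (2 / a (sp setT x) ^+ g) <= 2 ^+ d * (#|A|%:R ^+ (d - g) * M ^+ g) * (2 / a (sp setT x) ^+ g).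
      by rewrite ler_wpM2r ?divr_ge0 ?exprn_ge0 ?(ltW aG0) // (le_trans le1).
    apply: le_trans le3 _.
    have -> : 2 ^+ d * (#|A|%:R ^+ (d - g) * M ^+ g) * (2 / a (sp setT x) ^+ g) =
        2 ^+ d.+1 / kappa ^+ (d * g) * #|A|%:R ^+ (d - g).
      rewrite /M expr_div_n -exprM exprS; field.
      by rewrite !expf_neq0 ?gt_eqF.
    rewrite ler_wpM2r ?exprn_ge0 ?ler0n // ler_wpM2l ?exprn_ge0 // lef_pV2 ?posrE ?exprn_gt0 //.
    by rewrite ler_wiXn2l ?leq_mul // ltW.
  apply: le_trans (ler_sum _ inner) _; rewrite sumr_const -[leLHS]mulr_natl.
  have := ler_wpM2r (mulr_ge0 (ltW K0) (exprn_ge0 (d - g) (ltW n0))) lt.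
  move=> /le_trans; apply; rewrite le_eqVlt; apply/orP; left; apply/eqP.
  have -> : #|A|%:R ^+ d = #|A|%:R ^+ g * #|A|%:R ^+ (d - g) :> R by rewrite -exprD subnKC.
  by ring.
have : #|Ty|%:R <= \sum_(g < d.+1) #|[set D in Ty | \dim (G D) == g]|%:R :> R.
  rewrite -natr_sum ler_nat; apply: leq_trans (card_bigcup_leq _).
  apply: subset_leq_card; apply/subsetP => D DTy; have /andP[_ gd] := TyG D DTy.
  rewrite -ltnS in gd; apply/bigcupP; exists (Ordinal gd) => //.
  by rewrite inE DTy /=.
move=> /(le_trans HTy) /le_trans /(_ (ler_sum _ (fun g _ => bound g))).
rewrite sumr_const card_ord -[leRHS]mulr_natl.
have -> : d.+1%:R * (K * de * #|A|%:R ^+ d) = #|A|%:R ^+ d / 4.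
  have d1 : 1 + d%:R != 0 :> R by rewrite addrC natr1 pnatr_eq0.
  by rewrite /K /de !exprS; field; rewrite d1 !expf_neq0 ?gt_eqF.
have := exprn_gt0 d n0; lra.
Qed.

End RichFlats.

(** * Relations built from windows *)

Section Joining.
Variables (R : realFieldType) (T : finType).

Definition fsum (I J : finType) (a : {ffun I -> T}) (b : {ffun J -> T}) : {ffun I + J -> T} :=
  [ffun k => match k with inl i => a i | inr j => b j end].
Definition finl (I J : finType) (z : {ffun I + J -> T}) : {ffun I -> T} := [ffun i => z (inl i)].
Definition finr (I J : finType) (z : {ffun I + J -> T}) : {ffun J -> T} := [ffun j => z (inr j)].
Definition fopt (I : finType) (t : T) (a : {ffun I -> T}) : {ffun option I -> T} :=
  [ffun k => if k is Some i then a i else t].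
Definition fsome (I : finType) (z : {ffun option I -> T}) : {ffun I -> T} := [ffun i => z (Some i)].

Lemma sum_fsum (I J : finType) (G : {ffun I + J -> T} -> R) :
  \sum_z G z = \sum_a \sum_b G (fsum a b).
Proof.
rewrite pair_big /= (reindex (fun p : {ffun I -> T} * {ffun J -> T} => fsum p.1 p.2)) //=.
exists (fun z => (finl z, finr z)) => [[a b]|z] _ /=.
  by congr pair; apply/ffunP => i; rewrite !ffunE.
by apply/ffunP => -[i|j]; rewrite !ffunE.
Qed.

Lemma sum_fopt (I : finType) (G : {ffun option I -> T} -> R) :
  \sum_z G z = \sum_a \sum_t G (fopt t a).
Proof.
rewrite pair_big /= (reindex (fun p : {ffun I -> T} * T => fopt p.2 p.1)) //=.
exists (fun z : {ffun option I -> T} => (fsome z, z None)) => [[a b]|z] _ /=.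
  by congr pair; [apply/ffunP => i|]; rewrite !ffunE.
by apply/ffunP => -[i|]; rewrite !ffunE.
Qed.

Lemma fsum_inl (I J : finType) (a : {ffun I -> T}) (b : {ffun J -> T}) : finl (fsum a b) = a.
Proof. by apply/ffunP => i; rewrite !ffunE. Qed.

Lemma fsum_inr (I J : finType) (a : {ffun I -> T}) (b : {ffun J -> T}) : finr (fsum a b) = b.
Proof. by apply/ffunP => i; rewrite !ffunE. Qed.

Lemma tuples_fsum (I J : finType) (B : {set T}) (a : {ffun I -> T}) (b : {ffun J -> T}) :
  (fsum a b \in tuples (I + J)%type B) = (a \in tuples I B) && (b \in tuples J B).
Proof.
rewrite !inE; apply/forallP/andP => [H|[/forallP Ha /forallP Hb] [i|j]]; last by rewrite ffunE.
  by split; apply/forallP => i; [have := H (inl i)|have := H (inr i)]; rewrite ffunE.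
by rewrite ffunE.
Qed.

Lemma tuples_fopt (I : finType) (B : {set T}) t (a : {ffun I -> T}) :
  (fopt t a \in tuples (option I) B) = (t \in B) && (a \in tuples I B).
Proof.
rewrite !inE; apply/forallP/andP => [H|[tB /forallP Ha] [i|]]; rewrite ?ffunE //.
split; first by have := H None; rewrite ffunE.
by apply/forallP => i; have := H (Some i); rewrite ffunE.
Qed.

Lemma tuples_subset (I : finType) (B B' : {set T}) (z : {ffun I -> T}) :
  B \subset B' -> z \in tuples I B -> z \in tuples I B'.
Proof. by move=> /subsetP s; rewrite !inE => /forallP H; apply/forallP => i; apply: s. Qed.

Lemma mem_tuples (I : finType) (B : {set T}) (z : {ffun I -> T}) i : z \in tuples I B -> z i \in B.
Proof. by rewrite inE => /forallP. Qed.

(** Cauchy-Schwarz in tangent form: f^2 >= 2 m f - m^2. *)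
Lemma sum_sqr_ge (I : finType) (X : {set I}) (f : I -> R) (m : R) :
  0 <= m -> m * #|X|%:R <= \sum_(i in X) f i -> m ^+ 2 * #|X|%:R <= \sum_(i in X) f i ^+ 2.
Proof.
move=> m0 le.
have : \sum_(i in X) (2 * m * f i - m ^+ 2) <= \sum_(i in X) f i ^+ 2.
  by apply: ler_sum => i _; have := sqr_ge0 (f i - m); nra.
apply: le_trans; rewrite sumrB -mulr_sumr sumr_const -[X in _ - X]mulr_natr.
by have := ler_wpM2l m0 le; nra.
Qed.

End Joining.

Section JoiningSpans.
Variables (R : realFieldType) (F : finFieldType) (V : vectType F) (T : finType) (phi : T -> V).

Lemma sp_bij (I J : finType) (h : J -> I) (z : {ffun I -> T}) : bijective h ->
  sp phi setT [ffun j => z (h j)] = sp phi setT z.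
Proof.
move=> hb; rewrite /sp [RHS](reindex h) /=; last exact: onW_bij.
by apply: eq_big => j; rewrite ?inE // ffunE.
Qed.

Lemma sp_fopt (I : finType) t (a : {ffun I -> T}) :
  sp phi setT (fopt t a) = (<[phi t]> + sp phi setT a)%VS.
Proof.
apply: subv_anti; apply/andP; split.
  apply: sp_sub => -[i|] _; rewrite ffunE.
    by rewrite (subvP (addvSr _ _)) // mem_sp ?inE.
  by rewrite (subvP (addvSl _ _)) // memv_line.
rewrite subv_add; apply/andP; split.
  by have := mem_sp phi (fopt t a) (in_setT None); rewrite ffunE memvE.
apply: sp_sub => i _.
by have := mem_sp phi (fopt t a) (in_setT (Some i)); rewrite ffunE.
Qed.

Lemma sum_opt (I : finType) (W : zmodType) (f : option I -> W) :
  \sum_k f k = f None + \sum_i f (Some i).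
Proof.
rewrite (bigD1 None) //=; congr (_ + _).
rewrite (reindex_omap (@Some I) id) /=; last by case.
by apply: eq_bigl => i; rewrite eqxx.
Qed.

Lemma sum_inlr (I J : finType) (W : zmodType) (f : I + J -> W) :
  \sum_k f k = \sum_i f (inl i) + \sum_j f (inr j).
Proof. by rewrite big_sumType. Qed.

Lemma rep_full (I : finType) (D : {ffun I -> T}) u : rep phi setT D u ->
  fullrel phi (fopt u D) /\ sp phi setT (fopt u D) = sp phi setT D.
Proof.
move=> r; split; last first.
  rewrite sp_fopt; apply/addv_idPr; rewrite -memvE; exact: rep_sp r.
case/repP: r => c [c0 uE]; apply/existsP.
exists [ffun k => if k is Some i then c i else -1]; apply/andP; split.
  by apply/forallP => -[i|]; rewrite ffunE ?c0 ?inE // oppr_eq0 oner_eq0.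
rewrite sum_opt !ffunE scaleN1r uE addrC subr_eq0; apply/eqP; apply: eq_bigr => i _.
by rewrite !ffunE.
Qed.

Variable A : {set T}.
Local Notation a := (npts phi R A).

(** If all coordinates but [i] are fixed, a full relation forces the point at [i] into the span [G]
    of the others, and [G] is also the span of the whole tuple: at most a(G) choices, each of weight
    at most 1/a(G). *)
Lemma relation_measure (I : finType) (nu : {ffun I -> T} -> R) :
  (forall z, nu z <= if (z \in tuples I A) && fullrel phi z then (a (sp phi setT z))^-1 else 0) ->
  marginal_le1 nu.
Proof.
move=> H i z; set G := sp phi [set~ i] z.
apply: (@le_trans _ _ (\sum_t if t \in pts phi A G then (a G)^-1 else 0)); last first.
  rewrite sum_indicator -/(a G); have [->|n0] := eqVneq (a G) 0; first by rewrite mul0r ler01.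
  by rewrite mulfV.
apply: ler_sum => t _; apply: le_trans (H _) _.
have inv0 : 0 <= (if t \in pts phi A G then (a G)^-1 else 0).
  by case: ifP; rewrite // invr_ge0 npts_ge0.
case: ifP => // /andP[zA zf].
have spG : sp phi [set~ i] (upd z i t) = G by rewrite /G sp_upd_notin // !inE eqxx.
have := fullrel_sub i zf; rewrite upd_same spG => tG.
have tA := mem_tuples i zA; rewrite upd_same in tA.
by rewrite inE tA tG (fullrel_span i zf) spG.
Qed.

End JoiningSpans.

Lemma card_bij (I J : finType) : #|I| = #|J| -> exists h : I -> J, bijective h.
Proof.
move=> E; exists (fun i => enum_val (cast_ord E (enum_rank i))).
exists (fun j => enum_val (cast_ord (esym E) (enum_rank j))) => i.
  by rewrite enum_valK cast_ordK enum_rankK.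
by rewrite enum_valK cast_ordKV enum_rankK.
Qed.

Section Cleaning.
Variables (R : realFieldType) (T : finType).

Lemma card_reindex_le (I J : finType) (h : J -> I) (X : {set {ffun I -> T}}) (Y : {set {ffun J -> T}}) :
  bijective h -> (forall z, z \in X -> [ffun j => z (h j)] \in Y) -> (#|X| <= #|Y|)%N.
Proof.
case=> h' hK h'K H; pose f (z : {ffun I -> T}) : {ffun J -> T} := [ffun j => z (h j)].
have finj : injective f.
  move=> z z' /ffunP E; apply/ffunP => i; have := E (h' i).
  by rewrite !ffunE h'K.
rewrite -(card_imset _ finj); apply: subset_leq_card; apply/subsetP => _ /imsetP[z zX ->].
exact: H.
Qed.

(* A' maximizes the number of its tuples minus c times the number of its points. *)
Lemma clean (J : finType) (A : {set T}) (X : pred {ffun J -> T}) (c : R) (j0 : J) : 0 <= c ->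
  (forall (h : J -> J) z, bijective h -> X z -> X [ffun j => z (h j)]) ->
  2 * c * #|A|%:R <= #|[set z in tuples J A | X z]|%:R ->
  exists A' : {set T}, [/\ A' \subset A, c * #|A|%:R <= #|[set z in tuples J A' | X z]|%:R &
    forall v, v \in A' -> c <= #|J|%:R * #|[set z in tuples J A' | X z && (z j0 == v)]|%:R].
Proof.
move=> c0 HX HN; pose N (B : {set T}) := [set z in tuples J B | X z].
pose f (B : {set T}) : R := #|N B|%:R - c * #|B|%:R.
have [A' A'A maxA'] := @arg_maxP _ _ _ A (fun B : {set T} => B \subset A) f (subxx _).
have maxf (B : {set T}) : B \subset A -> f B <= f A' := maxA' B.
exists A'; split => //.
  have := maxf A (subxx _); rewrite /f -/(N A) in HN * => le.
  by have := mulr_ge0 c0 (ler0n R #|A'|); lra.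
move=> v vA'; have := maxf (A' :\ v) (subset_trans (subD1set _ _) A'A).
rewrite /f (cardsD1 v A') vA' natrD mulrDr mulr1 => le.
(* By maximality of [A'], removing [v] destroys at least [c] tuples. *)
have {}le : c <= #|N A'|%:R - #|N (A' :\ v)|%:R by lra.
pose M j := [set z in tuples J A' | X z && (z j == v)].
have sub : N A' :\: N (A' :\ v) \subset \bigcup_j M j.
  apply/subsetP => z; rewrite !inE => /andP[nz /andP[zA Xz]].
  have /existsP[j zj] : [exists j, z j == v].
    apply: contraR nz; rewrite negb_exists => /forallP H; rewrite Xz andbT.
    by apply/forallP => j; rewrite !inE H (forallP zA).
  by apply/bigcupP; exists j => //; rewrite !inE zA Xz.
have NN : N (A' :\ v) \subset N A'.
  apply/subsetP => z; rewrite !inE => /andP[/forallP zA ->]; rewrite andbT.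
  by apply/forallP => j; have := zA j; rewrite inE => /andP[].
(* Transposing [j] and [j0] carries the tuples with [v] at [j] to those with [v] at [j0]; hence the
   factor #|J| in the conclusion. *)
have cM j : (#|M j| <= #|M j0|)%N.
  apply: (@card_reindex_le J J (tperm j j0)); first exact: inv_bij (@tpermK _ _ _).
  move=> z; rewrite !(inE, ffunE) => /andP[zA /andP[Xz zj]]; rewrite tpermR zj andbT.
  rewrite HX ?andbT //; last exact: inv_bij (@tpermK _ _ _).
  by apply/forallP => k; rewrite ffunE (forallP zA).
apply: le_trans le _; rewrite -natrB ?subset_leq_card // -natrM ler_nat.
rewrite -{1}(setIidPr NN) -cardsD (leq_trans (subset_leq_card sub)) //.
rewrite (leq_trans (card_bigcup_leq _)) // (leq_trans (leq_sum _ (fun j _ => cM j))) //.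
by rewrite sum_nat_const.
Qed.

End Cleaning.

Section Attach.
Variables (R : realFieldType) (F : finFieldType) (V : vectType F) (T : finType) (phi : T -> V).
Variables (A A' : {set T}) (kappa theta : R).
Hypothesis A'A : A' \subset A.
Hypothesis theta0 : 0 < theta.
Local Notation a := (npts phi R A).
Local Notation sp := (sp phi).

(* A measure on relations.  Coordinate j is the one where the next window will be
   attached: it has to lie in the cleaned set A', whose points all have many windows. *)
Definition relation_weight (I : finType) (j : I) (nu : {ffun I -> T} -> R) :=
  [/\ forall z, 0 <= nu z, supported A nu, marginal_le1 nu,
      forall z, nu z != 0 -> fullrel phi z /\ z j \in A' & forall z, nu z <= theta^-1].

(** A coefficient of a point of the span vanishes only on one of the #|W| subspaces spanned by [W]
    without an index; as the span is good, they cover at most half of its points. *)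
Lemma full_window (I : finType) (W : {set I}) (D : {ffun I -> T}) :
  \dim (sp W D) = #|W| -> good phi A kappa (sp W D) -> #|W|%:R * kappa <= 2^-1 ->
  a (sp W D) <= 2 * #|[set u in A | rep phi W D u]|%:R.
Proof.
move=> dW /goodP gW kW; set Y := [set u in A | _].
have cover : pts phi A (sp W D) :\: Y \subset \bigcup_(i in W) pts phi A (sp (W :\ i) D).
  apply/subsetP => y; rewrite inE => /andP[yY]; rewrite inE => /andP[yA /memv_spP[b yE]].
  have /existsP[i /andP[iW /eqP bi]] : [exists i, (i \in W) && (b i == 0)].
    apply: contraR yY; rewrite negb_exists => /forallP none; rewrite inE yA /=; apply/repP.
    exists [ffun i => if i \in W then b i else 0]; split.
      move=> i; rewrite ffunE; have := none i.
      by case: (i \in W); rewrite ?eqxx //= => ->.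
    rewrite yE big_mkcond; apply: eq_bigr => i _; rewrite ffunE.
    by case: ifP => // _; rewrite scale0r.
  apply/bigcupP; exists i; rewrite // inE yA /=; apply/memv_spP; exists b.
  rewrite yE (bigD1 i) //= bi scale0r add0r; apply: eq_bigl => k.
  by rewrite !inE andbC.
have dK i : i \in W -> (\dim (sp (W :\ i) D) < \dim (sp W D))%N.
  by move=> iW; rewrite dW (leq_ltn_trans (dim_sp _ _ _)) // [X in (_ < X)%N](cardsD1 i) iW.
have le1 := cover_count cover (fun i iW => gW _ (sp_subset _ _ (subD1set _ _)) (dK i iW)).
have Ysub : Y \subset pts phi A (sp W D).
  by apply/subsetP => y; rewrite !inE => /andP[-> /rep_sp].
have : a (sp W D) = #|Y|%:R + #|pts phi A (sp W D) :\: Y|%:R.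
  by rewrite -natrD cardsD (setIidPr Ysub) subnKC // subset_leq_card.
have := ler_wpM2r (npts_ge0 phi R A (sp W D)) kW.
by rewrite mulrA in le1; move=> H1 H2; lra.
Qed.

(** A measure on the relations between [y], [v] and [x]. The window is split as (v, x) because [v]
    is the point to be eliminated when it is glued to another relation. *)
Definition window_weight (J : finType) (y v : T) (x : {ffun J -> T}) : R :=
  if [&& y \in A, fopt v x \in tuples (option J) A',
      window phi A kappa theta setT (fopt v x) & rep phi setT (fopt v x) y]
  then (a (sp setT (fopt v x)))^-1 else 0.

Lemma window_weight_ge0 (J : finType) y v (x : {ffun J -> T}) : 0 <= window_weight y v x.
Proof. by rewrite /window_weight; case: ifP => // _; rewrite invr_ge0 npts_ge0. Qed.

Lemma window_weight_le (J : finType) y v (x : {ffun J -> T}) : window_weight y v x <= theta^-1.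
Proof.
rewrite /window_weight; case: ifP => [/and4P[_ _ /and3P[_ _ th] _]|_].
  by rewrite lef_pV2 ?posrE // (lt_le_trans theta0).
by rewrite invr_ge0 ltW.
Qed.

Lemma window_marginal (J : finType) :
  marginal_le1 (fun l : {ffun option (option J) -> T} =>
    window_weight (l None) (l (Some None)) (fsome (fsome l))).
Proof.
apply: (@relation_measure _ _ _ _ phi A) => l; rewrite /window_weight.
have lE : l = fopt (l None) (fopt (l (Some None)) (fsome (fsome l))).
  by apply/ffunP => -[[k|]|]; rewrite !ffunE.
case: ifP => [/and4P[yA xA' w r]|_]; last by case: ifP; rewrite // invr_ge0 npts_ge0.
have [fr sE] := rep_full r.
have lA : l \in tuples (option (option J)) A.
  by rewrite lE tuples_fopt yA (tuples_subset A'A xA').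
have lf : fullrel phi l by rewrite lE.
have ls : sp setT l = sp setT (fopt (l (Some None)) (fsome (fsome l))) by rewrite {1}lE.
by rewrite lA lf ls.
Qed.

End Attach.

Section Attach2.
Variables (R : realFieldType) (F : finFieldType) (V : vectType F) (T : finType) (phi : T -> V).
Variables (A A' : {set T}) (kappa theta : R).
Hypothesis A'A : A' \subset A.
Hypothesis theta0 : 0 < theta.
Local Notation a := (npts phi R A).
Local Notation sp := (sp phi).
Local Notation ww := (window_weight phi A A' kappa theta).
Local Notation rweight := (relation_weight phi A A' theta).

(* The point y = z (inl j) is a combination of the window (v, x), where x = finr z;
   eliminating v from a relation through v relates y, x and the rest of z. *)
Definition attached (I J : finType) (j : I) (nu : {ffun I -> T} -> R) (z : {ffun I + J -> T}) :=
  \sum_v nu (upd (finl z) j v) * ww (z (inl j)) v (finr z).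

Lemma finl_upd_inl (I J : finType) (z : {ffun I + J -> T}) i t :
  finl (upd z (inl i) t) = upd (finl z) i t.
Proof. by apply/ffunP => k; rewrite !ffunE. Qed.

Lemma finr_upd_inl (I J : finType) (z : {ffun I + J -> T}) i t :
  finr (upd z (inl i) t) = finr z.
Proof. by apply/ffunP => k; rewrite !ffunE. Qed.

Lemma finl_upd_inr (I J : finType) (z : {ffun I + J -> T}) k t :
  finl (upd z (inr k) t) = finl z.
Proof. by apply/ffunP => i; rewrite !ffunE. Qed.

Lemma finr_upd_inr (I J : finType) (z : {ffun I + J -> T}) k t :
  finr (upd z (inr k) t) = upd (finr z) k t.
Proof. by apply/ffunP => i; rewrite !ffunE. Qed.

Lemma upd_comm (I : finType) (z : {ffun I -> T}) i k t u : i != k ->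
  upd (upd z i t) k u = upd (upd z k u) i t.
Proof.
move=> ik; apply/ffunP => l; rewrite !ffunE.
by case: (eqVneq l k) => [->|//]; rewrite eq_sym (negPf ik).
Qed.

Lemma ww_sum_y (J : finType) v (x : {ffun J -> T}) : \sum_t ww t v x <= 1.
Proof.
have := @window_marginal R F V T phi A A' kappa theta A'A J None (fopt v (fopt v x)).
apply: le_trans; rewrite le_eqVlt; apply/orP; left; apply/eqP; apply: eq_bigr => t _.
rewrite !ffunE /=; congr ww.
  by apply/ffunP => k; rewrite !ffunE.
Qed.

Lemma ww_sum_v (J : finType) y (x : {ffun J -> T}) : \sum_t ww y t x <= 1.
Proof.
have := @window_marginal R F V T phi A A' kappa theta A'A J (Some None) (fopt y (fopt y x)).
apply: le_trans; rewrite le_eqVlt; apply/orP; left; apply/eqP; apply: eq_bigr => t _.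
rewrite !ffunE /=; congr ww.
  by apply/ffunP => k; rewrite !ffunE.
Qed.

Lemma ww_sum_x (J : finType) y v (x : {ffun J -> T}) k : \sum_t ww y v (upd x k t) <= 1.
Proof.
have := @window_marginal R F V T phi A A' kappa theta A'A J (Some (Some k)) (fopt y (fopt v x)).
apply: le_trans; rewrite le_eqVlt; apply/orP; left; apply/eqP; apply: eq_bigr => t _.
rewrite !ffunE /=; congr ww.
  by apply/ffunP => k'; rewrite !ffunE.
Qed.

(** Marginals: along [y] or a point of [x], sum the window weight first and then [nu] over [v];
    along another point of the old relation, sum [nu] first and then the window weight over [v].
    Values: a marginal of [nu] times [theta^-1]. Mass: [v] lies in [A'], hence in at least [de]
    windows, each carrying weight at least 1/2 when summed over [y]. *)
Lemma attach (I J : finType) (j : I) (j0 : J) nu (m de : R) :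
  rweight j nu -> 0 <= de -> #|{: option J}|%:R * kappa <= 2^-1 -> m <= \sum_z nu z ->
  (forall v, v \in A' -> de <= #|[set x : {ffun J -> T} | (fopt v x \in tuples (option J) A') &&
                                 window phi A kappa theta setT (fopt v x)]|%:R) ->
  rweight (inr j0 : I + J) (attached j nu) /\ de / 2 * m <= \sum_(z : {ffun I + J -> T}) attached j nu z.
Proof.
case=> nu0 nuA nu1 nuf nub de0 Jk mass deg.
have at0 (z : {ffun I + J -> T}) : 0 <= attached j nu z.
  by apply: sumr_ge0 => v _; rewrite mulr_ge0 ?nu0 ?window_weight_ge0.
have atP (z : {ffun I + J -> T}) : attached j nu z != 0 -> exists v, [/\ nu (upd (finl z) j v) != 0,
    z (inl j) \in A, fopt v (finr z) \in tuples (option J) A' & rep phi setT (fopt v (finr z)) (z (inl j))].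
  move=> nz; have [v /andP[Hv Hw]|none] := pickP (fun v => (nu (upd (finl z) j v) != 0) && (ww (z (inl j)) v (finr z) != 0)).
    exists v; move: Hw; rewrite /window_weight; case: ifP => [/and4P[yA xA' _ r] _|]; first by split.
    by rewrite eqxx.
  case/negP: nz; apply/eqP; apply: big1 => v _; apply/eqP; rewrite mulf_eq0.
  by have := none v; case: (_ =P 0) => //= _ /negbFE.
split; first split.
- exact: at0.
- move=> z /atP[v [nuz yA xA' _]] [i|k].
    have [->//|ij] := eqVneq i j.
    by have := nuA _ nuz i; rewrite upd_other // ffunE.
  by have := mem_tuples (Some k) xA'; rewrite !ffunE => /(subsetP A'A).
- case=> [i|k] z.
    have [->|ij] := eqVneq i j.
      rewrite (eq_bigr (fun t => \sum_v nu (upd (finl z) j v) * ww t v (finr z))); last first.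
        move=> t _; apply: eq_bigr => v _.
        by rewrite finl_upd_inl finr_upd_inl upd_same upd_upd.
      rewrite exchange_big /=; apply: le_trans (nu1 j (finl z)).
      by apply: ler_sum => v _; rewrite -mulr_sumr ler_piMr ?nu0 ?ww_sum_y.
    rewrite (eq_bigr (fun t => \sum_v nu (upd (upd (finl z) j v) i t) * ww (z (inl j)) v (finr z))); last first.
      move=> t _; apply: eq_bigr => v _.
      rewrite finl_upd_inl finr_upd_inl upd_comm // upd_other //.
      by apply: contraNneq ij => -[->].
    rewrite exchange_big /=; apply: le_trans (ww_sum_v (z (inl j)) (finr z)).
    by apply: ler_sum => v _; rewrite -mulr_suml ler_piMl ?nu1 ?window_weight_ge0.
  rewrite (eq_bigr (fun t => \sum_v nu (upd (finl z) j v) * ww (z (inl j)) v (upd (finr z) k t))); last first.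
    move=> t _; apply: eq_bigr => v _.
    by rewrite finl_upd_inr finr_upd_inr upd_other.
  rewrite exchange_big /=; apply: le_trans (nu1 j (finl z)).
  by apply: ler_sum => v _; rewrite -mulr_sumr ler_piMr ?nu0 ?ww_sum_x.
- move=> z /atP[v [nuz yA xA' r]]; split; last first.
    by have := mem_tuples (Some j0) xA'; rewrite !ffunE.
  have [/existsP[l /andP[/forallP l0 /eqP lE]] _] := nuf _ nuz.
  case/repP: r => c [c0 yE]; apply/existsP.
  (* Multiply the relation [l] by [c None] and replace [c None] times the point [v] by [y] minus its
     components along [x]. *)
  exists [ffun k => match k with inl i => if i == j then l j else c None * l i
                               | inr k => - (l j * c (Some k)) end].
  have c0' k : c k != 0 by rewrite c0 inE.
  apply/andP; split.
    apply/forallP => -[i|k]; rewrite ffunE; last by rewrite oppr_eq0 mulf_neq0.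
    by case: ifP => _; [apply: l0|rewrite mulf_neq0 ?l0].
  rewrite (bigD1 j) //= upd_same in lE.
  rewrite sum_inlr (bigD1 j) //= ffunE eqxx yE sum_opt ffunE.
  rewrite [X in _ + X + _](eq_bigr (fun i => c None *: (l i *: phi (upd (finl z) j v i)))); last first.
    by move=> i ij; rewrite ffunE (negPf ij) upd_other // !ffunE scalerA.
  rewrite [X in _ + X == _](eq_bigr (fun k => - (l j *: (c (Some k) *: phi (fopt v (finr z) (Some k)))))); last first.
    by move=> k _; rewrite !ffunE scaleNr scalerA.
  rewrite -scaler_sumr sumrN -scaler_sumr scalerDr addrAC addrK scalerA mulrC -scalerA -scalerDr lE.
  by rewrite scaler0.
- move=> z; apply: (@le_trans _ _ (\sum_v nu (upd (finl z) j v) * theta^-1)).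
    by apply: ler_sum => v _; rewrite ler_wpM2l ?nu0 ?window_weight_le.
  by rewrite -mulr_suml ler_piMl ?nu1 // invr_ge0 ltW.
have -> : \sum_(z : {ffun I + J -> T}) attached j nu z =
    \sum_z nu z * \sum_(x : {ffun J -> T}) \sum_y ww y (z j) x.
  rewrite sum_fsum.
  rewrite (eq_bigr (fun zl : {ffun I -> T} => \sum_v \sum_(x : {ffun J -> T}) nu (upd zl j v) * ww (zl j) v x)); last first.
    move=> zl _; rewrite exchange_big /=; apply: eq_bigr => x _; apply: eq_bigr => v _.
    by rewrite fsum_inl fsum_inr ffunE.
  rewrite (sum_exchange j); apply: eq_bigr => zl _.
  rewrite mulr_sumr exchange_big /=; apply: eq_bigr => x _; rewrite mulr_sumr; apply: eq_bigr => v _.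
  by rewrite updK upd_same.
apply: (@le_trans _ _ (\sum_z nu z * (de / 2))); last first.
  apply: ler_sum => z _; have [->|nuz] := eqVneq (nu z) 0; first by rewrite !mul0r.
  rewrite ler_wpM2l ?nu0 //; have [_ zj] := nuf z nuz.
  apply: (@le_trans _ _ (\sum_(x : {ffun J -> T} | (fopt (z j) x \in tuples (option J) A') &&
                                 window phi A kappa theta setT (fopt (z j) x)) 2^-1)).
    rewrite sumr_const -[leRHS]mulr_natl ler_wpM2r ?invr_ge0 //.
    by have := deg _ zj; rewrite cardsE.
  rewrite big_mkcond; apply: ler_sum => x _; case: ifP => [/andP[xA' w]|_]; last first.
    by apply: sumr_ge0 => y _; apply: window_weight_ge0.
  have /and3P[/eqP dW gW th] := w.
  have := full_window dW gW; rewrite cardsT => /(_ Jk).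
  have aW0 : 0 < a (sp setT (fopt (z j) x)) by apply: lt_le_trans th.
  move=> le; rewrite (eq_bigr (fun y => if y \in [set u in A | rep phi setT (fopt (z j) x) u]
     then (a (sp setT (fopt (z j) x)))^-1 else 0)); last first.
    by move=> y _; rewrite /window_weight xA' w !inE.
  by rewrite sum_indicator ler_pdivlMr // mulrC ler_pdivrMr // mulrC.
by rewrite -mulr_suml mulrC ler_wpM2r // divr_ge0.
Qed.

End Attach2.

(** * Relations from two overlapping windows *)

Section Pair.
Variables (R : realFieldType) (F : finFieldType) (V : vectType F) (T : finType) (phi : T -> V).
Variables (A A' : {set T}) (kappa theta : R).
Hypothesis A'A : A' \subset A.
Hypothesis theta0 : 0 < theta.
Local Notation a := (npts phi R A).
Local Notation sp := (sp phi).
Local Notation rweight := (relation_weight phi A A' theta).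
Local Notation win := (window phi A kappa theta).
Local Notation Phi := (Phi phi R A).

(** A tuple [D] together with a combination [u] of full support is a relation, weighted by the
    inverse number of points in its span; [Phi] is by design a lower bound for the resulting
    mass. *)
Lemma base_weight (I : finType) (j0 : I) (Q : pred {ffun I -> T}) :
  (forall D, Q D -> [/\ D \in tuples I A, theta <= a (sp setT D) & D j0 \in A']) ->
  exists nu, rweight (Some j0) nu /\ Phi Q setT <= \sum_z nu z.
Proof.
move=> HQ; pose nu (z : {ffun option I -> T}) :=
  if [&& z \in tuples (option I) A, fullrel phi z, theta <= a (sp setT z) & z (Some j0) \in A']
  then (a (sp setT z))^-1 else 0.
have nu0 z : 0 <= nu z by rewrite /nu; case: ifP => // _; rewrite invr_ge0 npts_ge0.
exists nu; split; first split => //.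
- by move=> z; rewrite /nu; case: ifP => [/and4P[zA _ _ _] _ i|]; [apply: mem_tuples|rewrite eqxx].
- apply: (@relation_measure _ _ _ _ phi A) => z; rewrite /nu.
  case: ifP => [/and4P[-> -> _ _]//|_].
  by case: ifP => // _; rewrite invr_ge0 npts_ge0.
- by move=> z; rewrite /nu; case: ifP => [/and4P[_ zf _ zj] _|]; [split|rewrite eqxx].
- move=> z; rewrite /nu; case: ifP => [/and4P[_ _ th _]|_]; last by rewrite invr_ge0 ltW.
  by rewrite lef_pV2 ?posrE // (lt_le_trans theta0).
rewrite sum_fopt /Phi big_mkcond; apply: ler_sum => D _.
case: ifP => [QD|_]; last by apply: sumr_ge0.
have [DA th Dj] := HQ D QD; rewrite big_mkcond; apply: ler_sum => u _.
case: ifP => // /andP[uA r]; have [fr sE] := rep_full r.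
by rewrite /nu tuples_fopt uA DA fr sE th ffunE Dj.
Qed.

(** Every point of the span of [D] has at least one support, so the [Phi Q S] add up to at least the
    number of [D], over 2^#|I| supports. *)
Lemma Phi_pigeonhole (I : finType) (Q : pred {ffun I -> T}) :
  (forall D, Q D -> 0 < a (sp setT D)) ->
  exists S : {set I}, #|[set D | Q D]|%:R <= 2 ^+ #|I| * Phi Q S.
Proof.
move=> HQ; have [/existsP[S HS]|] := boolP [exists S : {set I}, #|[set D | Q D]|%:R <= 2 ^+ #|I| * Phi Q S].
  by exists S.
rewrite negb_exists => /forallP none; exfalso.
have : #|[set D | Q D]|%:R <= \sum_(S : {set I}) Phi Q S.
  rewrite /Phi exchange_big /= -sum1_card natr_sum; under eq_bigl do rewrite inE.
  apply: ler_sum => D QD; have a0 := HQ D QD.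
  rewrite (exchange_big_dep (mem A)) /=; last by move=> S u _ /andP[].
  apply: (@le_trans _ _ (\sum_(u in pts phi A (sp setT D)) (a (sp setT D))^-1)).
    by rewrite sumr_const -[leRHS]mulr_natl mulfV // gt_eqF.
  rewrite big_mkcond [leRHS]big_mkcond; apply: ler_sum => u _; rewrite inE.
  case: (boolP (u \in A)) => //= uA; case: ifP => [/sp_rep_ex[S rS]|_].
    rewrite (bigD1 S) ?uA ?rS //= lerDl sumr_ge0 // => S' _.
    by rewrite invr_ge0 npts_ge0.
  by apply: sumr_ge0 => S' _; rewrite invr_ge0 npts_ge0.
apply/negP; rewrite -ltNge.
apply: (@lt_le_trans _ _ (\sum_(S : {set I}) #|[set D | Q D]|%:R / 2 ^+ #|I|)).
  apply: ltr_sum => [|S _]; first by apply/hasP; exists set0; rewrite ?mem_index_enum.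
  by have := none S; rewrite -ltNge ltr_pdivlMr ?exprn_gt0 // mulrC.
rewrite sumr_const; have -> : #|(fun=> true) : pred {set I}| = (2 ^ #|I|)%N.
  by rewrite -cardsT -(card_powerset [set: I]) powersetT cardsT.
by rewrite -[leLHS]mulr_natl natrX mulrC divfK // expf_neq0 ?pnatr_eq0.
Qed.

(** Each counted [u] lies in the span of the window, and at least half of the points there are
    combinations with support exactly [W]. *)
Lemma Phi_window (I : finType) (Q : pred {ffun I -> T}) (S W : {set I}) :
  #|W|%:R * kappa <= 2^-1 -> (forall D, Q D -> win W D) -> S \subset W ->
  Phi Q S <= 2 * Phi Q W.
Proof.
move=> kW HQ SW; rewrite /Phi mulr_sumr; apply: ler_sum => D QD.
have /and3P[/eqP dW gW th] := HQ D QD.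
rewrite !sumr_const -[leLHS]mulr_natl -[X in _ <= 2 * X]mulr_natl mulrA.
rewrite ler_wpM2r ?invr_ge0 ?npts_ge0 //.
have := full_window dW gW kW; rewrite cardsE; apply: le_trans.
rewrite ler_nat; apply: subset_leq_card; apply/subsetP => u; rewrite !inE => /andP[-> r] /=.
by rewrite (subvP (sp_subset phi D SW)) // rep_sp.
Qed.

Variables (K P : finType).
Local Notation ID := (K + (P + P))%type.

(* The K-points are shared by the two windows, side true and side false. *)
Definition side (b : bool) : {set ID} :=
  [set k | match k with inl _ => true | inr (inl _) => b | inr (inr _) => ~~ b end].

Definition side_proj (b : bool) (D : {ffun ID -> T}) : {ffun K + P -> T} :=
  fsum (finl D) (if b then finl (finr D) else finr (finr D)).

Lemma sp_side b D : sp (side b) D = sp setT (side_proj b D).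
Proof.
apply: subv_anti; apply/andP; split; apply: sp_sub.
  case=> [k|[p|p]]; rewrite inE.
  - by have := mem_sp phi (side_proj b D) (in_setT (inl k)); rewrite !ffunE.
  - by case: b => // _; have := mem_sp phi (side_proj true D) (in_setT (inr p)); rewrite !ffunE.
  - by case: b => // _; have := mem_sp phi (side_proj false D) (in_setT (inr p)); rewrite !ffunE.
case=> [k|p] _; rewrite !ffunE; first by apply: (mem_sp phi D (i := inl k)); rewrite inE.
case: b; rewrite !ffunE; first by apply: (mem_sp phi D (i := inr (inl p))); rewrite inE.
by apply: (mem_sp phi D (i := inr (inr p))); rewrite inE.
Qed.

Lemma card_side b : #|side b| = (#|K| + #|P|)%N.
Proof.
rewrite -card_sum; pose h (k : K + P) : ID := match k with inl k => inl k
   | inr p => inr (if b then inl p else inr p) end.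
rewrite -(card_imset (f := h) _); last first.
  by move=> [k|p] [k'|p'] //=; rewrite /h => {h}; [case=> ->|case: b => -[->]].
apply: eq_card => -[k|[p|p]]; rewrite !inE; apply/esym.
- by apply/imsetP; exists (inl k).
- move: b @h => [] h; first by apply/imsetP; exists (inr p).
  by apply/negP => /imsetP[[k|p'] _].
- move: b @h => [] h; last by apply/imsetP; exists (inr p).
  by apply/negP => /imsetP[[k|p'] _].
Qed.

Lemma side_setT b : side b :|: side (~~ b) = setT.
Proof. by apply/setP => -[k|[p|p]]; rewrite !inE //; case: b. Qed.

Definition pairs (D : {ffun ID -> T}) :=
  [&& D \in tuples ID A', win (side true) D & win (side false) D].

(** Cauchy-Schwarz over the shared points: [m] bounds from below the mean number of ways to complete
    #|K| points to a window. *)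
Lemma card_pairs (m : R) : 0 <= m ->
  m * #|A|%:R ^+ #|K| <= #|[set z in tuples (K + P)%type A' | win setT z]|%:R ->
  m ^+ 2 * #|A|%:R ^+ #|K| <= #|[set D | pairs D]|%:R.
Proof.
move=> m0 HN; pose E (x : {ffun K -> T}) (p : {ffun P -> T}) : R :=
  if (fsum x p \in tuples (K + P)%type A') && win setT (fsum x p) then 1 else 0.
have NE : #|[set z in tuples (K + P)%type A' | win setT z]|%:R = \sum_(x in tuples K A) \sum_p E x p.
  rewrite -sum1_card natr_sum big_mkcond sum_fsum [RHS]big_mkcond; apply: eq_bigr => x _.
  case: ifPn => [_|xA]; first by apply: eq_bigr => p _; rewrite inE.
  rewrite big1 // => p _; rewrite inE tuples_fsum ifF //; apply/negbTE; apply: contra xA.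
  by case/andP=> /andP[+ _] _; apply: tuples_subset.
have := @sum_sqr_ge R _ (tuples K A) (fun x => \sum_p E x p) m m0.
rewrite card_tuples natrX -NE => /(_ HN); move=> /le_trans; apply.
rewrite -sum1_card natr_sum big_mkcond [leRHS]big_mkcond sum_fsum /=.
apply: ler_sum => x _; case: ifP => _; last by apply: sumr_ge0 => b _; case: ifP.
rewrite sum_fsum expr2 mulr_suml; apply: ler_sum => p _; rewrite mulr_sumr; apply: ler_sum => p' _.
rewrite /E; case: ifP => [/andP[t1 w1]|_]; last by rewrite mul0r; case: ifP.
case: ifP => [/andP[t2 w2]|_]; last by rewrite mulr0; case: ifP.
rewrite mul1r ifT // inE /pairs /window !sp_side !card_side.
rewrite /window cardsT card_sum in w1 w2.
have s1 : side_proj true (fsum x (fsum p p')) = fsum x p.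
  by rewrite /side_proj fsum_inl !fsum_inr fsum_inl.
have s2 : side_proj false (fsum x (fsum p p')) = fsum x p'.
  by rewrite /side_proj fsum_inl !fsum_inr.
rewrite s1 s2 w1 w2 !tuples_fsum andbT.
by move: t1 t2; rewrite !tuples_fsum => /andP[-> ->] /andP[_ ->].
Qed.

(** Most popular support first, then two steps that enlarge it to all indices, each at the cost of a
    factor 2; together with the pigeonhole this gives the power of 2. *)
Lemma pair_weight (m : R) : (0 < #|K|)%N -> (2 <= #|K| + #|P|)%N -> 0 <= m ->
  (#|K| + #|P|)%:R * kappa <= 2^-1 ->
  m * #|A|%:R ^+ #|K| <= #|[set z in tuples (K + P)%type A' | win setT z]|%:R ->
  exists j nu, rweight (j : option ID) nu /\
    m ^+ 2 * #|A|%:R ^+ #|K| <= 2 ^+ (#|K| + (#|P| + #|P|)).+2 * \sum_z nu z.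
Proof.
move=> K0 g2 m0 kg HN; have HP := card_pairs m0 HN.
have [k0 _] := card_gt0P K0.
have kW b : #|side b|%:R * kappa <= 2^-1 by rewrite card_side.
have pW b D : pairs D -> win (side b) D by case/and3P => _ w1 w2; case: b.
have pA D : pairs D -> D \in tuples ID A by case/and3P => /(tuples_subset A'A).
have pT D b : win (side b) D -> theta <= a (sp setT D).
  by case/and3P => _ _ th; apply: le_trans th _; apply: nptsS; apply: sp_subset; apply: subsetT.
have pQ b D : win (side b) D -> (forall i, D i \in A) -> [/\ forall i, D i \in A,
    \dim (sp (side b) D) = #|side b|, good phi A kappa (sp (side b) D) & 0 < a (sp (side b) D)].
  by case/and3P => /eqP d gd th DA; split => //; apply: lt_le_trans th.
have [S] := @Phi_pigeonhole _ pairs (fun D pD => lt_le_trans theta0 (pT D true (pW true D pD))).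
rewrite card_sum card_sum => HS; have {HP}HS := le_trans HP HS.
suff [j0 [Q' [HQ' le]]] : exists j0 (Q' : pred {ffun ID -> T}), (forall D, Q' D -> [/\ D \in tuples ID A, theta <= a (sp setT D) &
      D j0 \in A']) /\ Phi pairs S <= 4 * Phi Q' setT.
  have [nu [rw mass]] := base_weight HQ'; exists (Some j0), nu; split => //.
  apply: le_trans HS _; rewrite !exprS; have e0 := exprn_ge0 (#|K| + (#|P| + #|P|)) (ler0n R 2).
  have := ler_wpM2l e0 le; have := ler_wpM2l e0 mass; lra.
(* If the support stays inside one window, fill that window by [Phi_window], then absorb the other
   one at a shared point. *)
have [b SW|none] := pickP (fun b => S \subset side b).
  (* The point at [inl k0] will be replaced by one that need not lie in [A'], so the next window has
     to be attached at another coordinate. *)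
  have [j0 j0k] : exists j0 : ID, j0 != inl k0.
    have [p|p0] := pickP (@predT P); first by exists (inr (inl p)).
    have [k1 _ k10] : exists2 k1, k1 \in K & k1 != k0.
      have : (0 < #|predC1 k0|)%N.
        have P0 : #|P| = 0%N by apply: eq_card0 => p; have := p0 p.
        by move: g2; rewrite cardC1 P0 addn0; case: #|K| => [|[]].
      by case/card_gt0P => k1 Hk; exists k1.
    by exists (inl k1); rewrite (inj_eq (@inl_inj _ _)).
  pose Q' (D : {ffun ID -> T}) := [&& D \in tuples ID A, theta <= a (sp setT D) & D j0 \in A'].
  exists j0, Q'; split; first by move=> D /and3P[].
  have le1 := Phi_window (kW b) (pW b) SW.
  have := @absorb F V T phi R A ID pairs Q' (side b) (side (~~ b)) (inl k0) kappa.
  rewrite side_setT !inE => /(_ isT isT (kW _)) le2.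
  have {}le2 : Phi pairs (side b) <= 2 * Phi Q' setT.
    apply: le2 => [D pD|D y pD yA _ _ sE].
      by apply: pQ; [apply: pW|move=> i; apply: mem_tuples (pA D pD)].
    apply/and3P; split; last by rewrite upd_other // (mem_tuples j0 (_ : D \in tuples ID A')) //; case/and3P: pD.
      rewrite inE; apply/forallP => i; have [->|ik] := eqVneq i (inl k0); first by rewrite upd_same.
      by rewrite upd_other // (mem_tuples i (pA D pD)).
    by rewrite sE (pT D true) // pW.
  by lra.
(* Otherwise [S] contains a point private to each window. Absorbing the first window at its private
   point leaves the second one intact, and neither step moves the shared point at [inl k0]. *)
have notin b : exists2 x, x \in S & x \notin side b.
  by apply/subsetPn; rewrite none.
have [x1 x1S x1W] := notin false; have [x2 x2S x2W] := notin true.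
have x1W' : x1 \in side true by move: x1W; rewrite !inE; case: x1 {x1S} => // -[].
have x2W' : x2 \in side false by move: x2W; rewrite !inE; case: x2 {x2S} => // -[].
pose Q1 (D : {ffun ID -> T}) := [&& D \in tuples ID A, win (side false) D & D (inl k0) \in A'].
pose Q2 (D : {ffun ID -> T}) := [&& D \in tuples ID A, theta <= a (sp setT D) & D (inl k0) \in A'].
have x1k : inl k0 != x1 by apply: contraNneq x1W => <-; rewrite inE.
have x2k : inl k0 != x2 by apply: contraNneq x2W => <-; rewrite inE.
have updA D x y : D \in tuples ID A -> y \in A -> upd D x y \in tuples ID A.
  move=> DA yA; rewrite inE; apply/forallP => i; have [->|ik] := eqVneq i x; first by rewrite upd_same.
  by rewrite upd_other // (mem_tuples i DA).
exists (inl k0), Q2; split; first by move=> D /and3P[].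
have le1 : Phi pairs S <= 2 * Phi Q1 (S :|: side true).
  apply: (absorb x1S x1W' (kW true)) => [D pD|D y pD yA _ _ sE].
    by apply: pQ; [apply: pW|move=> i; apply: mem_tuples (pA D pD)].
  apply/and3P; split; first by rewrite updA ?pA.
    by rewrite /window sp_upd_notin //; apply: (pW false D pD).
  by rewrite upd_other // (mem_tuples _ (_ : D \in tuples ID A')) //; case/and3P: pD.
have le2 : Phi Q1 (S :|: side true) <= 2 * Phi Q2 (S :|: side true :|: side false).
  apply: (absorb (x := x2) _ x2W' (kW false)) => [|D /and3P[DA w _]|D y /and3P[DA w Dk] yA _ _ sE].
  - by rewrite inE x2S.
  - by apply: pQ => // i; apply: mem_tuples DA.
  apply/and3P; split; first by rewrite updA.
    by rewrite sE (pT D false).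
  by rewrite upd_other.
by rewrite -setUA (side_setT true) setUT in le2; lra.
Qed.
End Pair.

Section Iterate.
Variables (R : realFieldType) (F : finFieldType) (V : vectType F) (T : finType) (phi : T -> V).
Variables (A A' : {set T}) (kappa theta : R).
Hypothesis A'A : A' \subset A.
Hypothesis theta0 : 0 < theta.
Local Notation rweight := (relation_weight phi A A' theta).

Lemma attach_iter (I J : finType) (j : I) (j0 : J) nu (m de : R) l :
  rweight j nu -> 0 <= de -> #|{: option J}|%:R * kappa <= 2^-1 -> m <= \sum_z nu z ->
  (forall v, v \in A' -> de <= #|[set x : {ffun J -> T} | (fopt v x \in tuples (option J) A') &&
                                 window phi A kappa theta setT (fopt v x)]|%:R) ->
  exists (I' : finType) (j' : I') (nu' : {ffun I' -> T} -> R),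
    [/\ #|I'| = (#|I| + l * #|J|)%N, rweight j' nu' & (de / 2) ^+ l * m <= \sum_z nu' z].
Proof.
move=> rw de0 Jk mass deg; elim: l => [|l [I' [j' [nu' [cI rw' mass']]]]].
  by exists I, j, nu; rewrite addn0 expr0 mul1r.
have [rw2 mass2] := attach A'A theta0 j0 rw' de0 Jk mass' deg.
exists (I' + J)%type, (inr j0), (attached phi A A' kappa theta j' nu'); split => //.
  by rewrite card_sum cI mulSnr addnA.
by rewrite exprS -mulrA.
Qed.

Lemma window_bij (I J : finType) (h : J -> I) (z : {ffun I -> T}) : bijective h ->
  window phi A kappa theta setT [ffun j => z (h j)] = window phi A kappa theta setT z.
Proof. by move=> bh; rewrite /window (sp_bij _ _ bh) !cardsT (bij_eq_card bh). Qed.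

Lemma card_windows (I J : finType) (B : {set T}) : #|I| = #|J| ->
  (#|[set z in tuples I B | window phi A kappa theta setT z]| <=
   #|[set z in tuples J B | window phi A kappa theta setT z]|)%N.
Proof.
move=> IJ; have [h bh] := card_bij (esym IJ).
apply: (card_reindex_le bh) => z; rewrite !inE window_bij // => /andP[zB ->]; rewrite andbT.
by apply/forallP => j; rewrite ffunE (forallP zB).
Qed.

End Iterate.

(* Two windows that share g - e points give relations on g + e + 1 points, and each
   attached window adds g - 1 points; e is chosen so that d + 1 points are reached. *)
Lemma relation_mass (R : realFieldType) (d g : nat) (delta : R) : (2 <= g <= d)%N -> 0 < delta ->
  exists2 de : R, 0 < de & forall (F : finFieldType) (V : vectType F) (T : finType) (phi : T -> V)
    (A : {set T}) (kappa theta : R), 0 < theta -> 0 <= kappa -> d%:R * kappa <= 2^-1 -> (0 < #|A|)%N ->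
    delta * #|A|%:R ^+ g <= #|[set z in tuples 'I_g A | window phi A kappa theta setT z]|%:R ->
    exists (I : finType) (A' : {set T}) (j : I) (nu : {ffun I -> T} -> R),
      [/\ #|I| = d.+1, relation_weight phi A A' theta j nu & de * #|A|%:R ^+ d <= \sum_z nu z].
Proof.
move=> /andP[g2 gd] delta0; have g1 : (0 < g.-1)%N by rewrite -ltnS prednK // ltnW.
(* Division of d - g by g - 1. As e <= g - 2, the two windows share at least two points. *)
pose e := ((d - g) %% g.-1)%N; pose l := ((d - g) %/ g.-1)%N.
have eg : (e < g.-1)%N by rewrite ltn_mod.
have eg' : (e <= g)%N by apply: leq_trans (leq_pred g); apply: ltnW.
have dE : (g + e + l * g.-1 = d)%N.
  by rewrite -addnA [(e + _)%N]addnC -divn_eq subnKC.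
have gP : g.-1.+1 = g by rewrite prednK // ltnW.
(* Half of the windows is given up in passing to [A']. *)
pose c := delta / 2; have c0 : 0 < c by rewrite divr_gt0.
exists ((c / g%:R / 2) ^+ l * (c ^+ 2 / 2 ^+ (g + e).+2)) => [|F V T phi A kappa theta th0 k0 dk n0 HN].
  by rewrite mulr_gt0 ?exprn_gt0 ?divr_gt0 ?ltr0n ?exprn_gt0 // ltnW.
have nn : 0 < #|A|%:R :> R by rewrite ltr0n.
have gk : g%:R * kappa <= 2^-1 by apply: le_trans dk; rewrite ler_wpM2r // ler_nat.
pose J := 'I_g.-1; have cJ : #|{: option J}| = g by rewrite card_option card_ord.
pose j0 : J := Ordinal g1.
have [A' [A'A HA' degA']] : exists A' : {set T}, [/\ A' \subset A,
    c * #|A|%:R ^+ g.-1 * #|A|%:R <= #|[set z in tuples (option J) A' | window phi A kappa theta setT z]|%:R &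
    forall v, v \in A' -> c * #|A|%:R ^+ g.-1 <= #|{: option J}|%:R *
      #|[set z in tuples (option J) A' | window phi A kappa theta setT z && (z None == v)]|%:R].
  apply: clean => [|h z bh|]; first by rewrite mulr_ge0 ?exprn_ge0 ?ltW.
    by rewrite window_bij.
  apply: (@le_trans _ _ (delta * #|A|%:R ^+ g)).
    by rewrite -[in leRHS]gP exprSr /c; lra.
  by apply: le_trans HN _; rewrite ler_nat card_windows // cJ card_ord.
(* [clean] counts windows with [v] at [None]; forgetting that coordinate is injective on them. *)
have deg v : v \in A' -> c / g%:R * #|A|%:R ^+ g.-1 <=
    #|[set x : {ffun J -> T} | (fopt v x \in tuples (option J) A') &&
        window phi A kappa theta setT (fopt v x)]|%:R.
  move=> /degA'; rewrite cJ => le; rewrite mulrAC ler_pdivrMr ?ltr0n ?(ltnW g2) //.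
  apply: (le_trans le); rewrite mulrC ler_wpM2r //.
  rewrite ler_nat -(card_in_imset (f := @fsome T J)); last first.
    move=> z z'; rewrite !inE => /andP[_ /andP[_ /eqP zv]] /andP[_ /andP[_ /eqP zv']] /ffunP E.
    by apply/ffunP => -[k|]; [have := E k; rewrite !ffunE|rewrite zv].
  apply: subset_leq_card; apply/subsetP => _ /imsetP[z zX ->].
  move: zX; rewrite inE => /andP[zA /andP[w /eqP zv]].
  have zE : fopt v (fsome z) = z by apply/ffunP => -[k|]; rewrite !ffunE ?zv.
  by rewrite inE zE zA.
have cK : #|{: 'I_(g - e) + 'I_e}| = g by rewrite card_sum !card_ord subnK.
have cg : (g - e + e = g)%N by rewrite subnK.
have [j [nu [rw mass]]] := @pair_weight R F V T phi A A' kappa theta A'A th0 'I_(g - e) 'I_e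
  (c * #|A|%:R ^+ e)
  ltac:(rewrite card_ord subn_gt0; apply: leq_trans (leq_pred g); exact: eg)
  ltac:(by rewrite !card_ord cg) ltac:(by rewrite mulr_ge0 ?exprn_ge0 ?ltW)
  ltac:(by rewrite !card_ord cg)
  ltac:(rewrite card_ord -mulrA -exprD subnKC //; apply: le_trans (le_trans _ HA') _;
    [by rewrite -mulrA -exprSr gP | by rewrite ler_nat; apply: card_windows; rewrite cJ cK]).
have mass' : c ^+ 2 / 2 ^+ (g + e).+2 * #|A|%:R ^+ (g + e) <= \sum_z nu z.
  have E2 : (g - e + (e + e) = g + e)%N by rewrite addnA subnK.
  move: mass; rewrite !card_ord E2 => mass.
  rewrite mulrAC ler_pdivrMr ?exprn_gt0 // [leRHS]mulrC; apply: le_trans mass.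
  have -> : (g + e = e + e + (g - e))%N by rewrite [RHS]addnC E2.
  by rewrite !exprD le_eqVlt; apply/orP; left; apply/eqP; ring.
have de0 : 0 <= c / g%:R * #|A|%:R ^+ g.-1 by rewrite mulr_ge0 ?exprn_ge0 ?divr_ge0 ?ler0n // ltW.
have [] := attach_iter A'A th0 j0 l rw de0 _ mass' deg; first by rewrite cJ.
move=> I [j' [nu' [cI rw' mass2]]].
exists I, A', j', nu'; split => //.
  rewrite cI card_option !card_sum !card_ord addnA -[RHS]/(d.+1) -[in RHS]dE.
  by rewrite addSn; congr ((_ + _).+1); rewrite -addnA addnA subnK.
apply: le_trans mass2; rewrite le_eqVlt; apply/orP; left; apply/eqP.
have -> : #|A|%:R ^+ d = #|A|%:R ^+ (g + e) * (#|A|%:R ^+ g.-1) ^+ l :> R.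
  by rewrite -exprM mulnC -exprD dE.
have -> : c / g%:R * #|A|%:R ^+ g.-1 / 2 = c / g%:R / 2 * #|A|%:R ^+ g.-1 by ring.
rewrite [in RHS]exprMn; ring.
Qed.

(** * Supersaturation *)

Section Points.
Variables (R : realFieldType) (F : finFieldType) (d : nat).
Local Notation T := 'rV[F]_d.

Definition pnt (x : T) : 'rV[F]_(1 + d) := row_mx 1 x.

Lemma pnt_neq0 x : pnt x != 0.
Proof.
apply/eqP => /(congr1 lsubmx); rewrite row_mxKl linear0 => /matrixP /(_ ord0 ord0).
by rewrite !mxE => /eqP; rewrite oner_eq0.
Qed.

Lemma pnt_relation (I : finType) (c : I -> F) (z : I -> T) :
  \sum_i c i *: pnt (z i) = 0 <-> \sum_i c i = 0 /\ \sum_i c i *: z i = 0.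
Proof.
have -> : \sum_i c i *: pnt (z i) = row_mx (\sum_i c i)%:M (\sum_i c i *: z i).
  rewrite -[LHS]hsubmxK !linear_sum /=; congr row_mx.
    rewrite raddf_sum; apply: eq_bigr => i _.
    by rewrite linearZ /= row_mxKl scalemx1.
  by apply: eq_bigr => i _; rewrite linearZ /= row_mxKr.
split => [H|[-> ->]]; last by rewrite raddf0 row_mx0.
split; last by have := congr1 rsubmx H; rewrite row_mxKr linear0.
have := congr1 lsubmx H; rewrite row_mxKl linear0 => /matrixP /(_ ord0 ord0).
by rewrite !mxE mulr1n.
Qed.

(** The leading coordinate 1 fixes the scaling, so a line through the origin contains at most one
    homogenized point. *)
Lemma pts_line (A : {set T}) (G : {vspace 'rV[F]_(1 + d)}) : (\dim G <= 1)%N -> npts pnt R A G <= 1.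
Proof.
move=> dG; rewrite /npts -[1]/(1%:R) ler_nat; apply/card_le1_eqP => x y.
rewrite !inE => /andP[_ xG] /andP[_ yG].
have GE : G = <[pnt x]>%VS.
  apply/esym/eqP; rewrite eqEdim -memvE xG (leq_trans dG) // dim_vline.
  by rewrite pnt_neq0.
move: yG; rewrite GE => /vlineP[k E].
have := congr1 lsubmx E; rewrite linearZ /= !row_mxKl => /matrixP /(_ ord0 ord0).
rewrite !mxE mulr1 => k1.
have := congr1 rsubmx E; rewrite linearZ /= !row_mxKr => ->.
by rewrite -k1 scale1r.
Qed.

Lemma sp_annihilated (z : {ffun 'I_d -> T}) (y : 'cV[F]_(1 + d)) (x : T) :
  y != 0 -> \dim (sp pnt setT z) = d -> (forall i, pnt (z i) *m y = 0) ->
  (pnt x *m y == 0) = (pnt x \in sp pnt setT z).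
Proof.
move=> y0 dz zy; pose f := linfun (mulmxr y : 'rV[F]_(1 + d) -> 'M[F]_1).
have mf v : (v \in lker f) = (v *m y == 0) by rewrite memv_ker lfunE.
have spf : (sp pnt setT z <= lker f)%VS by apply: sp_sub => i _; rewrite mf zy.
apply/idP/idP => [xy|/(subvP spf)]; last by rewrite mf.
apply: contraR y0 => xz.
have full : (<[pnt x]> + sp pnt setT z)%VS = fullv.
  apply/eqP; rewrite eqEdim subvf dimvf /= /dim /= mul1n.
  by rewrite dim_addv_line // dz.
have ff : (fullv <= lker f)%VS.
  by rewrite -full subv_add spf andbT -memvE mf.
apply/eqP/matrixP => i j; have := subvP ff (delta_mx 0 i) (memvf _).
by rewrite mf -rowE => /eqP/matrixP/(_ 0 j); rewrite !mxE.
Qed.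

Lemma annihilator (z : {ffun 'I_d -> T}) : exists2 y : 'cV[F]_(1 + d), y != 0 & forall i, pnt (z i) *m y = 0.
Proof.
pose M : 'M[F]_(d, 1 + d) := \matrix_(i, j) pnt (z i) 0 j.
have : kermx M^T != 0.
  rewrite kermx_eq0 /row_free neq_ltn; apply/orP; left.
  by apply: leq_ltn_trans (rank_leq_col _) _.
case/rowV0Pn => v vk v0; exists v^T; first by rewrite -(inj_eq trmx_inj) trmxK trmx0.
move=> i; apply: trmx_inj; rewrite trmx_mul trmxK trmx0.
move/sub_kermxP: vk => /matrixP /(_ 0 i) E; apply/matrixP => a b; rewrite !ord1 mxE [RHS]mxE.
by rewrite !mxE in E; rewrite -[RHS]E; apply: eq_bigr => k _; rewrite !mxE.
Qed.

(* A tuple spanning a hyperplane is annihilated by q - 1 covectors, whose zeros are the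
   points of that hyperplane; count the pairs (tuple, covector). *)
Lemma thin_count (A : {set T}) (theta : R) : 0 <= theta ->
  (#|F|%:R - 1) * #|[set z in tuples 'I_d A | (\dim (sp pnt setT z) == d) && (npts pnt R A (sp pnt setT z) < theta)]|%:R
    <= #|F|%:R ^+ d.+1 * theta ^+ d.
Proof.
move=> th0; set X := [set z in _ | _].
pose K (y : 'cV[F]_(1 + d)) := [set x in A | pnt x *m y == 0].
pose Y := [set y : 'cV[F]_(1 + d) | (y != 0) && (#|K y|%:R < theta)].
pose P (z : {ffun 'I_d -> T}) (y : 'cV[F]_(1 + d)) := [forall i, z i \in K y].
have up : \sum_(z in X) #|[set y in Y | P z y]|%:R <= #|F|%:R ^+ d.+1 * theta ^+ d.
  apply: (@le_trans _ _ (\sum_(y in Y) theta ^+ d)); last first.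
    rewrite sumr_const -[leLHS]mulr_natl ler_wpM2r ?exprn_ge0 // -natrX ler_nat.
    by apply: leq_trans (max_card _) _; rewrite card_mx muln1.
  rewrite (eq_bigr (fun z => \sum_(y in Y) (P z y)%:R)); last first.
    move=> z _; rewrite -natr_sum; congr _%:R; rewrite -sum1_card big_mkcond [RHS]big_mkcond.
    by apply: eq_bigr => y _; rewrite inE; case: (y \in Y) => //=; case: (P z y).
  rewrite exchange_big; apply: ler_sum => y; rewrite inE => /andP[_ lt].
  rewrite -natr_sum; apply: (@le_trans _ _ (#|tuples 'I_d (K y)|%:R)).
    rewrite ler_nat -sum1_card big_mkcond [leqRHS]big_mkcond /=; apply: leq_sum => z _.
    have -> : (z \in tuples 'I_d (K y)) = P z y by rewrite inE.
    by case: (z \in X); case: (P z y).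
  by rewrite card_tuples card_ord natrX lerXn2r ?nnegrE // ltW.
apply: le_trans up; rewrite mulrC mulr_natl -sumr_const; apply: ler_sum => z.
rewrite inE => /and3P[zA /eqP dz lt]; have [y y0 yz] := annihilator z.
have -> : #|F|%:R - 1 = #|predC1 (0 : F)|%:R :> R.
  by rewrite cardC1 -subn1 natrB //; apply/card_gt0P; exists 0.
rewrite ler_nat -(card_in_imset (f := fun c : F => c *: y) (D := predC1 0)); last first.
  move=> c c' _ _ /eqP; rewrite -subr_eq0 -scalerBl scaler_eq0 (negPf y0) orbF subr_eq0.
  by move/eqP.
apply: subset_leq_card; apply/subsetP => _ /imsetP[c c0 ->]; rewrite inE in c0; rewrite !inE.
have cy0 : c *: y != 0 by rewrite scaler_eq0 negb_or c0.
have cyz i : pnt (z i) *m (c *: y) = 0 by rewrite -scalemxAr yz scaler0.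
rewrite cy0 /=; apply/andP; split; last first.
  by apply/forallP => i; rewrite inE cyz eqxx (mem_tuples i zA).
rewrite (_ : K _ = pts pnt A (sp pnt setT z)) //.
by apply/setP => x; rewrite !inE (sp_annihilated _ cy0 dz cyz).
Qed.

(** The tuples left out are dependent, a proportion at most d eps <= 1/4, or span a hyperplane with
    fewer than n / (4q) points, a proportion at most 4^(-d) q / (q - 1) <= 1/8. *)
Lemma typical_count (A : {set T}) (eps : R) : (2 <= d)%N -> (0 < #|A|)%N ->
  0 <= eps -> d%:R * eps <= 4^-1 ->
  (forall G : {vspace 'rV[F]_(1 + d)}, (\dim G <= d)%N -> npts pnt R A G <= eps * #|A|%:R) ->
  #|A|%:R ^+ d / 2 <= #|[set z in tuples 'I_d A | (\dim (sp pnt setT z) == d) &&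
     (#|A|%:R / (4 * #|F|%:R) <= npts pnt R A (sp pnt setT z))]|%:R :> R.
Proof.
move=> d2 A0 e0 de HG; set n : R := #|A|%:R; set q : R := #|F|%:R.
have n0 : 0 < n by rewrite ltr0n.
have q2 : 2 <= q by rewrite ler_nat; apply: card_finNzRing_gt1.
set th := n / (4 * q).
have th0 : 0 <= th by apply: divr_ge0; [apply: ltW|apply: mulr_ge0].
set Ty := [set z in _ | _].
pose X1 := [set z in tuples 'I_d A | (\dim (sp pnt setT z) < d)%N].
pose X2 := [set z in tuples 'I_d A | (\dim (sp pnt setT z) == d) && (npts pnt R A (sp pnt setT z) < th)].
have cover : (#|tuples 'I_d A| <= #|Ty| + (#|X1| + #|X2|))%N.
  apply: leq_trans (_ : #|Ty :|: (X1 :|: X2)| <= _)%N; last first.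
    by rewrite cardsU (leq_trans (leq_subr _ _)) // leq_add2l cardsU leq_subr.
  apply: subset_leq_card; apply/subsetP => z zA; rewrite !inE in zA *; rewrite zA /=.
  have := dim_sp pnt setT z; rewrite cardsT card_ord leq_eqVlt => /orP[/eqP->|->]; last by rewrite orbT.
  by rewrite eqxx /= ltnn /= orbC ltNge orNb.
have le1 : #|X1|%:R <= n ^+ d / 4.
  have HG' G : (\dim G < #|'I_d|)%N -> #|pts pnt A G|%:R <= eps * n.
    by rewrite card_ord => /ltnW /HG.
  have := dependent_count (mulr_ge0 e0 (ltW n0)) HG'; rewrite card_ord -/X1 -/n => le.
  rewrite -(ler_pM2l n0) (le_trans le) //.
  have := ler_wpM2r (mulr_ge0 (ltW n0) (exprn_ge0 d (ltW n0))) de; lra.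
have le2 : #|X2|%:R <= n ^+ d / 8.
  have := thin_count A th0; rewrite -/X2 -/q => le.
  have E : q ^+ d.+1 * th ^+ d = q * (n ^+ d / 4 ^+ d).
    by rewrite /th expr_div_n exprMn exprS; field; rewrite !expf_neq0 ?gt_eqF //; lra.
  have q4 : n ^+ d / 4 ^+ d <= n ^+ d / 16.
    rewrite ler_wpM2l ?exprn_ge0 ?(ltW n0) // lef_pV2 ?posrE ?exprn_gt0 //.
    by apply: (@le_trans _ _ (4 ^+ 2)); [rewrite expr2; lra|rewrite ler_weXn2l // ler1n].
  rewrite E in le; have nd := exprn_gt0 d n0.
  have q10 : 0 < q - 1 by lra.
  rewrite -(ler_pM2l q10) (le_trans le) //.
  have q0 : 0 <= q by lra.
  have := ler_wpM2l q0 q4; nra.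
have nd := exprn_gt0 d n0; have := cover; rewrite -(@ler_nat R) !natrD card_tuples card_ord natrX -/n; lra.
Qed.

End Points.

(** Sum first over a third coordinate [k], at cost 1; coordinate [i] is determined by [j], so #|I| -
    2 coordinates remain free. *)
Lemma collision_mass (R : realFieldType) (T I : finType) (A : {set T}) (mu : {ffun I -> T} -> R) i j :
  (2 < #|I|)%N -> i != j -> (forall z, 0 <= mu z) -> supported A mu -> marginal_le1 mu ->
  \sum_(z : {ffun I -> T} | z i == z j) mu z <= #|A|%:R ^+ (#|I| - 2).
Proof.
move=> I2 ij mu0 muA mu1.
have [k ki kj] : exists2 k, k != i & k != j.
  have /card_gt0P[k] : (0 < #|~: [set i; j]|)%N.
    by have := cardsC [set i; j]; rewrite cards2 ij /= => E; rewrite -(ltn_add2l 2) E addn0.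
  by rewrite !inE negb_or => /andP[]; exists k.
have [A0|[t0 t0A]] := set_0Vmem A.
  rewrite big1 ?exprn_ge0 // => z _; apply/eqP; apply: contraTT isT => /muA/(_ i).
  by rewrite A0 inE.
rewrite big_mkcond (sum_upd k t0) /=.
pose Y := [set z : {ffun I -> T} | [&& z k == t0, z i == z j & [forall l, z l \in A]]].
apply: (@le_trans _ _ (\sum_(z in Y) 1)).
  rewrite big_mkcond [leRHS]big_mkcond; apply: ler_sum => z _; rewrite inE.
  case: eqP => //= zk; rewrite (eq_bigr (fun t => if z i == z j then mu (upd z k t) else 0)); last first.
    by move=> t _; rewrite (upd_other _ _ (k := i)) 1?eq_sym // (upd_other _ _ (k := j)) 1?eq_sym.
  case: (z i == z j) => /=; last by rewrite big1.
  case: ifPn => [_|/forallPn[l zl]]; first exact: mu1.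
  rewrite big1 // => t _; apply/eqP; apply: contraTT isT => /muA/(_ l).
  have lk : l != k by apply: contraNneq zl => ->; rewrite zk.
  by rewrite upd_other // (negPf zl).
rewrite sumr_const -[leLHS]mulr_natl mulr1 -natrX ler_nat.
pose B l := if (l == k) || (l == i) then [set t0] else A.
have finj : {in Y &, injective (fun z : {ffun I -> T} => upd z i t0)}.
  move=> z z'; rewrite !inE => /and3P[_ /eqP zij _] /and3P[_ /eqP zij' _] E.
  have Ez l : l != i -> z l = z' l.
    by move=> li; have := congr1 (fun f : {ffun I -> T} => f l) E; rewrite !upd_other.
  by apply/ffunP => l; have [->|/Ez//] := eqVneq l i; rewrite zij zij' Ez // eq_sym.
rewrite -(card_in_imset finj).
apply: (@leq_trans #|[set z : {ffun I -> T} | [forall l, z l \in B l]]|).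
  apply: subset_leq_card; apply/subsetP => _ /imsetP[z zY ->].
  move: zY; rewrite !inE => /and3P[/eqP zk _ /forallP zA]; apply/forallP => l; rewrite /B.
  have [->|li] := eqVneq l i; first by rewrite orbT upd_same inE.
  rewrite orbF upd_other //; have [->|lk] := eqVneq l k; first by rewrite zk inE.
  exact: zA.
rewrite card_box (bigID (mem (~: [set k; i]))) /= [X in (_ * X)%N]big1 ?muln1; last first.
  by move=> l; rewrite !inE negbK /B => ->; rewrite cards1.
rewrite (eq_bigr (fun=> #|A|)); last by move=> l; rewrite !inE /B => /negPf ->.
have <- : #|~: [set k; i]| = (#|I| - 2)%N by rewrite cardsCs setCK cards2 ki.
by rewrite prod_nat_const.
Qed.

Section Reindex.
Variables (R : realFieldType) (F : finFieldType) (V : vectType F) (T : finType) (phi : T -> V).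

Lemma fullrel_bij (I J : finType) (h : J -> I) (z : {ffun I -> T}) : bijective h ->
  fullrel phi z -> fullrel phi [ffun j => z (h j)].
Proof.
move=> bh /existsP[c /andP[/forallP c0 /eqP E]]; apply/existsP; exists [ffun j => c (h j)].
apply/andP; split; first by apply/forallP => j; rewrite ffunE.
apply/eqP; rewrite -[RHS]E [RHS](reindex h) /=; last exact: onW_bij.
by apply: eq_bigr => j _; rewrite !ffunE.
Qed.

Lemma reindex_weight (I J : finType) (A A' : {set T}) (theta : R) (j : I) (nu : {ffun I -> T} -> R) :
  #|I| = #|J| -> relation_weight phi A A' theta j nu ->
  exists mu : {ffun J -> T} -> R, [/\ forall z, 0 <= mu z, supported A mu, marginal_le1 mu,
    forall z, mu z != 0 -> fullrel phi z & (forall z, mu z <= theta^-1) /\ \sum_z mu z = \sum_z nu z].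
Proof.
move=> IJ [nu0 nuA nu1 nuf nub]; have [h bh] := card_bij IJ; have [h' hK h'K] := bh.
have bh' : bijective h' by exists h.
pose f (z : {ffun J -> T}) : {ffun I -> T} := [ffun i => z (h i)].
pose f' (z : {ffun I -> T}) : {ffun J -> T} := [ffun j => z (h' j)].
have fK : cancel f f' by move=> z; apply/ffunP => l; rewrite !ffunE h'K.
have f'K : cancel f' f by move=> z; apply/ffunP => l; rewrite !ffunE hK.
exists (fun z => nu (f z)); split => //.
- by move=> z /nuA zA l; have := zA (h' l); rewrite ffunE h'K.
- move=> k z; apply: le_trans (nu1 (h' k) (f z)); rewrite le_eqVlt; apply/orP; left; apply/eqP.
  apply: eq_bigr => t _; congr nu; apply/ffunP => l; rewrite !ffunE.
  by rewrite (can2_eq hK h'K).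
- by move=> z /nuf[fr _]; rewrite -[z]fK; apply: fullrel_bij.
by split => //; rewrite [RHS](reindex f) //; exists f' => z _; [apply: fK|apply: f'K].
Qed.

End Reindex.

(** For [supersaturation], where the window size g depends on the point set but the constant must
    not. *)
Lemma uniform_constant (R : realFieldType) (P : nat -> R -> Prop) m :
  (forall g, (g < m)%N -> exists2 a, 0 < a & P g a) -> (forall g a b, b <= a -> P g a -> P g b) ->
  exists2 a, 0 < a & forall g, (g < m)%N -> P g a.
Proof.
move=> H mono; elim: m H => [|m IHm] H; first by exists 1.
have [a a0 Ha] := IHm (fun g gm => H g (ltnW gm)); have [b b0 Hb] := H m (ltnSn m).
exists (Num.min a b) => [|g]; first by rewrite lt_min a0.
rewrite ltnS leq_eqVlt => /orP[/eqP->|gm]; first by apply: mono Hb; rewrite ge_min lexx orbT.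
by apply: mono (Ha g gm); rewrite ge_min lexx.
Qed.

(** Combines [typical_count], [rich_flats] and [relation_mass]. Tuples with repeated points are
    discarded at the end, since general position only forbids relations between distinct points. *)
Theorem supersaturation (R : realFieldType) (d : nat) : (2 <= d)%N ->
  exists C0 Bq de : R, [/\ 0 < C0, 0 < Bq, 0 < de & forall (F : finFieldType) (A : {set 'rV[F]_d}),
    C0 * #|F|%:R <= #|A|%:R ->
    (forall G : {vspace 'rV[F]_(1 + d)}, (\dim G <= d)%N -> npts (@pnt F d) R A G <= (4 * d%:R)^-1 * #|A|%:R) ->
    exists mu : {ffun 'I_d.+1 -> 'rV[F]_d} -> R,
      [/\ forall z, 0 <= mu z, supported A mu /\ marginal_le1 mu,
          forall z, mu z != 0 -> fullrel (@pnt F d) z /\ injective z,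
          forall z, mu z <= Bq * #|F|%:R / #|A|%:R & de * #|A|%:R ^+ d <= \sum_z mu z]].
Proof.
move=> d2; have d0 : 0 < d%:R :> R by rewrite ltr0n ltnW.
pose kappa : R := (2 * d%:R)^-1.
have k0 : 0 < kappa by rewrite invr_gt0 mulr_gt0.
have kd : d%:R * kappa <= 2^-1 by rewrite /kappa le_eqVlt; apply/orP; left; apply/eqP; field; lra.
have d1 : 1 <= d%:R :> R by rewrite ler1n ltnW.
have k1 : kappa <= 1 by rewrite invf_le1 ?mulr_gt0 //; lra.
pose delta : R := kappa ^+ (d * d) / (2 ^+ d.+3 * d.+1%:R).
have delta0 : 0 < delta by apply: divr_gt0; [apply: exprn_gt0|apply: mulr_gt0; [apply: exprn_gt0|]].
have [de1 de10 Hde] := @uniform_constant R (fun g de => (2 <= g)%N ->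
   forall (F : finFieldType) (V : vectType F) (T : finType) (phi : T -> V)
    (A : {set T}) (kappa theta : R), 0 < theta -> 0 <= kappa -> d%:R * kappa <= 2^-1 -> (0 < #|A|)%N ->
    delta * #|A|%:R ^+ g <= #|[set z in tuples 'I_g A | window phi A kappa theta setT z]|%:R ->
    exists (I : finType) (A' : {set T}) (j : I) (nu : {ffun I -> T} -> R),
      [/\ #|I| = d.+1, relation_weight phi A A' theta j nu & de * #|A|%:R ^+ d <= \sum_z nu z]) d.+1
  ltac:(move=> g gd; have [g2|g2] := leqP 2 g; [
    have [||de de0 H] := @relation_mass R d g delta; [by rewrite g2 -ltnS| exact: delta0 | by exists de => // _]
    | by exists 1 => // H; rewrite leqNgt g2 in H])
  ltac:(by move=> g a b ba Ha g2 F V T phi A ka th H1 H2 H3 H4 H5;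
     have [I [A' [j [nu [cI rw ma]]]]] := Ha g2 F V T phi A ka th H1 H2 H3 H4 H5;
     exists I, A', j, nu; split => //; apply: le_trans ma; rewrite ler_wpM2r ?exprn_ge0).
pose D2 : R := (d.+1 * d.+1)%:R; have D20 : 0 < D2 by rewrite ltr0n.
have kd0 : 0 < kappa ^+ d by rewrite exprn_gt0.
(* The first term makes kappa^d n / (4q) exceed 1, as [rich_flats] requires; the second makes the
   mass lost to repeated points at most half of the total. *)
pose C0 : R := 8 / kappa ^+ d + 2 * D2 / de1.
have C00 : 0 < C0 by rewrite addr_gt0 // divr_gt0 ?mulr_gt0.
exists C0, (4 / kappa ^+ d), (de1 / 2); split; [exact: C00|exact: divr_gt0|exact: divr_gt0|].
move=> F A HA HG; set n : R := #|A|%:R in HA *; set q : R := #|F|%:R in HA *.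
have q1 : 1 <= q by rewrite ler1n; apply: ltnW; apply: card_finNzRing_gt1.
have n0 : 0 < n by apply: lt_le_trans HA; rewrite mulr_gt0 // (lt_le_trans _ q1).
have cA0 : (0 < #|A|)%N by rewrite -(ltr0n R).
have ty := typical_count d2 cA0 (ltW _) _ HG.
have {}ty := ty ltac:(by rewrite invr_gt0 mulr_gt0) ltac:(by rewrite le_eqVlt; apply/orP; left; apply/eqP; field; lra).
have q0 : 0 < q by lra.
have th1 : 1 < kappa ^+ d * (n / (4 * q)).
  rewrite mulrA ltr_pdivlMr ?mulr_gt0 // mul1r -ltr_pdivrMl //.
  apply: lt_le_trans HA; rewrite mulrA ltr_pM2r // [ltLHS]mulrC /C0.
  have : 4 / kappa ^+ d < 8 / kappa ^+ d by rewrite ltr_pM2r ?invr_gt0 // ltr_nat.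
  have : 0 < 2 * D2 / de1 by rewrite divr_gt0 ?mulr_gt0.
  lra.
have th0 : 0 < kappa ^+ d * (n / (4 * q)) by apply: lt_trans th1.
have [g /andP[g2 gd] Hg] := rich_flats k0 k1 (fun G => @pts_line R F d A G) cA0 ty th1 kd.
rewrite -ltnS in gd.
have [I [A' [j [nu [cI rw mass]]]]] := Hde g gd g2 _ _ _ _ _ _ _ th0 (ltW k0) kd cA0 Hg.
have cII : #|I| = #|'I_d.+1| by rewrite card_ord.
have [mu [mu0 muA mu1 muf [mub mum]]] := reindex_weight cII rw.
exists (fun z : {ffun 'I_d.+1 -> 'rV[F]_d} => if injectiveb z then mu z else 0); split.
- by move=> z; case: ifP.
- split; first by move=> z; case: ifP => [_|]; [apply: muA|rewrite eqxx].
  move=> i z; apply: le_trans (mu1 i z); apply: ler_sum => t _; by case: ifP.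
- by move=> z; case: ifP => [/injectiveP iz /muf|]; [split|rewrite eqxx].
- have E : (kappa ^+ d * (n / (4 * q)))^-1 = 4 / kappa ^+ d * q / n by field; rewrite !gt_eqF.
  by move=> z; rewrite -E; case: ifP => _ //; rewrite invr_ge0 ltW.
(* A union bound over the pairs of coordinates that may coincide. *)
have loss : \sum_(z : {ffun 'I_d.+1 -> 'rV[F]_d} | ~~ injectiveb z) mu z <= D2 * n ^+ d.-1.
  apply: (@le_trans _ _ (\sum_(p : 'I_d.+1 * 'I_d.+1 | p.1 != p.2) \sum_(z : {ffun 'I_d.+1 -> 'rV[F]_d} | z p.1 == z p.2) mu z)).
    rewrite (exchange_big_dep predT) //= big_mkcond; apply: ler_sum => z _.
    case: ifPn => [/injectivePn[a [b ab E]]|_]; last by apply: sumr_ge0.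
    by rewrite (bigD1 (a, b)) /= ?ab ?E ?eqxx // lerDl sumr_ge0.
  apply: (@le_trans _ _ (\sum_(p : 'I_d.+1 * 'I_d.+1 | p.1 != p.2) n ^+ d.-1)).
    apply: ler_sum => p ne; have := collision_mass _ ne mu0 muA mu1.
    by rewrite card_ord subSS subn1; apply.
  rewrite sumr_const -[leLHS]mulr_natl ler_wpM2r ?exprn_ge0 ?(ltW n0) // ler_nat.
  by apply: leq_trans (max_card _) _; rewrite card_prod card_ord.
rewrite -big_mkcond /=; rewrite -mum (bigID (fun z : {ffun 'I_d.+1 -> 'rV[F]_d} => injectiveb z)) /= -/n in mass.
have : D2 * n ^+ d.-1 <= de1 / 2 * n ^+ d.
  have -> : n ^+ d = n * n ^+ d.-1 by rewrite -exprS prednK // ltnW.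
  rewrite mulrA ler_wpM2r ?exprn_ge0 ?(ltW n0) //.
  have : C0 <= n by apply: le_trans HA; rewrite ler_peMr // ltW.
  rewrite /C0 => H; have H2 : 2 * D2 / de1 <= n.
    by apply: le_trans H; rewrite lerDr ltW // divr_gt0.
  by move: H2; rewrite ler_pdivrMr //; lra.
lra.
Qed.

(** * General position *)

Lemma enumerate_superset (T : finType) (x0 : T) (A P : {set T}) m : A \subset P ->
  (#|A| <= m <= #|P|)%N -> exists z : {ffun 'I_m -> T},
    [/\ injective z, forall i, z i \in P & forall x, x \in A -> exists i, z i = x].
Proof.
move=> AP /andP[Am mP]; pose s := enum A ++ enum (P :\: A).
have ss : size s = #|P|.
  by rewrite size_cat -!cardE cardsD (setIidPr AP) subnKC // subset_leq_card.
have us : uniq s.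
  rewrite cat_uniq !enum_uniq andbT /=; apply/hasPn => x.
  by rewrite !mem_enum inE => /andP[].
have sm i : (i < m)%N -> (i < size s)%N by move=> im; rewrite ss (leq_trans im).
exists [ffun i : 'I_m => nth x0 s i]; split.
- move=> i j; rewrite !ffunE => /eqP; rewrite nth_uniq ?sm //.
  by move/eqP/val_inj.
- move=> i; rewrite ffunE; have : nth x0 s i \in s by rewrite mem_nth // sm.
  by rewrite mem_cat !mem_enum inE => /orP[/(subsetP AP)|/andP[]].
move=> x xA; have xs : (index x s < m)%N.
  by rewrite index_cat mem_enum xA (leq_trans _ Am) // cardE index_mem mem_enum.
exists (Ordinal xs); rewrite ffunE /= nth_index // mem_cat mem_enum xA //.
Qed.

Section GeneralPosition.
Variables (F : finFieldType) (d : nat).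
Hypothesis d2 : (2 <= d)%N.
Local Notation T := 'rV[F]_d.
Local Notation pnt := (@pnt F d).

(** Let k be the rank of the differences z i - z 0. A nontrivial relation forces k < d and
    distinctness forces k >= 1, so a k-flat contains all d + 1 >= k + 2 points. *)
Lemma gp_independent (P : {set T}) (z : {ffun 'I_d.+1 -> T}) (c : 'I_d.+1 -> F) :
  general_position P -> injective z -> (forall i, z i \in P) ->
  \sum_i c i *: pnt (z i) = 0 -> forall i, c i = 0.
Proof.
move=> gP zi zP /pnt_relation[c0 cz0].
pose U : 'M[F]_d := \matrix_(i, j) (z (lift ord0 i) - z ord0) 0 j.
have rU i : row i U = z (lift ord0 i) - z ord0 by apply/rowP => j; rewrite !mxE.
have cU : (\row_i c (lift ord0 i)) *m U = 0.
  rewrite mulmx_sum_row (eq_bigr (fun i => c (lift ord0 i) *: z (lift ord0 i) - c (lift ord0 i) *: z ord0)); last first.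
    by move=> i _; rewrite mxE rU scalerBr.
  rewrite sumrB -scaler_suml.
  move: c0 cz0; rewrite !big_ord_recl => /eqP; rewrite addrC addr_eq0 => /eqP -> /eqP.
  by rewrite addrC addr_eq0 => /eqP ->; rewrite scaleNr opprK addNr.
have [cc|ne] := eqVneq (\row_i c (lift ord0 i)) 0.
  have cl i : c (lift ord0 i) = 0 by have := congr1 (fun M : 'rV[F]_d => M 0 i) cc; rewrite !mxE.
  move=> i; case: (unliftP ord0 i) => [j ->|->]; first exact: cl.
  by move: c0; rewrite big_ord_recl big1 ?addr0.
have rk : (\rank U < d)%N.
  rewrite ltn_neqAle rank_leq_col andbT; apply: contraNneq ne => rk.
  have fU : row_free U by rewrite /row_free rk.
  by apply/eqP/(row_free_inj fU); rewrite cU mul0mx.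
have rk0 : (0 < \rank U)%N.
  rewrite lt0n mxrank_eq0; apply/eqP => U0.
  have d0 : (0 < d)%N by apply: ltnW.
  have := rU (Ordinal d0); rewrite U0 row0 => /esym/eqP; rewrite subr_eq0 => /eqP/zi/eqP.
  by rewrite eq_sym (negPf (neq_lift _ _)).
pose B := [set x : T | (x - z ord0 <= U)%MS]%SET.
have zB i : z i \in B.
  rewrite inE; case: (unliftP ord0 i) => [j ->|->]; last by rewrite subrr sub0mx.
  by rewrite -rU row_sub.
have /forallP/(_ (Ordinal rk))/implyP/(_ rk0)/forallP/(_ B)/implyP := gP.
have -> : is_flat (Ordinal rk) B.
  by apply/existsP; exists (z ord0); apply/existsP; exists U; rewrite !eqxx.
move=> /(_ isT)/negP[]; have le : ((\rank U).+2 <= d.+1)%N by [].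
apply/existsP; exists [set z (widen_ord le i) | i : 'I_(\rank U).+2]; apply/and3P; split.
- by apply/subsetP => _ /imsetP[i _ ->].
- by apply/subsetP => _ /imsetP[i _ ->].
rewrite card_imset ?card_ord // => i j /zi E; apply: val_inj.
exact: (congr1 val E).
Qed.

Lemma independent_spanning (z : {ffun 'I_d.+1 -> T}) :
  (forall c : 'I_d.+1 -> F, \sum_i c i *: pnt (z i) = 0 -> forall i, c i = 0) ->
  (d < \dim (sp pnt setT z))%N.
Proof.
move=> H; rewrite ltnNge; apply/negP => le.
have [|i /memv_spP[c E]] := @dependent_coord _ _ _ pnt _ z; first by rewrite card_ord.
have E2 : \sum_(j | j != i) (if j == i then -1 else c j) *: pnt (z j) = pnt (z i).
  by rewrite E; apply: eq_big => [j|j ji]; rewrite ?inE ?(negPf ji).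
have := H (fun j => if j == i then -1 else c j).
rewrite (bigD1 i) //= eqxx E2 scaleN1r addNr => /(_ erefl i)/eqP.
by rewrite eqxx oppr_eq0 oner_eq0.
Qed.

Lemma gp_spanning (P : {set T}) (z : {ffun 'I_d.+1 -> T}) :
  general_position P -> injective z -> (forall i, z i \in P) -> (d < \dim (sp pnt setT z))%N.
Proof.
by move=> gP zi zP; apply: independent_spanning => c; apply: gp_independent gP zi zP.
Qed.

Lemma gp_flat (P : {set T}) (G : {vspace 'rV[F]_(1 + d)}) :
  general_position P -> (\dim G <= d)%N -> (#|pts pnt P G| <= d)%N.
Proof.
move=> gP dG; rewrite leqNgt; apply/negP => lt.
have [|z [zi zP _]] := @enumerate_superset _ 0 set0 (pts pnt P G) d.+1 (sub0set _); first by rewrite cards0.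
have zP' i : z i \in P by have := zP i; rewrite inE => /andP[].
have := gp_spanning gP zi zP'; rewrite ltnNge (leq_trans _ dG) // dimvS //.
by apply: sp_sub => i _; have := zP i; rewrite inE => /andP[].
Qed.

(** Complete k + 2 points of a k-flat to d + 1 points of [P], which is large enough: their span has
    dimension at most (k + 1) + (d + 1 - (k + 2)) = d. *)
Lemma spanning_gp (P : {set T}) : (d < #|P|)%N ->
  (forall z : {ffun 'I_d.+1 -> T}, injective z -> (forall i, z i \in P) -> (d < \dim (sp pnt setT z))%N) ->
  general_position P.
Proof.
move=> cP H; apply/forallP => k; apply/implyP => k0; apply/forallP => A; apply/implyP.
case/existsP => a /existsP[U /andP[/eqP rU /eqP ->]]; apply/negP => /existsP[S /and3P[SP SA /eqP cS]].
have [|z [zi zP zS]] := @enumerate_superset _ 0 S P d.+1 SP.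
  by rewrite cS cP andbT ltnS ltn_ord.
pose W := [set i | z i \in S].
have cW : #|W| = k.+2.
  rewrite -cS -(card_imset (mem W) zi); apply: eq_card => x; apply/imsetP/idP.
    by case=> i; rewrite inE => zS' ->.
  by move=> xS; have [i zx] := zS x xS; exists i; rewrite // inE zx.
(* The homogenized flat, generated by (1, a) and the vectors (0, u) for u in a basis of the
   direction. *)
pose G : {vspace 'rV[F]_(1 + d)} := (<[pnt a]> + <<[seq row_mx 0 (row i (row_base U)) | i <- enum 'I_(\rank U)]>>)%VS.
have dG : (\dim G <= k.+1)%N.
  apply: leq_trans (dimv_add_leqif _ _) _; rewrite -[k.+1]add1n leq_add //.
    by rewrite dim_vline; case: (_ == _).
  by apply: leq_trans (dim_span _) _; rewrite size_map -cardE card_ord rU.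
have GW i : i \in W -> pnt (z i) \in G.
  rewrite inE => /(subsetP SA); rewrite inE -(eq_row_base U) => /submxP[w E].
  have -> : pnt (z i) = pnt a + \sum_k0 w 0 k0 *: row_mx 0 (row k0 (row_base U)).
    have -> : z i = a + w *m row_base U by rewrite -E addrC subrK.
    rewrite mulmx_sum_row /pnt -[RHS]hsubmxK; congr row_mx.
      rewrite !linearD !linear_sum /= row_mxKl big1 ?addr0 // => l _.
      by rewrite linearZ /= row_mxKl scaler0.
    rewrite !linearD !linear_sum /= row_mxKr; congr (_ + _); apply: eq_bigr => l _.
    by rewrite linearZ /= row_mxKr.
  rewrite memv_add ?memv_line // memv_suml // => l _; rewrite memvZ // memv_span //.
  by apply/mapP; exists l; rewrite ?mem_enum.
have := H z zi zP; rewrite ltnNge => /negP[].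
have sub : (sp pnt setT z <= G + sp pnt (~: W) z)%VS.
  apply: sp_sub => i _; have [iW|iW] := boolP (i \in W).
    by apply: subvP (GW i iW); apply: addvSl.
  by apply: (subvP (addvSr _ _)); apply: mem_sp; rewrite inE.
apply: leq_trans (dimvS sub) _; apply: leq_trans (dimv_add_leqif _ _) _.
apply: leq_trans (leq_add dG (dim_sp _ _ _)) _.
by rewrite -ltnS -addSn -cW cardsC card_ord.
Qed.

End GeneralPosition.

(** * Containers for sets in general position *)

(** For the case of a rich hyperplane [B]: the container is the rest of [A] together with the at
    most [d] points kept in [B], listed explicitly. *)
Lemma small_trace_family (T : finType) (A B : {set T}) (d : nat) :
  exists CC : {set {set T}}, [/\ (#|CC| <= #|T|.+1 ^ d)%N,
    forall X, X \in CC -> (#|X| <= #|A :\: B| + d)%N &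
    forall I : {set T}, I \subset A -> (#|I :&: B| <= d)%N -> exists2 X, X \in CC & I \subset X].
Proof.
pose J (f : {ffun 'I_d -> option T}) := [set x | [exists i, f i == Some x]].
exists [set (A :\: B) :|: J f | f in {: {ffun 'I_d -> option T}}]; split.
- by apply: leq_trans (leq_imset_card _ _) _; rewrite card_ffun card_option card_ord.
- move=> _ /imsetP[f _ ->]; rewrite cardsU (leq_trans (leq_subr _ _)) // leq_add2l.
  have sub : [set Some x | x in J f] \subset codom f.
    by apply/subsetP => _ /imsetP[x + ->]; rewrite inE => /existsP[i /eqP <-]; apply: codom_f.
  have Si : injective (@Some T) by move=> x y [].
  rewrite -(card_imset _ Si); apply: leq_trans (subset_leq_card sub) _.
  by apply: leq_trans (card_size _) _; rewrite size_codom card_ord.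
move=> I IA cI; pose f : {ffun 'I_d -> option T} := [ffun i : 'I_d => onth (enum (I :&: B)) i].
exists ((A :\: B) :|: J f); first exact: imset_f.
apply/subsetP => x xI; rewrite !inE (subsetP IA) //.
case: (boolP (x \in B)) => //= xB; apply/existsP.
have xe : x \in enum (I :&: B) by rewrite mem_enum inE xI.
have xs : (index x (enum (I :&: B)) < d)%N by apply: leq_trans cI; rewrite cardE index_mem.
by exists (Ordinal xs); rewrite ffunE /= onthE (nth_map x) ?index_mem // nth_index.
Qed.

Lemma container_step (R : realFieldType) (d : nat) : (2 <= d)%N ->
  exists C0 c B : R, [/\ 0 < C0, 0 < c, 0 < B & forall (F : finFieldType) (A : {set 'rV[F]_d}) (t : R) (L : nat),
    1 <= t -> #|F|%:R <= t ^+ d -> B * t <= L%:R -> C0 * #|F|%:R <= #|A|%:R ->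
    exists CC : {set {set 'rV[F]_d}}, [/\ (#|CC| <= (#|{: 'rV[F]_d}|.+1 ^ L) ^ d)%N,
      forall X, X \in CC -> #|X|%:R <= (1 - c) * #|A|%:R &
      forall I : {set 'rV[F]_d}, I \subset A -> general_position I -> exists2 X, X \in CC & I \subset X]].
Proof.
move=> d2; have d0 : 0 < d%:R :> R by rewrite ltr0n ltnW.
have [C1 [Bq [de [C10 Bq0 de0 Hmu]]]] := @supersaturation R d d2.
have [c [B [c0 B0 HC]]] := @measure_container R d de de0.
(* With [b * t] in place of [t], the d-th power dominates beta n = Bq q. *)
pose b : R := 1 + Bq; have b1 : 1 <= b by rewrite lerDl ltW.
pose eps : R := (4 * d%:R)^-1; have eps0 : 0 < eps by rewrite invr_gt0 mulr_gt0.
(* The term [2 * d%:R / eps] ensures that the d points kept in a rich hyperplane make up for at most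
   half of the eps n points removed. *)
exists (C1 + 2 * d%:R / eps), (Num.min c (eps / 2)), (1 + B * b); split.
- by rewrite addr_gt0 // divr_gt0 // mulr_gt0.
- by rewrite lt_min c0 divr_gt0.
- by rewrite addr_gt0 // mulr_gt0 //; lra.
move=> F A t L t1 tq BL cA; set n : R := #|A|%:R in cA *; set q : R := #|F|%:R in tq cA *.
have q1 : 1 <= q by rewrite ler1n; apply: ltnW; apply: card_finNzRing_gt1.
have de1 : 0 < 2 * d%:R / eps by rewrite divr_gt0 // mulr_gt0.
have n1 : C1 * q <= n by apply: le_trans cA; rewrite ler_wpM2r ?lerDl ?(ltW de1) //; lra.
have n2 : 2 * d%:R / eps <= n by apply: le_trans cA; have := mulr_gt0 C10 (lt_le_trans ltr01 q1); nra.
have n0 : 0 < n by apply: lt_le_trans n2.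
have L1 : (0 < L)%N.
  rewrite -(ltr0n R); apply: lt_le_trans BL.
  by rewrite mulr_gt0 ?(lt_le_trans ltr01 t1) // addr_gt0 // mulr_gt0 //; lra.
have [HG|[G [dG aG]]] : (forall G : {vspace 'rV[F]_(1 + d)}, (\dim G <= d)%N -> npts (@pnt F d) R A G <= eps * n) \/
    exists G : {vspace 'rV[F]_(1 + d)}, (\dim G <= d)%N /\ eps * n < npts (@pnt F d) R A G.
- have [/existsP[X /andP[dX aX]]|/existsPn none] :=
    boolP [exists X : {set 'rV[F]_d}, (\dim (spT (@pnt F d) X) <= d)%N && (eps * n < npts (@pnt F d) R A (spT (@pnt F d) X))].
    by right; exists (spT (@pnt F d) X).
  left => G dG; have [E le] := pts_spT (@pnt F d) A G.
  have := none (pts (@pnt F d) A G); rewrite (leq_trans (dimvS le)) //= -leNgt.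
  by rewrite /npts E.
- have [mu [mu0 [muA mu1] muf mub mass]] := Hmu F A n1 HG.
  have bt1 : 1 <= b * t by nra.
  have bt : Bq * q / n * n <= (b * t) ^+ d.
    rewrite divfK ?gt_eqF // exprMn; apply: ler_pM => //; try lra.
    by apply: le_trans (_ : b <= _); [rewrite /b; lra|rewrite ler_eXnr // ltnW].
  have BL' : B * (b * t) <= L%:R by apply: le_trans BL; nra.
  have [CC [cC sC covC]] := HC _ A (b * t) _ mu L bt1 mu0 muA mu1 mub bt mass BL'.
  exists CC; split => // [X /sC /le_trans|I IA gI].
    by apply; rewrite ler_wpM2r ?(ltW n0) // lerB // ge_min lexx.
  apply: covC => // z nz; have [fr iz] := muf z nz.
  apply/existsP; rewrite -negb_forall; apply/negP => /forallP zI.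
  have [c' /andP[/forallP c'0 /eqP E]] := existsP fr.
  by have := c'0 ord0; rewrite (gp_independent d2 gI iz zI E) eqxx.
have [CC [cC sC covC]] := small_trace_family A (pts (@pnt F d) A G) d.
exists CC; split => [|X /sC|I IA gI].
- by apply: leq_trans cC _; rewrite leq_exp2r ?(ltnW d2) // -{1}[_.+1]expn1 leq_pexp2l.
- rewrite -(ler_nat R) natrD => /le_trans; apply.
  have sub : pts (@pnt F d) A G \subset A by apply/subsetP => x; rewrite inE => /andP[].
  rewrite cardsD (setIidPr sub) natrB ?subset_leq_card // -/n.
  have e2 : Num.min c (eps / 2) <= eps / 2 by rewrite ge_min lexx orbT.
  have := ler_wpM2r (ltW n0) e2.
  move: n2; rewrite ler_pdivrMr // => n2; move: aG; rewrite /npts => aG; lra.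
apply: covC => //; apply: leq_trans (gp_flat d2 gI dG); apply: subset_leq_card.
by apply/subsetP => x; rewrite !inE => /andP[-> /andP[_ ->]].
Qed.

(** Iterate [container_step] for [r] rounds, keeping unchanged any set that has dropped below
    [C0 * #|F|]. *)
Theorem containers (R : realFieldType) (d : nat) : (2 <= d)%N ->
  exists C0 c B : R, [/\ 0 < C0, 0 < c <= 1, 0 < B & forall (F : finFieldType) (t : R) (L r : nat),
    1 <= t -> #|F|%:R <= t ^+ d -> B * t <= L%:R ->
    exists CC : {set {set 'rV[F]_d}}, [/\ (#|CC| <= #|{: 'rV[F]_d}|.+1 ^ (L * d * r))%N,
      forall X, X \in CC -> #|X|%:R <= C0 * #|F|%:R \/ #|X|%:R <= (1 - c) ^+ r * #|{: 'rV[F]_d}|%:R &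
      forall I : {set 'rV[F]_d}, general_position I -> exists2 X, X \in CC & I \subset X]].
Proof.
move=> d2; have [C0 [c [B [C00 c0 B0 H]]]] := @container_step R d d2.
pose c' := Num.min c 1; have c'0 : 0 < c' by rewrite lt_min c0 /=.
have c'1 : c' <= 1 by rewrite ge_min lexx orbT.
exists C0, c', B; split => //; first by rewrite c'0.
move=> F t L r t1 tq BL.
elim: r => [|r [CC [cC sC covC]]].
  exists [set setT]; split; first by rewrite cards1 muln0.
    by move=> X; rewrite inE => /eqP ->; right; rewrite expr0 mul1r cardsT.
  by move=> I _; exists setT; rewrite ?inE ?subsetT.
set N := #|{: 'rV[F]_d}| in cC sC *.
have step (A : {set 'rV[F]_d}) : exists CA : {set {set 'rV[F]_d}}, [/\ (#|CA| <= N.+1 ^ (L * d))%N,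
    forall X, X \in CA -> #|X|%:R <= C0 * #|F|%:R \/ #|X|%:R <= (1 - c') * #|A|%:R :> R &
    forall I : {set 'rV[F]_d}, I \subset A -> general_position I -> exists2 X, X \in CA & I \subset X].
  have [le|le] := lerP (C0 * #|F|%:R) (#|A|%:R : R).
    have [CA [c1 s1 cov1]] := H F A t L t1 tq BL le; exists CA; rewrite expnM; split => // X /s1 le2.
    by right; apply: le_trans le2 _; rewrite ler_wpM2r // lerB // ge_min lexx.
  exists [set A]; split; first by rewrite cards1 expn_gt0.
    by move=> X; rewrite inE => /eqP ->; left; apply: ltW.
  by move=> I IA _; exists A; rewrite ?inE.
have [f fP] := fin_all_exists step.
exists (\bigcup_(A in CC) f A); split.
- apply: leq_trans (_ : \sum_(A in CC) #|f A| <= _)%N.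
    rewrite big_mkcond /=; apply: leq_trans (card_bigcup_leq _) _; rewrite [leqRHS]big_mkcond /=.
    by apply: leq_sum => A _; case: ifP; rewrite ?cards0.
  apply: leq_trans (_ : \sum_(A in CC) N.+1 ^ (L * d) <= _)%N.
    by apply: leq_sum => A _; have [] := fP A.
  by rewrite sum_nat_const mulnS addnC expnD leq_mul2r cC orbT.
- move=> X /bigcupP[A /sC sA XA]; have [_ /(_ X XA)[le|le] _] := fP A; first by left.
  case: sA => sA; [left|right].
    by apply: le_trans le _; apply: le_trans sA; rewrite ler_piMl // gerBl ltW.
  by apply: le_trans le _; rewrite exprS -mulrA; apply: ler_wpM2l; rewrite ?subr_ge0.
move=> I gI; have [A AC IA] := covC I gI; have [_ _ /(_ I IA gI)[X XA IX]] := fP A.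
by exists X => //; apply/bigcupP; exists A.
Qed.

(** * Deletion and the moment curve *)

Section Alpha.
Variables (F : finFieldType) (d : nat).
Hypothesis d2 : (2 <= d)%N.
Local Notation T := 'rV[F]_d.
Local Notation pnt := (@pnt F d).

Lemma alpha_ge (P S : {set T}) : P \subset S -> general_position P -> (#|P| <= alpha S)%N.
Proof. by move=> PS gP; rewrite /alpha (leq_bigmax_cond (F := fun P : {set T} => #|P|)) // PS. Qed.

Lemma alpha_le_card (S : {set T}) : (alpha S <= #|S|)%N.
Proof. by apply/bigmax_leqP => P /andP[PS _]; apply: subset_leq_card. Qed.

Lemma alpha_subset (S S' : {set T}) : S \subset S' -> (alpha S <= alpha S')%N.
Proof.
by move=> SS'; apply/bigmax_leqP => P /andP[PS gP]; apply: alpha_ge gP; apply: subset_trans SS'.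
Qed.

Lemma alpha_witness (S : {set T}) : exists P : {set T}, [/\ P \subset S, general_position P & #|P| = alpha S].
Proof.
have g0 : (set0 \subset S) && general_position (set0 : {set T}).
  rewrite sub0set; apply/forallP => k; apply/implyP => _; apply/forallP => A; apply/implyP => _.
  by apply/negP => /existsP[B /and3P[]]; rewrite subset0 => /eqP ->; rewrite cards0.
have card_gt : (0 < #|[pred P : {set T} | (P \subset S) && general_position P]|)%N.
  by apply/card_gt0P; exists set0.
have [P] := eq_bigmax_cond (fun P : {set T} => #|P|) card_gt.
by rewrite inE => /andP[PS gP] E; exists P; split; rewrite // -E; apply: eq_bigl.
Qed.

Definition dependent_tuples (S : {set T}) : {set {ffun 'I_d.+1 -> T}} :=
  [set z in tuples 'I_d.+1 S | injectiveb z && (\dim (sp pnt setT z) <= d)%N].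

(** Remove the first point of each dependent tuple; the hypothesis leaves more than [d] points, as
    [spanning_gp] demands. *)
Lemma alpha_deletion (S : {set T}) : (d + #|dependent_tuples S| < #|S|)%N ->
  (#|S| - #|dependent_tuples S| <= alpha S)%N.
Proof.
move=> lt; set Z := dependent_tuples S in lt *.
pose B := [set z ord0 | z : {ffun 'I_d.+1 -> T} in Z]; pose P := S :\: B.
have cP : (#|S| - #|Z| <= #|P|)%N.
  by rewrite cardsD leq_sub2l // (leq_trans (subset_leq_card (subsetIr _ _))) // leq_imset_card.
apply: (leq_trans cP); apply: alpha_ge (subsetDl _ _) _.
apply: spanning_gp => [|z zi zP]; first by rewrite (leq_trans _ cP) // ltn_subRL addnC.
rewrite ltnNge; apply/negP => dz; have := zP ord0; rewrite inE => /andP[/negP nB _]; apply: nB.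
apply/imsetP; exists z => //; rewrite inE dz andbT; apply/andP; split; last exact/injectiveP.
by rewrite inE; apply/forallP => i; have := zP i; rewrite inE => /andP[].
Qed.

Lemma card_memv (G : {vspace 'rV[F]_(1 + d)}) : (#|[set v : 'rV[F]_(1 + d) | v \in G]| <= #|F| ^ \dim G)%N.
Proof.
pose f (v : 'rV[F]_(1 + d)) := [ffun i => coord (vbasis G) i v].
rewrite -(card_in_imset (f := f)); last first.
  move=> v w; rewrite !inE => vG wG /ffunP E.
  rewrite (coord_vbasis vG) (coord_vbasis wG); apply: eq_bigr => i _.
  by have := E i; rewrite !ffunE => ->.
by apply: leq_trans (max_card _) _; rewrite card_ffun card_ord.
Qed.

(** The q - 1 nonzero multiples of the vectors (1, x) in [G] are distinct, [G] has at most q^d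
    vectors, and q <= 2 (q - 1). *)
Lemma card_pts_proper (G : {vspace 'rV[F]_(1 + d)}) : (\dim G <= d)%N ->
  (#|pts pnt setT G| <= 2 * #|F| ^ d.-1)%N.
Proof.
move=> dG; have q2 : (1 < #|F|)%N := card_finNzRing_gt1 F.
pose f (u : F * T) := u.1 *: pnt u.2.
have le : (#|setX [set~ (0 : F)%R] (pts pnt setT G)| <= #|F| ^ d)%N.
  rewrite -(card_in_imset (f := f)); last first.
    move=> [c x] [c' x']; rewrite !inE /= => /andP[c0 _] _ E.
    have cc : c = c'.
      have := congr1 lsubmx E; rewrite /f /= !linearZ /= !row_mxKl => /matrixP /(_ ord0 ord0).
      by rewrite !mxE !mulr1.
    rewrite cc; congr pair; have := congr1 rsubmx E; rewrite /f /= cc !linearZ /= !row_mxKr.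
    by apply: scalerI; rewrite -cc.
  apply: leq_trans (subset_leq_card _) (leq_trans (card_memv G) _); last by rewrite leq_exp2l.
  apply/subsetP => _ /imsetP[[c x] + ->]; rewrite !inE /= => /andP[_ xG].
  exact: memvZ.
rewrite cardsX cardsC1 in le.
have q1 : (0 < #|F|.-1)%N by rewrite -ltnS prednK // ltnW.
rewrite -(leq_pmul2l q1); apply: leq_trans le _.
have -> : (#|F| ^ d = #|F| * #|F| ^ d.-1)%N by rewrite -expnS prednK // ltnW.
rewrite mulnA leq_mul2r; apply/orP; right.
by case: #|F| q2 q1 => [|[|q]] //= _ _; rewrite muln2 -addnn addSn ltnS leq_addl.
Qed.

Lemma card_dependent_tuples :
  (#|dependent_tuples setT| <= d.+1 * (2 * (#|{: T}| ^ d * #|F| ^ d.-1)))%N.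
Proof.
have N0 : (0 < #|{: T}|)%N by apply/card_gt0P; exists 0.
have HG (G : {vspace 'rV[F]_(1 + d)}) : (\dim G < #|'I_d.+1|)%N ->
    #|pts pnt setT G|%:R <= (2 * #|F| ^ d.-1)%:R :> rat.
  by rewrite card_ord ltnS ler_nat => /card_pts_proper.
have := dependent_count (ler0n _ _) HG.
rewrite cardsT -natrX -!natrM ler_nat card_ord expnS -!mulnA => le.
have {}le : (#|{: T}| * #|[set D in tuples 'I_d.+1 [set: T] | (\dim (sp pnt setT D) < d.+1)%N]| <=
   #|{: T}| * (d.+1 * (2 * (#|{: T}| ^ d * #|F| ^ d.-1))))%N.
  apply: leq_trans le _; rewrite leq_eqVlt; apply/orP; left; apply/eqP; ring.
rewrite leq_pmul2l // in le; apply: leq_trans le; apply: subset_leq_card; apply/subsetP => z.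
by rewrite inE => /andP[zA /andP[_ dz]]; rewrite inE zA.
Qed.

Definition moment_point (s : F) : T := \row_j s ^+ j.+1.

Lemma moment_point_inj : injective moment_point.
Proof.
move=> s s' /rowP /(_ (Ordinal (ltnW d2))); by rewrite !mxE /= !expr1.
Qed.

Definition moment_curve : {set T} := [set moment_point s | s in F].

Lemma card_moment_curve : #|moment_curve| = #|F|.
Proof. by rewrite card_imset //; apply: moment_point_inj. Qed.

(** A Vandermonde argument: a relation between points of the curve annihilates all polynomials of
    degree at most d, in particular the one vanishing at all parameters but one. *)
Lemma moment_curve_gp (P : {set T}) : P \subset moment_curve -> (d < #|P|)%N -> general_position P.
Proof.
move=> PM cP; apply: spanning_gp => // z zi zP; apply: independent_spanning => // c.
have zM i : exists s, z i = moment_point s.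
  by have /imsetP[s _ ->] := subsetP PM _ (zP i); exists s.
have [s zE] := fin_all_exists zM.
have si : injective s by move=> i j E; apply: zi; rewrite !zE E.
move=> /pnt_relation[c0 cz].
have pow (j : 'I_d.+1) : \sum_i c i * s i ^+ j = 0.
  case: (unliftP ord0 j) => [k ->|->]; last first.
    by rewrite -[RHS]c0; apply: eq_bigr => i _; rewrite expr0 mulr1.
  have := congr1 (fun M : 'rV[F]_d => M 0 k) cz; rewrite summxE mxE => E; rewrite -[RHS]E.
  by apply: eq_bigr => i _; rewrite zE !mxE.
have ev (f : {poly F}) : (size f <= d.+1)%N -> \sum_i c i * f.[s i] = 0.
  move=> sf; under eq_bigr do rewrite (horner_coef_wide _ sf) mulr_sumr.
  rewrite exchange_big big1 // => j _.
  rewrite (eq_bigr (fun i => f`_j * (c i * s i ^+ j))); last by move=> i _; rewrite mulrCA.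
  by rewrite -mulr_sumr pow mulr0.
move=> k; pose f := \prod_(l | l != k) ('X - (s l)%:P).
have sf : (size f <= d.+1)%N.
  by rewrite /f -big_enum size_prod_XsubC -cardE cardC1 card_ord.
have := ev f sf; rewrite (bigD1 k) //= big1 ?addr0; last first.
  move=> i ik; apply/eqP; rewrite mulf_eq0; apply/orP; right.
  by rewrite /f horner_prod (bigD1 i) //= hornerXsubC subrr mul0r.
move/eqP; rewrite mulf_eq0 => /orP[/eqP //|]; rewrite /f horner_prod prodf_seq_eq0 => /hasP[l _ /andP[lk]].
by rewrite hornerXsubC subr_eq0 (inj_eq si) eq_sym (negPf lk).
Qed.

End Alpha.

(** * Random subsets *)

From mathcomp Require Import reals.
From mathcomp.analysis Require Import sequences exp.

Section RandomSubset.
Variables (R : realType) (T : finType) (p : R).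
Hypothesis p01 : 0 <= p <= 1.
Local Notation P := (random_subset_prob p).

Definition subset_weight (S : {set T}) : R := \prod_(x : T) (if x \in S then p else 1 - p).
Local Notation w := subset_weight.

Lemma subset_weight_ge0 S : 0 <= w S.
Proof. by apply: prodr_ge0 => x _; have := p01; case: (x \in S); lra. Qed.

Lemma sum_set_prod (f g : T -> R) :
  \sum_(S : {set T}) \prod_x (if x \in S then f x else g x) = \prod_x (f x + g x).
Proof. by rewrite bigA_distr. Qed.

Lemma subset_weight_sum : \sum_S w S = 1.
Proof. by rewrite /w (sum_set_prod (fun=> p) (fun=> 1 - p)) big1 // => x _; rewrite addrC subrK. Qed.

Lemma prob_ge0 (E : pred {set T}) : 0 <= P E.
Proof. by apply: sumr_ge0 => S _; apply: subset_weight_ge0. Qed.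

Lemma prob_compl (E : pred {set T}) : P E = 1 - P (predC E).
Proof.
rewrite -subset_weight_sum [in RHS](bigID E) /= addrK; exact: eq_bigr.
Qed.

Lemma prob_le1 (E : pred {set T}) : P E <= 1.
Proof. by have := prob_ge0 (predC E); rewrite (prob_compl E); lra. Qed.

Lemma prob_mono (E E' : pred {set T}) : subpred E E' -> P E <= P E'.
Proof.
move=> EE'; rewrite /random_subset_prob [leLHS]big_mkcond [leRHS]big_mkcond; apply: ler_sum => S _.
case: ifP => [/EE' ->//|_]; case: ifP => _ //; exact: subset_weight_ge0.
Qed.

Lemma prob_union (I : finType) (D : pred I) (E : pred {set T}) (E' : I -> pred {set T}) :
  (forall S, E S -> exists2 i, D i & E' i S) -> P E <= \sum_(i | D i) P (E' i).
Proof.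
move=> H; rewrite /random_subset_prob (exchange_big_dep predT) //= big_mkcond; apply: ler_sum => S _.
case: ifP => [/H[i Di Ei]|_]; last by apply: sumr_ge0 => i _; apply: subset_weight_ge0.
rewrite (bigD1 i) /= ?Di // lerDl; apply: sumr_ge0 => j _; exact: subset_weight_ge0.
Qed.

Lemma prob_markov (E : pred {set T}) (g : {set T} -> R) :
  (forall S, 0 <= g S) -> (forall S, E S -> 1 <= g S) -> P E <= \sum_S w S * g S.
Proof.
move=> g0 g1; rewrite /random_subset_prob big_mkcond; apply: ler_sum => S _.
case: ifP => [/g1 g1S|_]; last by rewrite mulr_ge0 ?subset_weight_ge0.
by rewrite -[leLHS]mulr1 ler_wpM2l ?subset_weight_ge0.
Qed.

Lemma exp_moment (B : {set T}) (l : R) :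
  \sum_S w S * expR (l * #|S :&: B|%:R) = (1 + p * (expR l - 1)) ^+ #|B|.
Proof.
have -> : (1 + p * (expR l - 1)) ^+ #|B| = \prod_x (p * (if x \in B then expR l else 1) + (1 - p)).
  rewrite -prodr_const big_mkcond; apply: eq_bigr => x _; case: ifP => _; lra.
rewrite -sum_set_prod; apply: eq_bigr => S _.
have -> : expR (l * #|S :&: B|%:R) = \prod_x (if x \in S then if x \in B then expR l else 1 else 1).
  rewrite mulrC expRM_natl -prodr_const big_mkcond; apply: eq_bigr => x _; rewrite inE.
  by case: (x \in S); case: (x \in B).
rewrite -big_split; apply: eq_bigr => x _ /=; case: ifP => _ //; exact: mulr1.
Qed.

Lemma exp_moment_le (B : {set T}) (l a : R) : expR l - 1 <= a ->
  \sum_S w S * expR (l * #|S :&: B|%:R) <= expR (p * a * #|B|%:R).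
Proof.
move=> la; have [p0 p1] := andP p01; have l0 := expR_ge0 l.
rewrite exp_moment (mulrC (p * a)) expRM_natl; apply: lerXn2r; rewrite ?nnegrE ?expR_ge0 //; first by nra.
apply: le_trans (expR_ge1Dx _); rewrite lerD2l; exact: ler_wpM2l.
Qed.

(** Chernoff's method with exponent 1/2, using e^(1/2) - 1 <= 1. *)
Lemma prob_upper_tail (B : {set T}) (x : R) (E : pred {set T}) :
  (forall S, E S -> x <= #|S :&: B|%:R) -> P E <= expR (p * #|B|%:R - x / 2).
Proof.
move=> H; apply: (@le_trans _ _ (\sum_S w S * expR (2^-1 * #|S :&: B|%:R - x / 2))).
  apply: prob_markov => S; first exact: expR_ge0.
  by move=> /H le; rewrite -[leLHS](expR0 R) ler_expR; lra.
under eq_bigr do rewrite expRD mulrA; rewrite -mulr_suml expRD ler_wpM2r ?expR_ge0 //.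
rewrite -[X in expR (X * _)](mulr1 p); apply: exp_moment_le.
have := expR_ge1Dx (- 2^-1 : R); have := expRxMexpNx_1 (2^-1 : R).
have := expR_gt0 (2^-1 : R); nra.
Qed.

(** Chernoff's method with exponent -1, using 1/e <= 1/2. *)
Lemma prob_lower_tail (B : {set T}) (x : R) (E : pred {set T}) :
  (forall S, E S -> #|S :&: B|%:R <= x) -> P E <= expR (x - p * #|B|%:R / 2).
Proof.
move=> H; apply: (@le_trans _ _ (\sum_S w S * expR (- 1 * #|S :&: B|%:R + x))).
  apply: prob_markov => S; first exact: expR_ge0.
  by move=> /H le; rewrite -[leLHS](expR0 R) ler_expR; lra.
under eq_bigr do rewrite expRD mulrA; rewrite -mulr_suml expRD [leRHS]mulrC ler_wpM2r ?expR_ge0 //.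
have -> : - (p * #|B|%:R / 2) = p * (- 2^-1) * #|B|%:R by ring.
apply: exp_moment_le.
have := expR_ge1Dx (1 : R); have := expRxMexpNx_1 (1 : R).
have := expR_gt0 (- 1 : R); nra.
Qed.

Lemma prob_contains (J : {set T}) : \sum_(S : {set T} | J \subset S) w S = p ^+ #|J|.
Proof.
rewrite -prodr_const [RHS]big_mkcond /=.
have -> : \prod_x (if x \in J then p else 1) = \prod_x (p + (if x \in J then 0 else 1 - p)).
  by apply: eq_bigr => x _; case: ifP => _; lra.
rewrite -sum_set_prod big_mkcond; apply: eq_bigr => S _.
case: ifPn => [JS|/subsetPn[x xJ xS]].
  apply: eq_bigr => x _; case: ifPn => // xS; case: ifPn => // xJ.
  by rewrite (subsetP JS) in xS.
by rewrite (bigD1 x) //= (negPf xS) xJ mul0r.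
Qed.

End RandomSubset.

(* A p-random set is a p/p'-random subset of a p'-random set; h is their joint law. *)
Lemma prob_increasing (R : realType) (T : finType) (p p' : R) (E : pred {set T}) :
  0 <= p <= p' -> p' <= 1 -> (forall S S' : {set T}, S \subset S' -> E S -> E S') ->
  random_subset_prob p E <= random_subset_prob p' E.
Proof.
move=> /andP[p0 pp'] p1 up.
pose h (S S' : {set T}) : R := \prod_x (if x \in S' then if x \in S then p else p' - p
                                     else if x \in S then 0 else 1 - p').
have h0 S S' : 0 <= h S S' by apply: prodr_ge0 => x _; case: (x \in S'); case: (x \in S); lra.
have hS S : \sum_S' h S S' = subset_weight p S.
  rewrite sum_set_prod; apply: eq_bigr => x _; case: (x \in S); lra.
have hS' S' : \sum_S h S S' = subset_weight p' S'.
  transitivity (\sum_(S : {set T}) \prod_(x : T) (if x \in S then if x \in S' then p else 0 else if x \in S' then p' - p else 1 - p')).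
    by apply: eq_bigr => S _; apply: eq_bigr => x _; case: (x \in S); case: (x \in S').
  by rewrite sum_set_prod; apply: eq_bigr => x _; case: (x \in S'); lra.
rewrite /random_subset_prob -/(subset_weight _).
apply: (@le_trans _ _ (\sum_(S | E S) \sum_S' h S S')); first by under [leRHS]eq_bigr do rewrite hS.
apply: (@le_trans _ _ (\sum_(S' | E S') \sum_S h S S')); last by under [leLHS]eq_bigr do rewrite hS'.
rewrite exchange_big /= [leRHS]big_mkcond; apply: ler_sum => S' _.
case: ifPn => [_|nE]; first by rewrite [leRHS](bigID E) /= lerDl sumr_ge0.
rewrite big1 // => S ES; have /subsetPn[x xS xS'] : ~~ (S \subset S') by apply: contra nE => /up; apply.
by rewrite /h (bigD1 x) //= (negPf xS') xS mul0r.
Qed.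

(** * Tail bounds for alpha *)

Section Bounds.
Variables (R : realType) (F : finFieldType) (d : nat) (p : R).
Hypothesis d2 : (2 <= d)%N.
Hypothesis p01 : 0 <= p <= 1.
Local Notation T := 'rV[F]_d.
Local Notation P := (random_subset_prob p).
Local Notation q := (#|F|%:R : R).

Let p0 : 0 <= p. Proof. by case/andP: p01. Qed.

Lemma card_space : #|{: T}|%:R = q ^+ d :> R.
Proof. by rewrite card_mx mul1n natrX. Qed.

Lemma q_ge2 : 2 <= q.
Proof. by rewrite ler_nat card_finNzRing_gt1. Qed.

Lemma prob_between (X : {set T} -> R) (a b : R) :
  1 - P (fun S => X S < a) - P (fun S => b < X S) <= P (fun S => a <= X S <= b).
Proof.
rewrite (prob_compl p (fun S => a <= X S <= b)) -addrA lerD2l -opprD lerN2.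
rewrite /random_subset_prob big_mkcond [X in _ <= X + _]big_mkcond [X in _ <= _ + X]big_mkcond -big_split /=.
apply: ler_sum => S _; have := subset_weight_ge0 p01 S; rewrite /subset_weight => w0.
by case: (ltP (X S) a); case: (ltP b (X S)) => //= _ _; lra.
Qed.

Lemma prob_alpha_gt_card (c : R) : 4 <= c ->
  P (fun S : {set T} => c * (p * q ^+ d) < (alpha S)%:R) <= expR (- (p * q ^+ d)).
Proof.
move=> c4; apply: le_trans (prob_upper_tail p01 (B := setT) (x := c * (p * q ^+ d)) _) _.
  move=> S; rewrite setIT => /ltW le; apply: (le_trans le).
  by rewrite ler_nat alpha_le_card.
rewrite cardsT card_space ler_expR; have pq0 : 0 <= p * q ^+ d by rewrite mulr_ge0 // exprn_ge0.
have := ler_wpM2r pq0 c4; lra.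
Qed.

(** An injective tuple lies in the random set with probability p^(d+1), and at most 2 (d + 1) q^(d^2
    + d - 1) of them are dependent. *)
Lemma mean_dependent_tuples :
  \sum_(S : {set T}) subset_weight p S * #|dependent_tuples S|%:R <=
    2 * d.+1%:R * ((p * q ^+ d) ^+ d.+1 / q).
Proof.
apply: (@le_trans _ _ (\sum_(z in dependent_tuples [set: T]) p ^+ d.+1)).
  apply: (@le_trans _ _ (\sum_(S : {set T}) \sum_(z in dependent_tuples [set: T])
       (if [set z i | i in 'I_d.+1] \subset S then subset_weight p S else 0))).
    apply: ler_sum => S _; rewrite mulr_natr -sumr_const big_mkcond [leRHS]big_mkcond.
    apply: ler_sum => z _; case: ifPn => [|_].
      rewrite !inE => /andP[/forallP zS ->]; rewrite andbT.
      have -> : [forall i, z i \in [set: T]] by apply/forallP => i; rewrite inE.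
      by rewrite ifT //; apply/subsetP => _ /imsetP[i _ ->].
    by case: ifP => // _; case: ifP => // _; apply: subset_weight_ge0.
  rewrite exchange_big; apply: ler_sum => z; rewrite inE => /andP[_ /andP[/injectiveP zi _]].
  by rewrite -big_mkcond (prob_contains p) card_imset // card_ord.
rewrite sumr_const -[leLHS]mulr_natl.
have -> : 2 * d.+1%:R * ((p * q ^+ d) ^+ d.+1 / q) = (d.+1 * (2 * (#|{: T}| ^ d * #|F| ^ d.-1)))%N%:R * p ^+ d.+1.
  have q0 : q != 0 by rewrite gt_eqF // (lt_le_trans _ q_ge2).
  rewrite !natrM !natrX card_space exprMn.
  have -> : (q ^+ d) ^+ d.+1 = (q ^+ d) ^+ d * (q ^+ d.-1 * q).
    by rewrite -exprSr prednK ?(ltnW d2) // -exprSr.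
  by field.
by rewrite ler_wpM2r ?exprn_ge0 // ler_nat card_dependent_tuples.
Qed.

(** With m = p q^d, a small [alpha] forces at most m/4 points (Chernoff) or at least m/8 dependent
    tuples (Markov). The term m^d / q explains why range (a) ends near m = q^(1/d). *)
Lemma prob_alpha_lt_deletion : d.+1%:R <= p * q ^+ d / 8 ->
  P (fun S : {set T} => (alpha S)%:R < 8^-1 * (p * q ^+ d)) <=
    expR (- (p * q ^+ d / 4)) + 16 * d.+1%:R * ((p * q ^+ d) ^+ d / q).
Proof.
set m := p * q ^+ d => m8; have m0 : 0 < m.
  by have : 0 < d.+1%:R :> R by []; lra.
pose E1 (S : {set T}) := #|S :&: setT|%:R <= m / 4.
pose E2 (S : {set T}) := m / 8 <= #|dependent_tuples S|%:R.
have cover S : (alpha S)%:R < 8^-1 * m -> exists2 b : bool, predT b & (if b then E1 S else E2 S).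
  move=> lt; have [e1|e1] := boolP (E1 S); first by exists true.
  have [e2|e2] := boolP (E2 S); first by exists false.
  exfalso; move: e1 e2; rewrite /E1 /E2 setIT -!ltNge => e1 e2.
  have le : (d + #|dependent_tuples S| < #|S|)%N.
    by rewrite -(ltr_nat R) natrD; rewrite -natr1 in m8; lra.
  have := alpha_deletion le; rewrite -(ler_nat R) natrB; last by apply: ltnW; apply: leq_ltn_trans le; apply: leq_addl.
  lra.
apply: le_trans (prob_union p01 (E' := fun b S => if b then E1 S else E2 S) cover) _.
rewrite big_bool /=; apply: lerD.
  apply: le_trans (prob_lower_tail p01 (B := setT) (x := m / 4) _) _; first by [].
  by rewrite cardsT card_space -/m ler_expR; lra.
apply: le_trans (prob_markov p01 (g := fun S => 8 / m * #|dependent_tuples S|%:R) _ _) _.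
- by move=> S; rewrite mulr_ge0 // divr_ge0 // ltW.
- by move=> S; rewrite /E2 => le; rewrite mulrAC ler_pdivlMr //; lra.
rewrite (eq_bigr (fun S => 8 / m * (subset_weight p S * #|dependent_tuples S|%:R))); last by move=> S _; rewrite mulrCA.
rewrite -mulr_sumr; have := mean_dependent_tuples; rewrite -/m => le.
apply: le_trans (ler_wpM2l _ le) _; first by rewrite divr_ge0 // ltW.
have q0 : q != 0 by rewrite gt_eqF // (lt_le_trans _ q_ge2).
rewrite le_eqVlt; apply/orP; left; apply/eqP; rewrite exprS; field.
by rewrite q0 gt_eqF.
Qed.

(** The random part of the moment curve is in general position and has about p q points. *)
Lemma prob_alpha_lt_curve : d.+1%:R <= p * q / 4 ->
  P (fun S : {set T} => (alpha S)%:R < 8^-1 * (p * q)) <= expR (- (p * q / 4)).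
Proof.
move=> m4; apply: le_trans (prob_lower_tail p01 (B := moment_curve F d) (x := p * q / 4) _) _.
  move=> S lt; rewrite leNgt; apply/negP => lt2.
  have cS : (d < #|S :&: moment_curve F d|)%N by rewrite -(ltr_nat R); rewrite -natr1 in m4; lra.
  have := alpha_ge (subsetIl _ _) (moment_curve_gp (subsetIr _ _) cS).
  have : 0 < d.+1%:R :> R by [].
  by rewrite -(ler_nat R); lra.
by rewrite card_moment_curve // ler_expR; lra.
Qed.

Lemma prob_alpha_gt_containers (CC : {set {set T}}) (s x : R) :
  (forall I : {set T}, general_position I -> exists2 X, X \in CC & I \subset X) ->
  (forall X, X \in CC -> #|X|%:R <= s) ->
  P (fun S : {set T} => x < (alpha S)%:R) <= #|CC|%:R * expR (p * s - x / 2).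
Proof.
move=> cov sC.
apply: le_trans (prob_union p01 (D := mem CC) (E' := fun (X S : {set T}) => x <= #|S :&: X|%:R) _) _.
  move=> S lt; have [I [IS gI cI]] := alpha_witness S; have [X XC IX] := cov I gI.
  exists X => //; apply: (le_trans (ltW lt)); rewrite -cI ler_nat subset_leq_card //.
  by rewrite subsetI IS.
rewrite mulr_natl -sumr_const; apply: ler_sum => X XC.
apply: le_trans (prob_upper_tail p01 (B := X) (x := x) _) _; first by [].
by rewrite ler_expR lerD2r ler_wpM2l // sC.
Qed.

End Bounds.

(** * The three ranges *)

Lemma natural_above (R : realType) (x : R) : 0 <= x -> exists2 n : nat, x <= n%:R & n%:R <= x + 1.
Proof.
move=> x0; have /andP[le lt] := truncn_itv x0.
by exists (Num.truncn x).+1; [apply: ltW|rewrite -natr1 lerD2r].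
Qed.

Lemma expR_ge_pow (R : realType) (n : nat) (x : R) : 0 <= x -> (0 < n)%N -> (x / n%:R) ^+ n <= expR x.
Proof.
move=> x0 n0; have nn : n%:R != 0 :> R by rewrite pnatr_eq0 -lt0n.
have -> : expR x = expR (x / n%:R) ^+ n by rewrite -expRM_natr divfK.
apply: lerXn2r; rewrite ?nnegrE ?expR_ge0 ?divr_ge0 //.
by apply: le_trans (expR_ge1Dx _); rewrite lerDr.
Qed.

Lemma expRN_le (R : realType) (x : R) : 0 < x -> expR (- x) <= x^-1.
Proof.
move=> x0; rewrite expRN lef_pV2 ?posrE ?expR_gt0 //.
by apply: le_trans (expR_ge1Dx _); rewrite lerDr.
Qed.

Section LogCard.
Variables (R : realType) (F : finFieldType).
Local Notation q := (#|F|%:R : R).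

Lemma q_gt0 : 0 < q.
Proof. by apply: lt_le_trans (q_ge2 R F). Qed.

Lemma expR_ln_card : expR (ln q) = q.
Proof. by rewrite lnK // posrE q_gt0. Qed.

Lemma ln_card_ge : 2^-1 <= ln q.
Proof.
have := expR_ge1Dx (- ln q); rewrite expRN expR_ln_card.
have : q^-1 <= 2^-1 by rewrite lef_pV2 ?posrE ?q_gt0 // q_ge2.
lra.
Qed.

End LogCard.

(** The hypothesis says that p q dominates the logarithm of the number of containers. *)
Lemma prob_alpha_gt_linear (R : realType) (d : nat) : (2 <= d)%N ->
  exists c2 K1 : R, [/\ 4 <= c2, 0 < K1 & forall (F : finFieldType) (p : R), 0 <= p <= 1 ->
    K1 * expR (ln #|F|%:R / d%:R) * ln #|F|%:R ^+ 2 <= p * #|F|%:R ->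
    random_subset_prob p (fun S : {set 'rV[F]_d} => c2 * (p * #|F|%:R) < (alpha S)%:R) <= expR (- (p * #|F|%:R))].
Proof.
move=> d2; have [C0 [c [B [C00 /andP[c0 c1] B0 H]]]] := @containers R d d2.
have d0 : 0 < d%:R :> R by rewrite ltr0n ltnW.
have dc0 : 0 < d%:R / c by rewrite divr_gt0.
(* Bounds ln(q^d + 1) L d r by K1 t ln^2 q, with factors d + 1 for the logarithm, B + 1 for [L], and
   d/c + 2 for [r]. *)
pose K1 : R := d.+1%:R * ((B + 1) * (d%:R * (d%:R / c + 2))).
(* Half of this constant is (C0 + 1) + 2: the mean in a container cancels, one p q pays for the
   number of containers, and one p q remains. *)
exists (2 * (C0 + 1) + 4), K1; split; first by lra.
  by rewrite !mulr_gt0 ?addr_gt0.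
move=> F p p01 Hp; have p0 : 0 <= p by case/andP: p01.
set y := ln _ in Hp; set q : R := #|F|%:R in y Hp *.
have y2 : 2^-1 <= y by exact: ln_card_ge.
have qy : expR y = q by exact: expR_ln_card.
have q2 : 2 <= q by exact: q_ge2.
set t := expR (y / d%:R) in Hp.
have t1 : 1 <= t by rewrite -[leLHS](expR0 R) ler_expR divr_ge0 ?ltW //; lra.
have td : q <= t ^+ d by rewrite /t -expRM_natr divfK ?gt_eqF // qy.
have [|L BL L1] := @natural_above R (B * t); first by rewrite mulr_ge0 ?ltW //; lra.
(* After r >= d ln q / c rounds, (1 - c)^r q^d <= 1, so the second alternative of [containers] also
   yields small sets. *)
have [|r dr r1] := @natural_above R (d%:R * y / c); first by rewrite divr_ge0 ?mulr_ge0 ?ltW //; lra.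
have [CC [cC sC covC]] := H F t L r t1 td BL.
have small X : X \in CC -> #|X|%:R <= (C0 + 1) * q.
  case/sC => [le|le]; first by apply: le_trans le _; rewrite -/q; lra.
  apply: le_trans le _; apply: (@le_trans _ _ 1); last by have := ler_wpM2l (ltW C00) q2; lra.
  have c'1 : (1 - c) ^+ r <= expR (- (d%:R * y)).
    apply: (@le_trans _ _ (expR (- c) ^+ r)).
      apply: lerXn2r; rewrite ?nnegrE ?expR_ge0 ?subr_ge0 //; exact: expR_ge1Dx.
    by rewrite -expRM_natr ler_expR mulNr lerN2 [leRHS]mulrC -ler_pdivrMr.
  rewrite card_space -/q -qy -expRM_natl; apply: le_trans (ler_wpM2r (expR_ge0 _) c'1) _.
  by rewrite -expRD addNr expR0.
apply: le_trans (prob_alpha_gt_containers p01 _ covC small) _.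
have cCr : #|CC|%:R <= expR (p * q).
  apply: (@le_trans _ _ (expR (y * d.+1%:R * (L * d * r)%:R))).
    apply: (@le_trans _ _ ((#|{: 'rV[F]_d}|.+1)%:R ^+ (L * d * r))); first by rewrite -natrX ler_nat.
    rewrite expRM_natr; apply: lerXn2r; rewrite ?nnegrE ?expR_ge0 //.
    rewrite expRM_natr qy -natr1 card_space exprS.
    have : 1 <= q ^+ d by apply: exprn_ege1; lra.
    have := ler_wpM2r (exprn_ge0 d (le_trans (ler0n R 2) q2)) q2; rewrite -/q; lra.
  rewrite ler_expR; apply: le_trans Hp; rewrite !natrM /K1.
  have le1 : L%:R <= (B + 1) * t by lra.
  have le2 : r%:R <= (d%:R / c + 2) * y by rewrite mulrAC in r1; lra.
  have -> : d.+1%:R * ((B + 1) * (d%:R * (d%:R / c + 2))) * t * y ^+ 2 =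
     y * d.+1%:R * (((B + 1) * t) * d%:R * ((d%:R / c + 2) * y)) by ring.
  rewrite ler_wpM2l //; first by rewrite mulr_ge0 //; lra.
  by apply: ler_pM => //; [rewrite mulr_ge0|rewrite ler_wpM2r].
apply: le_trans (ler_wpM2r (expR_ge0 _) cCr) _.
rewrite -expRD ler_expR; lra.
Qed.

Section Ranges.
Variables (R : realType) (d : nat).
Hypothesis d2 : (2 <= d)%N.
Variables (c2 K1 : R).
Hypothesis c24 : 4 <= c2.
Hypothesis upper : forall (F : finFieldType) (p : R), 0 <= p <= 1 ->
    K1 * expR (ln #|F|%:R / d%:R) * ln #|F|%:R ^+ 2 <= p * #|F|%:R ->
    random_subset_prob p (fun S : {set 'rV[F]_d} => c2 * (p * #|F|%:R) < (alpha S)%:R) <= expR (- (p * #|F|%:R)).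
Variable F : finFieldType.
Local Notation T := 'rV[F]_d.
Local Notation q := (#|F|%:R : R).
Local Notation y := (ln q).
Local Notation t := (expR (y / d%:R)).
Hypothesis y8d : (8 * d.+1%:R : R) <= y.
Hypothesis yK : K1 <= y.
Hypothesis yc : c2 <= y.
Hypothesis y6 : ((6 * d%:R) ^+ 6 : R) <= y.

Let d0 : 0 < d%:R :> R. Proof. by rewrite ltr0n ltnW. Qed.
Let y8 : (8 : R) <= y.
Proof. have := y8d; have : 1 <= d.+1%:R :> R by rewrite ler1n. by lra. Qed.
Let y0 : (0 : R) < y. Proof. by have := y8; lra. Qed.
Let t0 : 0 < t. Proof. exact: expR_gt0. Qed.
Let td : t ^+ d = q.
Proof. by rewrite -expRM_natr divfK ?gt_eqF // expR_ln_card. Qed.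
Let q0 : 0 < q. Proof. exact: q_gt0. Qed.

Let y3 : y <= y ^+ 3.
Proof. by rewrite ler_eXnr //; have := y8; lra. Qed.

Let y30 : 0 < y ^+ 3. Proof. exact: exprn_gt0. Qed.

(** From e^x >= (x/6)^6 at x = y/d; one of the six factors y pays for (6d)^6. *)
Lemma root_card_ge : y ^+ 5 <= t.
Proof.
apply: le_trans (expR_ge_pow (n := 6) _ _); rewrite ?divr_ge0 ?(ltW y0) ?(ltW d0) //.
rewrite -mulrA -invfM expr_div_n ler_pdivlMr ?exprn_gt0 ?mulr_gt0 // [leRHS]exprSr ler_wpM2l ?exprn_ge0 ?(ltW y0) //.
by rewrite [d%:R * _]mulrC.
Qed.

Let err (x : R) : y <= x -> expR (- x) <= y^-1.
Proof.
move=> yx; have Y8 := y8; apply: le_trans (expRN_le _) _; first by lra.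
by rewrite lef_pV2 ?posrE //; lra.
Qed.

Let err4 (x : R) : y <= x -> expR (- (x / 4)) <= 4 / y.
Proof.
move=> yx; have Y8 := y8; apply: le_trans (expRN_le _) _; first by lra.
by rewrite invf_div ler_wpM2l // lef_pV2 ?posrE //; lra.
Qed.

(** Here m^d / q = (m / t)^d <= 1/y. Kept apart from [sparse_range] for reuse in [middle_range]. *)
Lemma sparse_lower (p : R) : 0 <= p <= 1 -> y <= p * q ^+ d -> p * q ^+ d * y ^+ 3 <= t ->
  random_subset_prob p (fun S : {set T} => (alpha S)%:R < 8^-1 * (p * q ^+ d)) <= (16 * d.+1%:R + 4) / y.
Proof.
move=> p01; set m := p * q ^+ d => ym my; have Y8 := y8; have Y8d := y8d; have m0 : 0 < m by lra.
apply: le_trans (prob_alpha_lt_deletion d2 p01 _) _; first by rewrite -/m; lra.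
rewrite -/m [leLHS]addrC [leRHS]mulrDl; apply: lerD; last exact: err4.
apply: ler_wpM2l; first by rewrite mulr_ge0.
have -> : m ^+ d / q = (m / t) ^+ d by rewrite expr_div_n td.
have mt : m / t <= y^-1.
  rewrite ler_pdivrMr // mulrC ler_pdivlMr //; apply: le_trans my; rewrite ler_wpM2l ?(ltW m0) //.
have mt0 : 0 <= m / t by rewrite divr_ge0 // ltW.
apply: (le_trans _ mt); rewrite ler_iXnr ?(ltnW d2) //.
by apply: (le_trans mt); rewrite invf_le1 //; lra.
Qed.

Lemma sparse_range (p : R) : 0 <= p <= 1 -> y ^+ 3 <= p * q ^+ d -> p * q ^+ d * y ^+ 3 <= t ->
  1 - (16 * d.+1%:R + 5) / y <= random_subset_prob p
    (fun S : {set T} => 8^-1 * (p * q ^+ d) <= (alpha S)%:R <= c2 * (p * q ^+ d)).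
Proof.
move=> p01 ym my; have {}ym := le_trans y3 ym; apply: le_trans (prob_between p01 _ _ _).
have l1 := sparse_lower p01 ym my.
have l2 := prob_alpha_gt_card F d p01 c24.
have l3 := err ym.
have -> : (16 * d.+1%:R + 5) / y = (16 * d.+1%:R + 4) / y + y^-1 by field; rewrite gt_eqF.
lra.
Qed.

Lemma dense_upper (p : R) : 0 <= p <= 1 -> t * y ^+ 3 <= p * q ->
  y <= p * q /\ random_subset_prob p (fun S : {set T} => c2 * (p * q) < (alpha S)%:R) <= y^-1.
Proof.
move=> p01 tp; have t1 : 1 <= t.
  by rewrite -[leLHS](expR0 R) ler_expR divr_ge0 // ltW.
have yp : y <= p * q by apply: le_trans tp; apply: le_trans y3 _; rewrite ler_peMl // ltW.
split => //; apply: le_trans (err yp); apply: upper => //; apply: le_trans tp.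
by rewrite mulrAC [leRHS]mulrC ler_wpM2r ?(ltW t0) // [y ^+ 3]exprS ler_wpM2r ?exprn_ge0 ?(ltW y0).
Qed.

Lemma dense_range (p : R) : 0 <= p <= 1 -> t * y ^+ 3 <= p * q ->
  1 - 5 / y <= random_subset_prob p
    (fun S : {set T} => 8^-1 * (p * q) <= (alpha S)%:R <= c2 * (p * q)).
Proof.
move=> p01 tp; have [yp l1] := dense_upper p01 tp; have Y8 := y8; have Y8d := y8d; apply: le_trans (prob_between p01 _ _ _).
have l2 : random_subset_prob p (fun S : {set T} => (alpha S)%:R < 8^-1 * (p * q)) <= 4 / y.
  by apply: le_trans (err4 yp); apply: prob_alpha_lt_curve => //; lra.
have -> : 5 / y = 4 / y + y^-1 by field; rewrite gt_eqF.
lra.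
Qed.

(** Compare [p] with both endpoints by monotonicity. The step from y^3 to y^4 absorbs the constants
    8 and [c2]. *)
Lemma middle_range (p : R) : 0 <= p <= 1 -> t / y ^+ 3 / q ^+ d <= p -> p <= t * y ^+ 3 / q ->
  1 - (16 * d.+1%:R + 5) / y <= random_subset_prob p
    (fun S : {set T} => t / y ^+ 4 <= (alpha S)%:R <= t * y ^+ 4).
Proof.
move=> p01 lep ple; apply: le_trans (prob_between p01 _ _ _).
have /andP[p0 p1] := p01; have Y8 := y8; have ty := root_card_ge.
have y4 : y ^+ 4 = y ^+ 3 * y by rewrite exprSr.
have y5 : y ^+ 5 = y ^+ 3 * y * y by rewrite !exprSr.
have qd0 : 0 < q ^+ d by rewrite exprn_gt0.
have low : random_subset_prob p (fun S : {set T} => (alpha S)%:R < t / y ^+ 4) <= (16 * d.+1%:R + 4) / y.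
  set p2 := t / y ^+ 3 / q ^+ d in lep.
  have p20 : 0 <= p2 by rewrite !divr_ge0 // ltW.
  have p201 : 0 <= p2 <= 1 by rewrite p20 (le_trans lep).
  have m2 : p2 * q ^+ d = t / y ^+ 3 by rewrite divfK // gt_eqF.
  have l1 : random_subset_prob p2 (fun S : {set T} => (alpha S)%:R < 8^-1 * (p2 * q ^+ d)) <= (16 * d.+1%:R + 4) / y.
    apply: sparse_lower => //; rewrite m2; last by rewrite divfK // gt_eqF.
    rewrite ler_pdivlMr //; apply: le_trans ty; rewrite y5 mulrC ler_wpM2r ?(ltW y0) //.
    by rewrite ler_peMr ?(ltW y30) //; lra.
  have l2 : random_subset_prob p2 (fun S : {set T} => t / y ^+ 4 <= (alpha S)%:R) <=
      random_subset_prob p (fun S : {set T} => t / y ^+ 4 <= (alpha S)%:R).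
    apply: prob_increasing => //; first by rewrite p20.
    by move=> S S' SS' /le_trans; apply; rewrite ler_nat alpha_subset.
  rewrite (prob_compl p2) (prob_compl p) in l2.
  have e1 r : random_subset_prob r (predC (fun S : {set T} => t / y ^+ 4 <= (alpha S)%:R)) =
      random_subset_prob r (fun S : {set T} => (alpha S)%:R < t / y ^+ 4).
    by apply: eq_bigl => S; rewrite /= ltNge.
  rewrite !e1 in l2.
  have l3 : random_subset_prob p2 (fun S : {set T} => (alpha S)%:R < t / y ^+ 4) <=
      random_subset_prob p2 (fun S : {set T} => (alpha S)%:R < 8^-1 * (p2 * q ^+ d)).
    apply: prob_mono => // S /lt_le_trans; apply; rewrite m2 y4 invfM mulrA mulrC ler_wpM2r //.
      by rewrite divr_ge0 ?ltW.
    by rewrite lef_pV2 ?posrE.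
  lra.
have up : random_subset_prob p (fun S : {set T} => t * y ^+ 4 < (alpha S)%:R) <= y^-1.
  set p1' := t * y ^+ 3 / q in ple.
  have pq : p1' * q = t * y ^+ 3 by rewrite divfK // gt_eqF.
  (* The right endpoint is a probability because t y^3 <= t^2 <= t^d = q. *)
  have p1'01 : 0 <= p1' <= 1.
    rewrite (le_trans p0 ple) ler_pdivrMr // mul1r.
    have t1 : 1 <= t by apply: le_trans ty; apply: exprn_ege1; lra.
    apply: (@le_trans _ _ (t ^+ 2)); last by rewrite -[leRHS]td ler_weXn2l.
    rewrite expr2 ler_wpM2l ?(ltW t0) //; apply: le_trans ty.
    by rewrite y5 -mulrA ler_peMr ?(ltW y30) //; nra.
  have [_ l1] := dense_upper p1'01 (eq_ind _ (fun x => x <= p1' * q) (lexx _) _ pq).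
  have l2 : random_subset_prob p (fun S : {set T} => t * y ^+ 4 < (alpha S)%:R) <=
      random_subset_prob p1' (fun S : {set T} => t * y ^+ 4 < (alpha S)%:R).
    apply: prob_increasing; [by rewrite p0|by case/andP: p1'01|].
    by move=> S S' SS' /lt_le_trans; apply; rewrite ler_nat alpha_subset.
  apply: (le_trans l2); apply: le_trans l1; apply: prob_mono => // S; apply: le_lt_trans.
  by rewrite pq y4 [leRHS]mulrA [leRHS]mulrC ler_wpM2r ?yc // mulr_ge0 ?(ltW t0) ?(ltW y30).
have -> : (16 * d.+1%:R + 5) / y = (16 * d.+1%:R + 4) / y + y^-1 by field; rewrite gt_eqF.
lra.
Qed.

End Ranges.

From mathcomp Require Import all_classical all_reals all_analysis.
Import numFieldNormedType.Exports.

(** An error explicit in [q] alone gives the limit along every admissible set of prime powers at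
    once. *)
Lemma tends_to_1_of_bound (R : realType) (D : nat -> Prop) (u : nat -> R) (C y0 : R) : 0 <= C ->
  (forall q, prime_powers q -> D q -> y0 <= ln q%:R -> 1 - C / ln q%:R <= u q <= 1) ->
  tends_to_1_along D u.
Proof.
move=> C0 H Q _ QD; apply/cvgrPdist_lt => e e0.
have [n n1 _] := @natural_above R (expR (Num.max y0 (C / e + 1))) (expR_ge0 _).
exists n => // q /= nq Qq; have [pq Dq] := QD q Qq.
have lq : Num.max y0 (C / e + 1) <= ln q%:R.
  rewrite -[leLHS]expRK ler_ln ?posrE ?expR_gt0 //.
    by apply: (le_trans n1); rewrite ler_nat.
  by apply: lt_le_trans (expR_gt0 _) (le_trans n1 _); rewrite ler_nat.
move: lq; rewrite ge_max => /andP[l1 l2]; have /andP[u1 u2] := H q pq Dq l1.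
have Ce : 0 <= C / e by rewrite divr_ge0 // ltW.
have l0 : 0 < ln q%:R :> R by lra.
rewrite ger0_norm; last by lra.
suff : C / ln q%:R < e by lra.
by rewrite ltr_pdivrMr // mulrC -ltr_pdivrMr //; lra.
Qed.

Theorem theorem1p2 (R : realType) (d : nat) (hd : (2 <= d)%N) :
  exists c1 c2 K K' : R,
    [/\ 0 < c1, 0 < c2, 0 < K & 0 < K'] /\
    forall (Fq : nat -> finFieldType)
           (hFq : forall q : nat, prime_powers q -> #|Fq q| = q)
           (p : nat -> R)
           (hp : forall q : nat, prime_powers q -> 0 <= p q <= 1),
    [/\ tends_to_1_along
          (fun q : nat =>
             q%:R `^ (- d%:R) * ln q%:R `^ K <= p q
               <= q%:R `^ (- d%:R + d%:R^-1) * ln q%:R `^ (- K))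
          (fun q : nat => random_subset_prob (p q)
             (fun S : {set 'rV[Fq q]_d} =>
                c1 * (p q * q%:R ^+ d) <= (alpha S)%:R
                  <= c2 * (p q * q%:R ^+ d))),
        tends_to_1_along
          (fun q : nat =>
             q%:R `^ (- d%:R + d%:R^-1) * ln q%:R `^ (- K) <= p q
               <= q%:R `^ (- 1 + d%:R^-1) * ln q%:R `^ K)
          (fun q : nat => random_subset_prob (p q)
             (fun S : {set 'rV[Fq q]_d} =>
                q%:R `^ d%:R^-1 * ln q%:R `^ (- K') <= (alpha S)%:R
                  <= q%:R `^ d%:R^-1 * ln q%:R `^ K'))
      & tends_to_1_along
          (fun q : nat =>
             q%:R `^ (- 1 + d%:R^-1) * ln q%:R `^ K <= p q <= 1)
          (fun q : nat => random_subset_prob (p q)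
             (fun S : {set 'rV[Fq q]_d} =>
                c1 * (p q * q%:R) <= (alpha S)%:R <= c2 * (p q * q%:R)))].
Proof.
have [c2 [K1 [c24 K10 Hup]]] := @prob_alpha_gt_linear R d hd.
(* K = 3 because ln^3 q must exceed the K1 ln^2 q of the containers; K' = 4 leaves one more
   logarithm for the constants at the endpoints. *)
exists 8^-1, c2, 3%:R, 4%:R; split; first by split => //; apply: lt_le_trans c24.
move=> Fq hFq p hp.
(* The threshold on ln q collects the four largeness assumptions on y in the lemmas on the
   ranges. *)
pose y0 : R := Num.max (Num.max (8 * d.+1%:R) K1) (Num.max c2 ((6 * d%:R) ^+ 6)).
pose C : R := 16 * d.+1%:R + 5.
have C0 : 0 <= C by rewrite addr_ge0 ?mulr_ge0.
have C5 : 5 <= C by rewrite lerDr mulr_ge0.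
have d0 : d%:R != 0 :> R by rewrite pnatr_eq0 -lt0n ltnW.
have facts q : prime_powers q -> y0 <= ln q%:R -> [/\ 8 * d.+1%:R <= ln q%:R :> R, K1 <= ln q%:R, c2 <= ln q%:R,
     (6 * d%:R) ^+ 6 <= ln q%:R :> R & [/\ 0 < ln q%:R :> R, 0 < q%:R :> R &
     forall a : R, q%:R `^ a = expR (a * ln q%:R)]].
  move=> pq; rewrite !ge_max => /andP[/andP[h1 h2] /andP[h3 h4]]; split => //.
  have l0 : 0 < ln q%:R :> R by apply: lt_le_trans h3; apply: lt_le_trans c24.
  have q0 : 0 < q%:R :> R.
    by rewrite ltr0n lt0n; apply: contraTneq l0 => ->; rewrite ln0 ?ltxx.
  by split => // a; rewrite /powR gt_eqF.
have pw q (y : R) : 0 < q%:R :> R -> y = ln q%:R ->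
    [/\ expR (- d%:R * y) = (q%:R ^+ d)^-1,
        expR ((- d%:R + d%:R^-1) * y) = expR (y / d%:R) / q%:R ^+ d,
        expR ((- 1 + d%:R^-1) * y) = expR (y / d%:R) / q%:R &
        expR (d%:R^-1 * y) = expR (y / d%:R)].
  move=> q0 yq; have qy : expR y = q%:R by rewrite yq lnK.
  have dy : expR (- d%:R * y) = (q%:R ^+ d)^-1 by rewrite mulNr expRN expRM_natl qy.
  split => //; last by rewrite mulrC.
    by rewrite mulrDl expRD dy mulrC [d%:R^-1 * y]mulrC.
  by rewrite mulrDl expRD mulN1r expRN qy mulrC [d%:R^-1 * y]mulrC.
have lnpow q (n : nat) : 0 < ln q%:R :> R ->
    ln q%:R `^ n%:R = ln q%:R ^+ n :> R /\ ln q%:R `^ (- n%:R) = (ln q%:R ^+ n)^-1 :> R.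
  by move=> l0; rewrite powRN powR_mulrn // ltW.
split.
- apply: (@tends_to_1_of_bound _ _ _ C y0) => // q pq Dq yq.
  have [h1 h2 h3 h4 [l0 q0 pE]] := facts q pq yq.
  have [e1 e2 e3 e4] := pw q _ q0 erefl; have [n1 n2] := lnpow q 3%N l0.
  have E := hFq q pq; have p01 := hp q pq.
  rewrite !pE e1 e2 n1 n2 in Dq; case/andP: Dq => D1 D2.
  have qd0 : 0 < q%:R ^+ d :> R by rewrite exprn_gt0.
  have := @sparse_range R d hd c2 c24 (Fq q); rewrite E => /(_ h1 (p q) p01) H.
  rewrite prob_le1 // andbT; apply: H.
    by move: D1; rewrite mulrC ler_pdivrMr.
  by move: D2; rewrite mulrAC ler_pdivlMr // ler_pdivlMr ?exprn_gt0 // mulrAC.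
- apply: (@tends_to_1_of_bound _ _ _ C y0) => // q pq Dq yq.
  have [h1 h2 h3 h4 [l0 q0 pE]] := facts q pq yq.
  have [e1 e2 e3 e4] := pw q _ q0 erefl; have [n1 n2] := lnpow q 3%N l0; have [m1 m2] := lnpow q 4%N l0.
  have E := hFq q pq; have p01 := hp q pq.
  rewrite !pE e2 e3 n1 n2 in Dq; case/andP: Dq => D1 D2.
  have := @middle_range R d hd c2 K1 Hup (Fq q); rewrite E => /(_ h1 h2 h3 h4 (p q) p01) H.
  rewrite prob_le1 // andbT !pE e4 m1 m2; apply: H.
    by rewrite mulrAC.
  by rewrite mulrAC.
apply: (@tends_to_1_of_bound _ _ _ C y0) => // q pq Dq yq.
have [h1 h2 h3 h4 [l0 q0 pE]] := facts q pq yq.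
have [e1 e2 e3 e4] := pw q _ q0 erefl; have [n1 n2] := lnpow q 3%N l0.
have E := hFq q pq; have p01 := hp q pq.
rewrite !pE e3 n1 in Dq; case/andP: Dq => D1 _.
have := @dense_range R d hd c2 K1 Hup (Fq q); rewrite E => /(_ h1 h2 (p q) p01) H.
rewrite prob_le1 // andbT; apply: le_trans (H _).
  by rewrite lerD2l lerN2 ler_wpM2r // invr_ge0 ltW.
by rewrite -ler_pdivrMr // mulrAC.
Qed.
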